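(* Let $\xi$ be exponentially stabilizing with respect to $\kappa$ and $A$, and suppose that $\xi$ has a moment of order $p$ (with respect to $\kappa$ and $A$) for every $p\ge 1$. Let $m\in\mathbb{N}$ and let $\Gamma_1,\dots,\Gamma_m$ be fixed pairwise disjoint Borel subsets of $A$ of non-zero Lebesgue measure such that, for each $i$, $|\partial_r(\Gamma_i)|=O(r)$ as $r\downarrow 0$. For $i=1,\dots,m$ let $f_i:\Gamma_i\to\mathbb{R}$ be bounded and Borel-measurable, and set $T_i:=\int_{\Gamma_i} f_i\,\mathrm{d}\mu^\xi_\lambda$ (a random variable depending on $\lambda$). Suppose that there exist constants $C_i\in(0,\infty)$, $i=1,\dots,m$, such that for each $i$, $\mathrm{Var}[T_i]\ge C_i\lambda$ for all $\lambda$ sufficiently large. Let $\varepsilon>0$. Then there exists a constant $C\in(0,\infty)$, depending on $d$, $\xi$, $\kappa$, $\varepsilon$, $\{f_i\}$ and $\{\Gamma_i\}$, such that for all $\lambda\ge 1$, $$\sup_{t_1,\dots,t_m\in\mathbb{R}}\left|\mathbb{P}\left[\bigcap_{i=1}^m\left\{\frac{T_i-\mathbb{E}[T_i]}{(\mathrm{Var}[T_i])^{1/2}}\le t_i\right\}\right]-\prod_{i=1}^m\Phi(t_i)\right|\le C\lambda^{-1/(2d+\varepsilon)}.$$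
   Context: Let $d\in\mathbb{N}$. Let $(\mathcal{M},\mathcal{F}_{\mathcal{M}},\mathbb{P}_{\mathcal{M}})$ be a probability space (the mark space). $\xi(x,s;\mathcal{X})$ is a measurable $[0,\infty)$-valued function defined for all finite $\mathcal{X}\subset\mathbb{R}^d\times\mathcal{M}$ and all $(x,s)\in\mathcal{X}$; if $(x,s)\notin\mathcal{X}$, $\xi(x,s;\mathcal{X})$ means $\xi(x,s;\mathcal{X}\cup\{(x,s)\})$. For $y\in\mathbb{R}^d$, $a>0$, put $y+a\mathcal{X}:=\{(y+ax,s):(x,s)\in\mathcal{X}\}$. For $\lambda>0$ let $\xi_\lambda(x,s;\mathcal{X}):=\xi(x,s;x+\lambda^{1/d}(-x+\mathcal{X}))$. $\kappa$ is a bounded probability density function on $\mathbb{R}^d$ with compact support $A\subset\mathbb{R}^d$ of non-zero Lebesgue measure. For $\lambda>0$, $\mathcal{P}_\lambda$ is a Poisson point process in $\mathbb{R}^d\times\mathcal{M}$ with intensity measure $(\lambda\kappa(x)\,\mathrm{d}x)\times\mathbb{P}_{\mathcal{M}}(\mathrm{d}s)$. $U$ is a random element of $\mathcal{M}$ with distribution $\mathbb{P}_{\mathcal{M}}$, independent of $\mathcal{P}_\lambda$. $B_r(x)$ is the Euclidean ball of radius $r$ centred at $x$. $\xi$ is exponentially stabilizing with respect to $\kappa$ and $A$ if for all $\lambda\ge1$ and $x\in A$ there is an almost surely finite random variable $R=R(x,\lambda)$ (a radius of stabilization for $\xi$ at $x$) such that $$\xi_\lambda\big(x,U;[\mathcal{P}_\lambda\cap(B_{\lambda^{-1/d}R}(x)\times\mathcal{M})]\cup\mathcal{X}\big)=\xi_\lambda\big(x,U;\mathcal{P}_\lambda\cap(B_{\lambda^{-1/d}R}(x)\times\mathcal{M})\big)$$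 for all finite $\mathcal{X}\subset(A\setminus B_{\lambda^{-1/d}R}(x))\times\mathcal{M}$, and moreover $\limsup_{t\to\infty}t^{-1}\log\big(\sup_{\lambda\ge1,x\in A}\mathbb{P}[R(x,\lambda)>t]\big)<0$. $\xi$ has a moment of order $p>0$ (with respect to $\kappa$ and $A$) if $\sup_{\lambda\ge1,x\in A}\mathbb{E}[|\xi_\lambda(x,U;\mathcal{P}_\lambda)|^p]<\infty$. The random measure $\mu^\xi_\lambda$ on $\mathbb{R}^d$ is $\mu^\xi_\lambda:=\sum_{(x,s)\in\mathcal{P}_\lambda\cap(A\times\mathcal{M})}\xi_\lambda(x,s;\mathcal{P}_\lambda)\,\delta_x$, with $\delta_x$ the unit point mass at $x$. $|B|$ is the $d$-dimensional Lebesgue measure of $B$; $\partial B$ is the boundary of $B$; for $r>0$, $\partial_r(B):=\{x\in\mathbb{R}^d:\inf_{y\in\partial B}\|x-y\|_\infty\le r\}$. $\Phi$ is the standard normal distribution function on $\mathbb{R}$. *)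

(* Defs.v *)
From HB Require Import structures.
From mathcomp Require Import all_boot all_order all_algebra finmap.
From mathcomp Require Import all_classical all_reals all_analysis.
From mathcomp Require Import measurable_realfun.

Set Implicit Arguments.
Unset Strict Implicit.
Unset Printing Implicit Defensive.

Import Order.TTheory GRing.Theory Num.Theory.
Import numFieldNormedType.Exports.

Local Open Scope classical_set_scope.
Local Open Scope ring_scope.

(* 'rV[R]_n is equipped with its Borel sigma-algebra. *)
Section borel_rV.
Context (R : realType) (n : nat).

HB.instance Definition _ := @isMeasurable.Build
  (sigma_display (@open 'rV[R]_n)) 'rV[R]_n <<s @open 'rV[R]_n >>
  (@sigma_algebra0 _ setT (@open 'rV[R]_n))
  (@sigma_algebraC _ (@open 'rV[R]_n))
  (@sigma_algebra_bigcup _ setT (@open 'rV[R]_n)).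

Lemma open_measurable_rV (A : set 'rV[R]_n) : open A -> measurable A.
Proof. by move=> oA; exact: sub_sigma_algebra. Qed.

Lemma continuous_measurable_rV (f : 'rV[R]_n -> R) :
  continuous f -> measurable_fun setT f.
Proof.
move=> cf; apply: (measurability _ (RGenOpens.measurableE R)).
move=> _ [_ [a [b ->]] <-]; rewrite setTI.
apply: open_measurable_rV; move/continuousP : cf; apply.
exact: interval_open.
Qed.

Lemma measurable_coord_rV (i : 'I_n) :
  measurable_fun setT (fun v : 'rV[R]_n => v ord0 i).
Proof. by apply: continuous_measurable_rV => x; exact: coord_continuous. Qed.

Definition rat_box (q : 'rV[rat]_n) (k : nat) : set 'rV[R]_n :=
  [set v | forall i, `|v ord0 i - ratr (q ord0 i)| < k.+1%:R^-1].

Lemma open_bigcup_rat_box (U : set 'rV[R]_n) : open U ->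
  U = \bigcup_(p in [set p : 'rV[rat]_n * nat | rat_box p.1 p.2 `<=` U])
        rat_box p.1 p.2.
Proof.
move=> oU; apply/seteqP; split=> [v Uv|v [p pU]]; last exact: pU.
have /nbhs_ballP[e /= e0 eU] : nbhs v U by move: oU; rewrite openE => /(_ _ Uv).
have [k ke] : exists k : nat, k.+1%:R^-1 < e / 2.
  have e20 : 0 < e / 2 by rewrite divr_gt0.
  exists (Num.truncn (e / 2)^-1).
  rewrite invf_plt ?posrE// ?ltr0n//.
  by rewrite truncnS_gt.
have k0 : 0 < k.+1%:R^-1 :> R by rewrite invr_gt0 ltr0n.
have /choice[q qv] : forall i, exists q : rat,
    `|v ord0 i - ratr q| < k.+1%:R^-1.
  move=> i; have [q] : exists q : rat, ratr q \in `](v ord0 i - k.+1%:R^-1), (v ord0 i + k.+1%:R^-1)[.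
    have lt : v ord0 i - k.+1%:R^-1 < v ord0 i + k.+1%:R^-1.
      by rewrite ltrD2l gtrN.
    by have [q qi] := rat_in_itvoo lt; exists q.
  by rewrite in_itv/= => qi; exists q; rewrite distrC ltr_distl.
have bv : rat_box (\row_i q i) k v by move=> i; rewrite mxE.
exists (\row_i q i, k) => //= w bw; apply: eU; split => // i j.
rewrite ord1 /ball/= (le_lt_trans (ler_distD (ratr (q j)) _ _))//.
rewrite [ltRHS]splitr ltrD// (lt_trans _ ke)//.
by rewrite distrC; have := bw j; rewrite mxE.
Qed.

Lemma measurable_rat_box q k : measurable (rat_box q k).
Proof.
rewrite (_ : rat_box q k = \bigcap_(i in [set: 'I_n])
    [set v : 'rV[R]_n | `|v ord0 i - ratr (q ord0 i)| < k.+1%:R^-1]); last first.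
  by apply/seteqP; split=> v /= => [bv i _|bv i]; exact: bv.
apply: fin_bigcap_measurable => [|i _]; first exact: finite_finset.
have mf : measurable_fun setT
    (fun v : 'rV[R]_n => `|v ord0 i - ratr (q ord0 i)|).
  apply: measurableT_comp => //; apply: measurable_funB => //.
  exact: measurable_coord_rV.
have := mf measurableT _ (measurable_itv `]-oo, k.+1%:R^-1[).
by rewrite setTI; congr measurable.
Qed.

Lemma measurable_fun_rVP d (T : measurableType d) (f : T -> 'rV[R]_n) :
  (forall i, measurable_fun setT (fun x => f x ord0 i)) ->
  measurable_fun setT f.
Proof.
move=> mf; apply: (@measurability _ _ T 'rV[R]_n setT f (@open 'rV[R]_n) erefl) => _ [U oU <-]; rewrite setTI.
rewrite (open_bigcup_rat_box oU) preimage_bigcup bigcup_mkcond.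
apply: countable_bigcupT_measurable => [|p]; first exact: countableP.
case: ifPn => // _; rewrite (_ : _ @^-1` _ = \bigcap_(i in [set: 'I_n])
    [set x | `|f x ord0 i - ratr (p.1 ord0 i)| < p.2.+1%:R^-1]); last first.
  by apply/seteqP; split=> v /= => [bv i _|bv i]; exact: bv.
apply: fin_bigcap_measurable => [|i _]; first exact: finite_finset.
have mg : measurable_fun setT (fun x => `|f x ord0 i - ratr (p.1 ord0 i)|).
  by apply: measurableT_comp => //; exact: measurable_funB.
have := mg measurableT _ (measurable_itv `]-oo, p.2.+1%:R^-1[).
by rewrite setTI; congr measurable.
Qed.

End borel_rV.

Section lebesgue_rV.
Context (R : realType).

Definition cons_rV n (z : measurableTypeR R * 'rV[R]_n) : 'rV[R]_n.+1 :=
  row_mx (z.1%:M : 'rV[R]_1) z.2.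

Definition uncons_rV n (v : 'rV[R]_n.+1) : measurableTypeR R * 'rV[R]_n :=
  (v ord0 ord0, \row_i v ord0 (lift ord0 i)).

Lemma cons_rV0 n (z : measurableTypeR R * 'rV[R]_n) : cons_rV z ord0 ord0 = z.1.
Proof.
rewrite /cons_rV (_ : (ord0 : 'I_n.+1) = lshift n (ord0 : 'I_1)); last first.
  exact: val_inj.
by rewrite (@row_mxEl _ _ 1) mxE eqxx mulr1n.
Qed.

Lemma cons_rVS n (z : measurableTypeR R * 'rV[R]_n) i :
  cons_rV z ord0 (lift ord0 i) = z.2 ord0 i.
Proof.
rewrite /cons_rV (_ : lift ord0 i = rshift 1 i); last exact: val_inj.
by rewrite (@row_mxEr _ _ 1).
Qed.

Lemma cons_rVK n : cancel (@cons_rV n) (@uncons_rV n).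
Proof.
move=> [x v]; rewrite /uncons_rV cons_rV0; congr pair.
by apply/rowP => i; rewrite mxE cons_rVS.
Qed.

Lemma measurable_cons_rV n : measurable_fun setT (@cons_rV n).
Proof.
apply: measurable_fun_rVP => i; have [j ->|->] := unliftP ord0 i.
  under eq_fun do rewrite cons_rVS.
  by apply: (measurableT_comp (@measurable_coord_rV R n j)).
under eq_fun do rewrite cons_rV0.
exact: measurable_fst.
Qed.

Lemma measurable_uncons_rV n : measurable_fun setT (@uncons_rV n).
Proof.
apply/measurable_fun_pairP; split; first exact: measurable_coord_rV.
apply: measurable_fun_rVP => i; under eq_fun do rewrite mxE.
exact: measurable_coord_rV.
Qed.

Section cons_measure.
Context n (mu : {sigma_finite_measure set 'rV[R]_n -> \bar R}).

Definition cons_measure : set 'rV[R]_n.+1 -> \bar R :=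
  pushforward (@lebesgue_measure R \x mu)%E (@cons_rV n).

Let cons_measure0 : cons_measure set0 = 0%E.
Proof. by rewrite /cons_measure /pushforward preimage_set0 measure0. Qed.

Let cons_measure_ge0 A : (0 <= cons_measure A)%E.
Proof. by rewrite /cons_measure /pushforward; exact: measure_ge0. Qed.

Let measurable_preimage_cons_rV (A : set 'rV[R]_n.+1) :
  measurable A -> measurable (@cons_rV n @^-1` A).
Proof.
by move=> mA; rewrite -[_ @^-1` _]setTI; exact: measurable_cons_rV.
Qed.

Let cons_measure_sigma_additive : semi_sigma_additive cons_measure.
Proof.
move=> F mF tF mUF; rewrite /cons_measure /pushforward preimage_bigcup.
apply: measure_semi_sigma_additive => [i||].
- exact: measurable_preimage_cons_rV.
- apply/trivIsetP => i j _ _ ij; rewrite -preimage_setI.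
  by move/trivIsetP : tF => /(_ _ _ _ _ ij) -> //; rewrite preimage_set0.
- by rewrite -preimage_bigcup; exact: measurable_preimage_cons_rV.
Qed.

HB.instance Definition _ := isMeasure.Build _ _ _ cons_measure
  cons_measure0 cons_measure_ge0 cons_measure_sigma_additive.

Let cons_measure_sigma_finite : sigma_finite setT cons_measure.
Proof.
have /sigma_finiteP[F [TF ndF mF]] := sigma_finiteT (@lebesgue_measure R).
have /sigma_finiteP[G [TG ndG mG]] := sigma_finiteT mu.
exists (fun k => @uncons_rV n @^-1` (F k `*` G k)) => [|k].
  rewrite -preimage_bigcup; apply/seteqP; split=> // v _ /=.
  have [i _ Fi] : (\bigcup_i F i) (uncons_rV v).1 by rewrite -TF.
  have [j _ Gj] : (\bigcup_i G i) (uncons_rV v).2 by rewrite -TG.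
  exists (maxn i j) => //; split.
  - by move: (_ v).1 Fi; exact/subsetPset/ndF/leq_maxl.
  - by move: (_ v).2 Gj; exact/subsetPset/ndG/leq_maxr.
have [mFk Fkoo] := mF k; have [mGk Gkoo] := mG k; split.
  rewrite -[_ @^-1` _]setTI; apply: measurable_uncons_rV => //.
  exact: measurableX.
rewrite /cons_measure /pushforward -comp_preimage.
rewrite (_ : _ \o _ = id); last by apply/funext => z; exact: cons_rVK.
by rewrite preimage_id product_measure1E// lte_mul_pinfty// ge0_fin_numE.
Qed.

HB.instance Definition _ := Measure_isSigmaFinite.Build _ _ _ cons_measure
  cons_measure_sigma_finite.

End cons_measure.

(* Iterated product of the Lebesgue measure on R; lebesgue_rV_box computes it on
   boxes. *)
Fixpoint lebesgue_rV n : {sigma_finite_measure set 'rV[R]_n -> \bar R} :=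
  match n with
  | 0 => \d_(0 : 'rV[R]_0)
  | n'.+1 => cons_measure (lebesgue_rV n')
  end.

Lemma lebesgue_rV_box n (a b : 'rV[R]_n) : (forall i, a ord0 i <= b ord0 i) ->
  lebesgue_rV n [set v | forall i, a ord0 i < v ord0 i <= b ord0 i] =
  (\prod_i (b ord0 i - a ord0 i))%:E.
Proof.
elim: n a b => [|n IH] a b ab.
  rewrite big_ord0 /= diracE mem_set// => i.
  by case: i.
transitivity ((@lebesgue_measure R \x lebesgue_rV n)%E (@cons_rV n @^-1`
  [set v | forall i, a ord0 i < v ord0 i <= b ord0 i])); first by [].
rewrite (_ : @cons_rV n @^-1` [set v | forall i, a ord0 i < v ord0 i <= b ord0 i]
   = (`]a ord0 ord0, b ord0 ord0] : set (measurableTypeR R)) `*`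
   [set v : 'rV[R]_n | forall i, (uncons_rV a).2 ord0 i < v ord0 i <= (uncons_rV b).2 ord0 i]); last first.
  apply/seteqP; split=> -[x v] /=.
    move=> h; split; first by have := h ord0; rewrite cons_rV0 in_itv.
    by move=> i; have := h (lift ord0 i); rewrite cons_rVS !mxE.
  rewrite in_itv /= => -[h0 h] i; have [j ->|->] := unliftP ord0 i.
    by have := h j; rewrite cons_rVS !mxE.
  by rewrite cons_rV0.
rewrite product_measure1E//; last first.
  rewrite (_ : [set v | _] = \bigcap_(i in [set: 'I_n]) [set v : 'rV[R]_n |
     (uncons_rV a).2 ord0 i < v ord0 i <= (uncons_rV b).2 ord0 i]); last first.
    by apply/seteqP; split=> v /= => [bv i _|bv i]; exact: bv.
  apply: fin_bigcap_measurable => [|i _]; first exact: finite_finset.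
  have := @measurable_coord_rV R n i measurableT _
    (measurable_itv `](uncons_rV a).2 ord0 i, (uncons_rV b).2 ord0 i]).
  by rewrite setTI; congr measurable.
rewrite IH; last by move=> i; rewrite !mxE.
have := lebesgue_measure_itv `]a ord0 ord0, b ord0 ord0].
rewrite big_ord_recl EFinM /= => ->; congr (_ * _)%E.
  rewrite lte_fin; have := ab ord0.
  by rewrite le_eqVlt => /orP[/eqP ->|->]; rewrite ?ltxx ?subrr ?EFinB.
by congr EFin; apply: eq_bigr => i _; rewrite !mxE.
Qed.

End lebesgue_rV.

Section rV_geometry.
Context (R : realType) (n : nat).
Implicit Types (x y : 'rV[R]_n) (B : set 'rV[R]_n).

Definition enorm x : R := Num.sqrt (\sum_i x ord0 i ^+ 2).

(* The radius is extended, so that the ball of radius +oo is the whole space. *)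
Definition eball x (r : \bar R) : set 'rV[R]_n :=
  [set y | ((enorm (y - x))%:E <= r)%E].

Definition boundary B : set 'rV[R]_n := closure B `\` interior B.

(* `|_| is the sup norm on 'rV[R]_n. *)
Definition boundary_nbhd (r : R) B : set 'rV[R]_n :=
  [set x | (ereal_inf [set `|x - y|%:E | y in boundary B] <= r%:E)%E].

End rV_geometry.

Section configurations.
Context d (E : measurableType d).

Definition npoints (X : {fset E}) (B : set E) : nat :=
  #|` [fset z in X | z \in B]%fset |.

Definition counting_events : set (set {fset E}) :=
  [set C | exists (B : set E) (k : nat),
     measurable B /\ C = [set X | npoints X B = k]].

HB.instance Definition _ := @isMeasurable.Build
  (sigma_display counting_events) {fset E} <<s counting_events >>
  (@sigma_algebra0 _ setT counting_events)
  (@sigma_algebraC _ counting_events)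
  (@sigma_algebra_bigcup _ setT counting_events).

End configurations.

Section poisson_process.
Context dO (Omega : measurableType dO) (R : realType) (P : probability Omega R).

(* The second argument of poisson_prob is a dummy; poisson_prob, unlike
   poisson_pmf, is the Dirac mass at 0 when the rate is 0. *)
Definition poisson_process d (E : measurableType d)
    (L : set E -> \bar R) (X : {RV P >-> {fset E}}) : Prop :=
  (forall B, measurable B -> forall k : nat,
     P [set w | npoints (X w) B = k] = poisson_prob (fine (L B)) 0 [set k]) /\
  (forall (q : nat) (B : 'I_q -> set E) (k : 'I_q -> nat),
     (forall i, measurable (B i)) -> trivIset setT B ->
     P (\bigcap_(i in setT) [set w | npoints (X w) (B i) = k i]) =
     (\prod_(i < q) P [set w | npoints (X w) (B i) = k i])%E).

Definition independent_RV d1 d2 (T1 : measurableType d1)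
    (T2 : measurableType d2) (X : {RV P >-> T1}) (Y : {RV P >-> T2}) : Prop :=
  forall A B, measurable A -> measurable B ->
    P (X @^-1` A `&` Y @^-1` B) = (P (X @^-1` A) * P (Y @^-1` B))%E.

End poisson_process.

Section marked_functional.
Context (R : realType) (d : nat) dM (M : measurableType dM).
Local Notation space := 'rV[R]_d.
Local Notation config := {fset (space * M)}.
Variable xi : space -> M -> config -> {nonneg R}.
Implicit Types (x y : space) (s : M) (X : config) (A B : set space) (l : R).

(* Measurability of xi on its domain {(x, s, X) | (x, s) \in X}, with respect to
   the trace of the product sigma-algebra; the domain itself need not be
   measurable for a general mark space, so that measurable_fun cannot be used. *)
Definition measurable_functional : Prop :=
  let D := [set t : (space * M) * config | t.1 \in t.2] in
  preimage_set_system D (fun t => (xi t.1.1 t.1.2 t.2)%:num) measurable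
    `<=` preimage_set_system D id measurable.

(* The values of xi x s X for (x, s) \notin X are never used. *)
Definition xi_add x s X : {nonneg R} := xi x s ((x, s) |` X)%fset.

Definition affine_config y (a : R) X : config :=
  [fset ((y + a *: z.1)%R, z.2) | z in X]%fset.

Definition xi_scaled l x s X : {nonneg R} :=
  xi_add x s (affine_config x (l `^ d%:R^-1) (affine_config (- x) 1 X)).

Definition restrict_config X B : config := [fset z in X | z.1 \in B]%fset.

Definition xi_measure A l X : set space -> \bar R := fun B =>
  (\sum_(z <- X | z.1 \in A) (xi_scaled l z.1 z.2 X)%:num%:E * \d_(z.1) B)%E.

Section xi_measure_measure.
Variables (A : set space) (l : R) (X : config).

Let xi_measure0 : xi_measure A l X set0 = 0%E.
Proof. by rewrite /xi_measure big1// => z _; rewrite measure0 mule0. Qed.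

Let xi_measure_ge0 B : (0 <= xi_measure A l X B)%E.
Proof. by apply: sume_ge0 => z _; rewrite mule_ge0. Qed.

Let xi_measure_sigma_additive : semi_sigma_additive (xi_measure A l X).
Proof.
move=> F mF tF mUF; rewrite /xi_measure.
pose m (k : nat) : {measure set space -> \bar R} :=
  let z := nth point X k in
  if z.1 \in A then
    (mscale (xi_scaled l z.1 z.2 X) \d_(z.1) : {measure set space -> \bar R})
  else (mzero : {measure set space -> \bar R}).
have mE B : (\sum_(z <- X | z.1 \in A)
    (xi_scaled l z.1 z.2 X)%:num%:E * \d_(z.1) B)%E = msum m (size X) B.
  rewrite (big_nth point) big_mkcond /= big_mkord; apply: eq_bigr => k _.
  by rewrite /m; case: ifPn.
under eq_fun do under eq_bigr do rewrite mE.
by rewrite mE; exact: measure_semi_sigma_additive.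
Qed.

HB.instance Definition _ := isMeasure.Build _ _ _ (xi_measure A l X)
  xi_measure0 xi_measure_ge0 xi_measure_sigma_additive.

End xi_measure_measure.

Context (PM : probability M R) (kappa : space -> R).

Definition intensity l : set (space * M) -> \bar R :=
  ((fun B => \int[lebesgue_rV R d]_(x in B) (l * kappa x)%:E) \x PM)%E.

Context dO (Omega : measurableType dO) (P : probability Omega R)
  (PP : R -> {RV P >-> config}) (U : {RV P >-> M}) (A : set space).

(* Since a radius of stabilization may take the value +oo on a null event, for
   which the defining identity is void, it is equivalent to require this identity
   surely or almost surely. *)
Definition stabilization_radius l x (rad : {RV P >-> \bar R}) : Prop :=
  [/\ forall w, (0 <= rad w)%E,
      {ae P, forall w, (rad w < +oo)%E} &
      forall w (Y : config),
        let B := eball x ((l `^ (- d%:R^-1))%:E * rad w)%E in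
        (forall z, z \in Y -> (A `\` B) z.1) ->
        xi_scaled l x (U w) (restrict_config (PP l w) B `|` Y)%fset =
        xi_scaled l x (U w) (restrict_config (PP l w) B)].

Definition exponentially_stabilizing : Prop :=
  exists rad : R -> space -> {RV P >-> \bar R},
    (forall l x, 1 <= l -> A x -> stabilization_radius l x (rad l x)) /\
    (limf_esup (fun t : R => t^-1%:E *
        lne (ereal_sup [set P [set w | t%:E < rad p.1 p.2 w] |
                         p in [set p : R * space | (1 <= p.1)%R /\ A p.2]]))
      +oo%R < 0)%E.

Definition has_moment (p : R) : Prop :=
  (ereal_sup [set 'E_P[(fun w =>
                 `|(xi_scaled q.1 q.2 (U w) (PP q.1 w))%:num| `^ p)%R] |
      q in [set q : R * space | (1 <= q.1)%R /\ A q.2]] < +oo)%E.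

Definition xi_integral (G : set space) (f : space -> R) l : Omega -> R :=
  fun w => \int[xi_measure A l (PP l w)]_(x in G) f x.

End marked_functional.

Definition std_normal_cdf (R : realType) (t : R) : R :=
  fine (normal_prob 0 1 `]-oo, t]).

(* Main.v *)
(* The space is cut into cells of side s = l^(delta - 1/d), a little larger than
   the typical radius of stabilization.  Off an event of probability O(l^(-q))
   for every q, all radii of stabilization are at most s, all scores are at most
   l^delta and no cell contains more than l^((d+1) delta) points; then T_i is a
   sum of bounded cell contributions, each of which depends only on the Poisson
   points in the neighbouring cells.  The contributions of the cells all of whose
   neighbours lie in Gamma_i form a sum S_i, and S_1, ..., S_m are independent
   since the sets Gamma_i are disjoint.  The remaining cells meet a neighbourhood
   of width 3s of the boundary of Gamma_i, so there are at most
   O(s / s^d) = O(l^(1 - 1/d)) of them, and high moments show that, after division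
   by the standard deviation of T_i, their contribution is at most
   l^(-1/(2d) + O(delta)).  This error dominates the rate.  Each S_i is normally
   approximated at rate l^(-1/2 + O(delta)) by Stein's method for locally
   dependent sums, up to the relative error of its variance; the latter is
   l^(-1/(2d) + O(delta)) too. *)
Require Import Defs.
From HB Require Import structures.
From mathcomp Require Import all_boot all_order all_algebra finmap.
From mathcomp Require Import all_classical all_reals all_analysis.
From mathcomp Require Import measurable_realfun ring lra zify.

Set Implicit Arguments.
Unset Strict Implicit.
Unset Printing Implicit Defensive.

Import Order.TTheory GRing.Theory Num.Theory.
Import numFieldNormedType.Exports.

Local Open Scope classical_set_scope.
Local Open Scope ring_scope.

(** * Stein's equation for a smoothed half-line *)

Section gauss.
Context (R : realType).
Local Notation mu := (@lebesgue_measure R).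
Implicit Types (w x z e : R).

(** Stabilization and moments are assumed for a single point, inserted at a fixed location with an
    independent mark, whereas the good event concerns all Poisson points at once. Mecke's formula
    passes from the former to the latter at the cost of a factor l, harmless against tails smaller
    than every power of l. The cell contributions are truncated for every configuration, not only on
    the good event: they are then bounded functions of the neighbouring points without exception, so
    that independence is exact, and the integrals T_i coincide with their sums off the bad event.
    What the bad event adds to mean and variance is controlled by a crude polynomial bound on the
    fourth moment of T_i. Only a lower bound on the variance is assumed, so variances are compared
    up to a relative error. The mark space is arbitrary: neither equality of marks nor the domain of
    the score has to be measurable. Hence points are inserted only where no point has the same
    location, and the score is replaced by a measurable extension of its restriction to its
    domain. *)

Definition gpdf (x : R) : R := normal_pdf 0 1 x.

Lemma gpdfE x : gpdf x = normal_peak 1 * expR (- (x ^+ 2 / 2)).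
Proof.
rewrite /gpdf normal_pdfE ?oner_neq0// /normal_fun subr0 expr1n.
by rewrite mulNr.
Qed.

Lemma gpdf_gt0 x : 0 < gpdf x.
Proof. by rewrite gpdfE mulr_gt0 ?expR_gt0// normal_peak_gt0// oner_neq0. Qed.

Lemma normal_peak1_bounds : 1 / 3 <= normal_peak (1 : R) <= 1.
Proof.
have pi2 := pi_ge2 R; have pi4 := pihalf_lt2 R.
have p4 : pi < 4 :> R by lra.
have s0 : 0 < Num.sqrt (pi *+ 2 : R) by rewrite sqrtr_gt0 mulrn_wgt0 ?pi_gt0.
rewrite /normal_peak expr1n mul1r; apply/andP; split.
  rewrite mul1r lef_pV2 ?posrE//.
  rewrite -[leRHS](@ger0_norm _ 3)// -sqrtr_sqr ler_wsqrtr//.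
  by rewrite -mulr_natr; lra.
rewrite mul1r invf_ple ?posrE// invr1.
rewrite -[leLHS]sqrtr1 ler_wsqrtr// -mulr_natr; lra.
Qed.

Lemma gpdf_le1 x : gpdf x <= 1.
Proof.
have /andP[_ h] := normal_peak1_bounds.
by apply: le_trans h; apply: normal_pdf_ub; rewrite oner_neq0.
Qed.

(** The peak is at least 1/3 and exp(-1/2) at least 1/2. The inverse of this value is the bound 6 of
    [stein_sol_le]. *)
Lemma gpdf_ge x : -1 <= x <= 1 -> 6^-1 <= gpdf x.
Proof.
move=> x1; have /andP[h _] := normal_peak1_bounds.
have e2 : 2^-1 <= expR (- (x ^+ 2 / 2)).
  by apply: le_trans (expR_ge1Dx _); nra.
rewrite gpdfE; apply: le_trans (ler_pM _ _ h e2); lra.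
Qed.

Lemma is_derive_gpdf x : is_derive x 1 gpdf (- (x * gpdf x)).
Proof.
have -> : gpdf = fun x => normal_peak 1 * expR (- (x ^+ 2 / 2)).
  by apply/funext => y; rewrite gpdfE.
have h : is_derive x 1 (fun x : R => - (x ^+ 2 / 2)) (- x).
  apply: is_derive_eq.
  by rewrite /GRing.scale /= !mulr0 add0r !mulr1; lra.
have h2 : is_derive x 1 (fun x => expR (- (x ^+ 2 / 2)))
    (expR (- (x ^+ 2 / 2)) * - x).
  exact: (is_derive1_comp (f := expR)).
apply: is_derive_eq; rewrite /GRing.scale /=; ring.
Qed.

Lemma continuous_gpdf : continuous gpdf.
Proof. by apply: continuous_normal_pdf; rewrite oner_neq0. Qed.

Lemma integrable_gpdf D : measurable D -> mu.-integrable D (EFin \o gpdf).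
Proof.
by move=> mD; apply: integrableS (integrable_normal_pdf 0 1).
Qed.

Local Notation Phi := (@std_normal_cdf R).

Lemma std_normal_cdfE w : Phi w = \int[mu]_(x in `]-oo, w]) gpdf x.
Proof. by []. Qed.

Lemma gpdf_total : \int[mu]_x gpdf x = 1.
Proof. by rewrite /Rintegral integral_normal_pdf. Qed.

Lemma Rintegral_gpdf_le A B : measurable A -> measurable B -> A `<=` B ->
  \int[mu]_(x in A) gpdf x <= \int[mu]_(x in B) gpdf x.
Proof.
move=> mA mB AB; rewrite /Rintegral fine_le//.
- by apply: integrable_fin_num => //; exact: integrable_gpdf.
- by apply: integrable_fin_num => //; exact: integrable_gpdf.
apply: ge0_subset_integral => //.
  apply/measurable_EFinP/measurable_funTS; exact: measurable_normal_pdf.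
by move=> x _; rewrite lee_fin ltW// gpdf_gt0.
Qed.

Lemma setT_itv_split w : [set: R] = `]-oo, w] `|` `]w, +oo[.
Proof.
by rewrite -itv_bndbnd_setU// set_itvE.
Qed.

Lemma Rintegral_split w k : mu.-integrable setT (EFin \o k) ->
  \int[mu]_x k x = \int[mu]_(x in `]-oo, w]) k x + \int[mu]_(x in `]w, +oo[) k x.
Proof.
move=> ik; rewrite {1}(setT_itv_split w) Rintegral_setU//.
- by rewrite -setT_itv_split.
- by apply/disj_setPS => x [] /=; rewrite !in_itv/= andbT => /le_lt_trans h /h; rewrite ltxx.
Qed.

Lemma std_normal_cdf_ge0 w : 0 <= Phi w.
Proof. by rewrite std_normal_cdfE Rintegral_ge0// => x _; exact/ltW/gpdf_gt0. Qed.

Lemma std_normal_cdf_le1 w : Phi w <= 1.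
Proof. by rewrite -gpdf_total std_normal_cdfE Rintegral_gpdf_le. Qed.

(** The density is at most 1; this crude Lipschitz constant is all that smoothing and shifting of
    thresholds require. *)
Lemma std_normal_cdf_lip a b : a <= b -> Phi a <= Phi b <= Phi a + (b - a).
Proof.
move=> ab; rewrite !std_normal_cdfE; apply/andP; split.
  apply: Rintegral_gpdf_le => //; exact: subset_itvl.
have E : [set` `]-oo, b]] = [set` `]-oo, a]] `|` [set` `]a, b]].
  by rewrite -itv_bndbnd_setU.
rewrite E Rintegral_setU//; last 2 first.
- by rewrite -E; exact: integrable_gpdf.
- by apply/disj_setPS => x [] /=; rewrite !in_itv/= => h /andP[/lt_le_trans] /(_ _ h); rewrite ltxx.
have lab : mu `]a, b] = (b - a)%:E.
  rewrite lebesgue_measure_itv /= lte_fin; case: ltP => // ba.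
  by rewrite (@le_anti _ _ a b) ?subrr// ab ba.
rewrite lerD2l; apply: (@le_trans _ _ (\int[mu]_(x in `]a, b]) 1)).
  apply: le_Rintegral => //; first exact: integrable_gpdf.
    apply/integrableP; split; first exact: measurable_cst.
    by rewrite integral_cst//= lab normr1 mul1e ltry.
  by move=> x _; exact: gpdf_le1.
rewrite Rintegral_cst// mul1r le_eqVlt; apply/orP; left; apply/eqP.
exact: (congr1 fine lab).
Qed.

Lemma cvg_gpdfy : gpdf x @[x --> +oo%R] --> (0 : R).
Proof.
have -> : gpdf = fun x => normal_peak 1 * expR (- (x ^+ 2 / 2)).
  by apply/funext => y; rewrite gpdfE.
rewrite -[X in _ --> X](mulr0 (normal_peak 1)); apply: cvgMr.
apply: (cvg_comp (fun x => x ^+ 2 / 2) (fun x => expR (- x))); last exact: cvgr_expR.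
apply: gt0_cvgMly; [lra|exact: cvgr_expr2].
Qed.

Lemma gpdfN x : gpdf (- x) = gpdf x.
Proof. by rewrite !gpdfE sqrrN. Qed.

(** Mills' inequality: [x * gpdf x] is the derivative of [- gpdf], hence has integral [gpdf a] over
    the half-line, on which [a <= x]. *)
Lemma gpdf_tail a : 0 <= a -> a * \int[mu]_(x in `[a, +oo[) gpdf x <= gpdf a.
Proof.
move=> a0.
have E : (\int[mu]_(x in `[a, +oo[) (x * gpdf x)%:E = (gpdf a)%:E)%E.
  rewrite (@ge0_continuous_FTC2y _ (fun x => x * gpdf x) (fun x => - gpdf x) _ 0).
  - by rewrite EFinN sub0e oppeK.
  - by move=> x ax; rewrite mulr_ge0 ?(le_trans a0 ax)// ltW// gpdf_gt0.
  - apply/continuous_subspaceT => x; apply: cvgM; first exact: cvg_id.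
    exact: continuous_gpdf.
  - by rewrite -oppr0; apply: cvgN; exact: cvg_gpdfy.
  - move=> x _; apply: derivableN; have [] := is_derive_gpdf x; done.
  - by apply: cvgN; apply: cvg_at_right_filter; exact: continuous_gpdf.
  - move=> x _; rewrite derive1E.
    rewrite deriveN; last by case: (is_derive_gpdf x).
    by rewrite (@derive_val _ _ _ _ _ _ _ (is_derive_gpdf x)) opprK.
rewrite -RintegralZl//; last exact: integrable_gpdf.
have mxg : measurable_fun [set: R] (fun x => x * gpdf x).
  by apply: measurable_funM => //; exact: measurable_normal_pdf.
apply: (@le_trans _ _ (\int[mu]_(x in `[a, +oo[) (x * gpdf x))).
  apply: le_Rintegral => //.
  - have : mu.-integrable `[a, +oo[ (fun x => a%:E * (gpdf x)%:E)%E.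
      by apply: integrableZl => //; exact: integrable_gpdf.
    by apply: eq_integrable.
  - apply/integrableP; split.
      by apply/measurable_EFinP; apply: measurable_funTS.
    rewrite (_ : (\int[mu]_(x in _) _)%E = (gpdf a)%:E) ?ltry// -E.
    apply: eq_integral => x.
    rewrite inE/= in_itv/= andbT => ax.
    rewrite /= ger0_norm// mulr_ge0 ?(le_trans a0 ax)// ltW// gpdf_gt0//.
  - move=> x; rewrite /= in_itv/= andbT => ax.
    by rewrite ler_wpM2r// ltW// gpdf_gt0.
by rewrite /Rintegral E.
Qed.

Lemma std_normal_cdf_tailN w : w <= 0 -> - w * Phi w <= gpdf w.
Proof.
move=> w0; rewrite std_normal_cdfE -[in leRHS](opprK w) gpdfN.
apply: le_trans (gpdf_tail (a := - w) _); last by rewrite oppr_ge0.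
rewrite ler_wpM2l ?oppr_ge0// /Rintegral -{1}(opprK w).
rewrite ge0_integration_by_substitutionNy//.
- by rewrite le_eqVlt; apply/orP; left; apply/eqP; congr fine; apply: eq_integral => x _; rewrite /= gpdfN.
- by apply/continuous_subspaceT => x; exact: continuous_gpdf.
- by move=> x _; exact/ltW/gpdf_gt0.
Qed.

Lemma std_normal_ccdf w : \int[mu]_(x in `]w, +oo[) gpdf x = 1 - Phi w.
Proof.
rewrite -gpdf_total (Rintegral_split w); last exact: integrable_gpdf.
rewrite std_normal_cdfE; ring.
Qed.

Lemma std_normal_ccdf_tail w : 0 <= w -> w * (1 - Phi w) <= gpdf w.
Proof.
move=> w0; apply: le_trans (gpdf_tail w0).
rewrite ler_wpM2l// -std_normal_ccdf; apply: Rintegral_gpdf_le => //.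
by move=> x /=; rewrite !in_itv/= !andbT => /ltW.
Qed.

Section stein.
Variables (h : R -> R).
Hypothesis h01 : forall x, 0 <= h x <= 1.
Hypothesis hc : continuous h.

Let mh : measurable_fun [set: R] h.
Proof. exact: continuous_measurable_fun. Qed.

Let mhg : measurable_fun [set: R] (fun x => h x * gpdf x).
Proof. by apply: measurable_funM => //; exact: measurable_normal_pdf. Qed.

Let ihg D : measurable D -> mu.-integrable D (EFin \o (fun x => h x * gpdf x)).
Proof.
move=> mD; apply: le_integrable (integrable_gpdf mD) => //.
  by apply/measurable_EFinP/measurable_funTS.
move=> x _ /=; rewrite lee_fin.
have g0 := gpdf_gt0 x; have /andP[h0 h1] := h01 x.
rewrite normrM (ger0_norm h0) (ger0_norm (ltW g0)).
by rewrite ler_piMl// ltW.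
Qed.

Definition gmean := \int[mu]_x (h x * gpdf x).

Lemma gmean01 : 0 <= gmean <= 1.
Proof.
rewrite /gmean; apply/andP; split.
  apply: Rintegral_ge0 => x _; rewrite mulr_ge0 ?(ltW (gpdf_gt0 _))//.
  by have /andP[] := h01 x.
rewrite -gpdf_total; apply: le_Rintegral => //.
- exact: ihg.
- exact: integrable_gpdf.
move=> x _; have g0 := gpdf_gt0 x; have /andP[h0 h1] := h01 x.
by rewrite ler_piMl// ltW.
Qed.

Lemma gmean_ge z : (forall x, x <= z -> h x = 1) -> Phi z <= gmean.
Proof.
move=> hz; rewrite std_normal_cdfE /gmean (Rintegral_split z); last exact: ihg.
have -> : \int[mu]_(x in `]-oo, z]) gpdf x = \int[mu]_(x in `]-oo, z]) (h x * gpdf x).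
  by apply: eq_Rintegral => x; rewrite inE/= in_itv/= => /hz ->; rewrite mul1r.
rewrite lerDl; apply: Rintegral_ge0 => x _.
by rewrite mulr_ge0 ?(ltW (gpdf_gt0 _))//; have /andP[] := h01 x.
Qed.

Lemma gmean_le z : (forall x, z <= x -> h x = 0) -> gmean <= Phi z.
Proof.
move=> hz; rewrite std_normal_cdfE /gmean (Rintegral_split z); last exact: ihg.
have -> : \int[mu]_(x in `]z, +oo[) (h x * gpdf x) = \int[mu]_(x in `]z, +oo[) 0.
  apply: eq_Rintegral => x; rewrite inE/= in_itv/= andbT => /ltW/hz ->.
  by rewrite mul0r.
rewrite [X in _ + X]/Rintegral integral0 /= addr0.
apply: le_Rintegral => //; [exact: ihg|exact: integrable_gpdf|].
move=> x _; have g0 := gpdf_gt0 x; have /andP[h0 h1] := h01 x.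
by rewrite ler_piMl// ltW.
Qed.

Let k x := h x * gpdf x - gmean * gpdf x.

Let igmg D : measurable D -> mu.-integrable D (EFin \o (fun x => gmean * gpdf x)).
Proof.
move=> mD; have : mu.-integrable D (fun x => gmean%:E * (gpdf x)%:E)%E.
  by apply: integrableZl => //; exact: integrable_gpdf.
exact: eq_integrable.
Qed.

Let ik D : measurable D -> mu.-integrable D (EFin \o k).
Proof.
move=> mD.
have := integrableB mD (ihg mD) (igmg mD).
exact: eq_integrable.
Qed.

Let k_le x : `|k x| <= gpdf x.
Proof.
have g0 := gpdf_gt0 x; have /andP[h0 h1] := h01 x; have /andP[m0 m1] := gmean01.
rewrite /k -mulrBl normrM (gtr0_norm g0) ler_piMl//; first exact: ltW.
rewrite ler_norml; lra.
Qed.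

Let k_total : \int[mu]_x k x = 0.
Proof.
rewrite /k RintegralB//; [|exact: ihg|exact: igmg].
rewrite RintegralZl//; last exact: integrable_gpdf.
by rewrite gpdf_total mulr1 subrr.
Qed.

Let H w := \int[mu]_(x in `]-oo, w]) k x.

Let norm_int_k D : measurable D -> `|\int[mu]_(x in D) k x| <= \int[mu]_(x in D) gpdf x.
Proof.
move=> mD; apply: le_trans (le_normr_Rintegral mD (ik mD)) _.
have ika := integrable_abse (ik mD).
apply: (le_Rintegral mD _ (integrable_gpdf mD)) => [|x _]; last exact: k_le.
by apply: eq_integrable ika.
Qed.

Let H_le w : `|H w| <= Phi w.
Proof. exact: norm_int_k. Qed.

(** Since [k] has integral 0, [H w] is also minus its integral over the right half-line; this gives
    the decay at +oo, as [H_le] does at -oo. *)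
Let H_ler w : `|H w| <= 1 - Phi w.
Proof.
have := k_total; rewrite (Rintegral_split w); last exact: ik.
move=> /eqP; rewrite addr_eq0 => /eqP; rewrite -/(H w) => ->.
by rewrite normrN -std_normal_ccdf; exact: norm_int_k.
Qed.

Let kc : continuous k.
Proof.
move=> x; apply: cvgB; apply: cvgM; [exact: hc|exact: continuous_gpdf|exact: cvg_cst|exact: continuous_gpdf].
Qed.

Let dH w : is_derive w 1 H (k w).
Proof.
have [] := @continuous_FTC1 _ k -oo%O w (w + 1) _ _ _ (@kc w).
- by rewrite ltrDl.
- exact: ik.
- by rewrite ltNyr.
by move=> d <-; rewrite derive1E; apply: DeriveDef.
Qed.

(** The bounded solution of Stein's equation f'(w) - w f(w) = h(w) - E h(N) with N standard normal.
    The formula for [stein_sol'] is the equation itself, solved for f'; the content is then that it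
    is the derivative of [stein_sol]. *)
Definition stein_sol w := H w * (gpdf w)^-1.
Definition stein_sol' w := w * stein_sol w + (h w - gmean).

Lemma is_derive_stein_sol w : is_derive w 1 stein_sol (stein_sol' w).
Proof.
have g0 := gpdf_gt0 w.
have gN0 : gpdf w != 0 by rewrite gt_eqF.
have dg := is_derive_gpdf w; have dHw := dH w.
have dv := is_deriveV gN0 dg.
apply: is_derive_eq.
rewrite /stein_sol' /stein_sol /GRing.scale /= /k; field.
exact: gN0.
Qed.

(** Mills' inequality on the side of the sign of [w], where [H w] is bounded by the smaller tail. *)
Lemma stein_sol_id_le w : `|w * stein_sol w| <= 1.
Proof.
have g0 := gpdf_gt0 w.
rewrite /stein_sol normrM normrM normfV (gtr0_norm g0) mulrA ler_pdivrMr// mul1r.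
have [w0|w0] := leP 0 w.
  apply: le_trans (std_normal_ccdf_tail w0).
  by rewrite ger0_norm// ler_wpM2l// H_ler.
apply: le_trans (std_normal_cdf_tailN (ltW w0)).
by rewrite ltr0_norm// ler_wpM2l ?H_le// oppr_ge0 ltW.
Qed.

(** On [-1, 1] the density is at least 1/6 and [H] at most 1 in absolute value; elsewhere [1 <= |w|]
    and [stein_sol_id_le] suffices. *)
Lemma stein_sol_le w : `|stein_sol w| <= 6.
Proof.
have g0 := gpdf_gt0 w.
have [w1|w1] := boolP (-1 <= w <= 1).
  rewrite /stein_sol normrM normfV (gtr0_norm g0) ler_pdivrMr//.
  have g6 := gpdf_ge w1.
  have := H_le w; have := std_normal_cdf_le1 w; lra.
have nw : 1 <= `|w|.
  by rewrite leNgt; apply: contra w1; rewrite ltr_norml => /andP[a b]; rewrite !ltW.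
have := stein_sol_id_le w; rewrite normrM => h6.
have := normr_ge0 (stein_sol w); nra.
Qed.

Lemma stein_sol'_le w : `|stein_sol' w| <= 2.
Proof.
rewrite /stein_sol'; apply: le_trans (ler_normD _ _) _.
have := stein_sol_id_le w; have /andP[h0 h1] := h01 w; have /andP[m0 m1] := gmean01.
have : `|h w - gmean| <= 1 by rewrite ler_norml; lra.
lra.
Qed.

Lemma continuous_stein_sol : continuous stein_sol.
Proof.
move=> w; apply/differentiable_continuous/derivable1_diffP.
by have [] := is_derive_stein_sol w.
Qed.

Lemma continuous_stein_sol' : continuous stein_sol'.
Proof.
move=> w; apply: cvgD; first apply: cvgM; [exact: cvg_id|exact: continuous_stein_sol|].
by apply: cvgB; [exact: hc|exact: cvg_cst].
Qed.

(** The mean value theorem, whatever the order of [u] and [w]; later it matters that the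
    intermediate point is no farther from [w] than [u] is. *)
Lemma stein_sol_incr u w : exists2 c, `|c - w| <= `|u - w| &
  stein_sol w - stein_sol u = stein_sol' c * (w - u).
Proof.
have [uw|/ltW uw] := leP u w.
  have [||c] := @MVT_segment _ stein_sol stein_sol' u w uw.
  - by move=> x _; exact: is_derive_stein_sol.
  - exact/continuous_subspaceT/continuous_stein_sol.
  rewrite in_itv/= => /andP[a b] E; exists c => //.
  by rewrite !ler0_norm ?subr_le0// lerN2 lerD2r.
have [||c] := @MVT_segment _ stein_sol stein_sol' w u uw.
- by move=> x _; exact: is_derive_stein_sol.
- exact/continuous_subspaceT/continuous_stein_sol.
rewrite in_itv/= => /andP[a b] E; exists c => //.
  by rewrite !ger0_norm ?subr_ge0// lerD2r.
by rewrite -opprB E -mulrN opprB.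
Qed.

End stein.

(** Linear interpolation from 1 at [z] to 0 at [z + e]. With [z = t] it lies above the indicator of
    the half-line up to [t], with [z = t - e] below it. *)
Definition ramp z e x : R := Num.min 1 (Num.max 0 (1 - (x - z) / e)).

Section ramp.
Variables (z e : R).
Hypothesis e0 : 0 < e.

Lemma ramp01 x : 0 <= ramp z e x <= 1.
Proof. by rewrite /ramp le_min ler01 le_max lexx/= ge_min lexx. Qed.

Lemma ramp_continuous : continuous (ramp z e).
Proof.
move=> x.
apply: (@continuous_min R R (cst 1) (cst 0 \max (fun x => 1 - (x - z) / e)) x).
  exact: cvg_cst.
apply: (@continuous_max R R (cst 0) (fun x => 1 - (x - z) / e) x).
  exact: cvg_cst.
apply: cvgB; first exact: cvg_cst.
by apply: cvgM; [apply: cvgB; [exact: cvg_id|exact: cvg_cst]|exact: cvg_cst].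
Qed.

Lemma ramp1 x : x <= z -> ramp z e x = 1.
Proof.
move=> xz; have h : (x - z) / e <= 0 by rewrite ler_pdivrMr// mul0r subr_le0.
rewrite /ramp /Num.min /Num.max (_ : 0 < _ = true); last by apply/idP; lra.
by case: ltP => // ?; lra.
Qed.

Lemma ramp0 x : z + e <= x -> ramp z e x = 0.
Proof.
move=> xz; have h : 1 <= (x - z) / e by rewrite ler_pdivlMr// mul1r; lra.
rewrite /ramp /Num.min /Num.max (_ : 0 < _ = false); last by apply/negbTE; rewrite -leNgt; lra.
by rewrite ltr10.
Qed.

Lemma ramp_lip x y : `|ramp z e x - ramp z e y| <= `|x - y| / e.
Proof.
have -> : `|x - y| / e = `|(x - z) / e - (y - z) / e|.
  rewrite -mulrBl normrM normfV (gtr0_norm e0); congr (`|_| * _); lra.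
rewrite /ramp; set a := (x - z) / e; set b := (y - z) / e.
have : - `|a - b| <= a - b <= `|a - b| by rewrite -ler_norml.
have := normr_ge0 (a - b).
rewrite ler_norml /Num.min /Num.max; move: `|a - b| => c.
case: (ltP 0 (1 - a)) => ?; case: (ltP 0 (1 - b)) => ?; rewrite ?ltr10;
  case: (ltP 1 (1 - a)) => ?; case: (ltP 1 (1 - b)) => ? => ? /andP[? ?]; lra.
Qed.

(** The ramp is constant off [[z, z + e]], so the two values differ only if [y] is within [b] of
    this interval. Keeping the indicator produces, after taking expectations, the probability that
    the sum falls in a short interval. *)
Lemma ramp_lip_near x y b : `|x - y| <= b ->
  `|ramp z e x - ramp z e y| <= b / e * \1_[set w | z - b <= w <= z + e + b] y.
Proof.
move=> xb; have b0 : 0 <= b by exact: le_trans xb.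
rewrite indicE; case: (boolP (y \in _)) => [_|].
  rewrite mulr1; apply: le_trans (ramp_lip x y) _.
  by rewrite ler_pM2r ?invr_gt0.
rewrite notin_setE /= => /negP; rewrite negb_and -!ltNge mulr0 => yb.
have : - b <= x - y <= b by rewrite -ler_norml.
case/orP: yb => yb /andP[? ?].
  by rewrite !ramp1 ?subrr ?normr0//; lra.
by rewrite !ramp0 ?subrr ?normr0//; lra.
Qed.

End ramp.

End gauss.

(** * Berry-Esseen bound under local dependence *)

Section expectation.
Context d (Omega : measurableType d) (R : realType) (P : probability Omega R).
Implicit Types (f g : Omega -> R).

(** This class is stable under all operations needed for truncated statistics and consists of
    integrable functions, so that expectations can be split without separate integrability
    arguments. *)
Definition bmeas f := measurable_fun setT f /\ exists K, forall w, `|f w| <= K.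

Definition Ex f : R := \int[P]_w f w.

Lemma ExE f : Ex f = \int[P]_w f w. Proof. by []. Qed.

Lemma bmeas_cst c : bmeas (fun=> c).
Proof. by split=> //; exists `|c|. Qed.

Lemma bmeasD f g : bmeas f -> bmeas g -> bmeas (fun w => f w + g w).
Proof.
move=> [mf [K hK]] [mg [L hL]]; split; first exact: measurable_funD.
by exists (K + L) => w; apply: le_trans (ler_normD _ _) _; rewrite lerD.
Qed.

Lemma bmeasN f : bmeas f -> bmeas (fun w => - f w).
Proof.
move=> [mf [K hK]]; split; first exact: measurableT_comp.
by exists K => w; rewrite normrN.
Qed.

Lemma bmeasM f g : bmeas f -> bmeas g -> bmeas (fun w => f w * g w).
Proof.
move=> [mf [K hK]] [mg [L hL]]; split; first exact: measurable_funM.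
by exists (K * L) => w; rewrite normrM ler_pM.
Qed.

Lemma bmeas_norm f : bmeas f -> bmeas (fun w => `|f w|).
Proof.
move=> [mf [K hK]]; split; first exact: measurableT_comp.
by exists K => w; rewrite normr_id.
Qed.

Lemma bmeasX f n : bmeas f -> bmeas (fun w => f w ^+ n).
Proof.
move=> [mf [K hK]]; split; first exact: measurable_funX.
by exists (K ^+ n) => w; rewrite normrX lerXn2r ?nnegrE// (le_trans _ (hK w)).
Qed.

Lemma bmeas_sum (I : Type) (r : seq I) (p : pred I) (F : I -> Omega -> R) :
  (forall i, p i -> bmeas (F i)) -> bmeas (fun w => \sum_(i <- r | p i) F i w).
Proof.
move=> h; elim: r => [|i r IH].
  under eq_fun do rewrite big_nil; exact: bmeas_cst.
have [pi|pi] := boolP (p i).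
  under eq_fun do rewrite big_cons pi.
  by apply: bmeasD => //; exact: h.
by under eq_fun do rewrite big_cons (negbTE pi).
Qed.

Lemma bmeas_comp (u : R -> R) f : continuous u -> bmeas f ->
  bmeas (fun w => u (f w)).
Proof.
move=> cu [mf [K hK]]; split.
  by apply: measurableT_comp => //; exact: continuous_measurable_fun.
have K0 : - K <= K.
  have := hK point; have := normr_ge0 (f point); lra.
have cnu : {within `[- K, K], continuous (fun x => `|u x|)}.
  apply: continuous_subspaceT => x; apply: continuous_comp; first exact: cu.
  exact: norm_continuous.
have [c _ hc] := EVT_max K0 cnu.
by exists `|u c| => w; apply: hc; rewrite in_itv/= -ler_norml.
Qed.

Lemma bmeas_indic_comp (A : set R) f : measurable A -> bmeas f ->
  bmeas (fun w => \1_A (f w)).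
Proof.
move=> mA [mf _]; split; first exact: measurableT_comp.
by exists 1 => w; rewrite indicE; case: (_ \in _); rewrite ?normr1 ?normr0.
Qed.

Lemma integrable_bmeas f : bmeas f -> P.-integrable setT (EFin \o f).
Proof.
move=> [mf [K hK]].
apply: (@le_integrable _ _ _ _ _ measurableT _ (cst K%:E)).
- exact/measurable_EFinP.
- by move=> w _ /=; rewrite lee_fin (le_trans (hK w))// ler_norm.
- exact: finite_measure_integrable_cst.
Qed.

Lemma Ex_cst c : Ex (fun=> c) = c.
Proof.
rewrite /Ex Rintegral_cst// (_ : fine _ = 1) ?mulr1//.
by rewrite -[RHS](congr1 fine (@probability_setT _ _ _ P)).
Qed.

Lemma ExD f g : bmeas f -> bmeas g -> Ex (fun w => f w + g w) = Ex f + Ex g.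
Proof. by move=> bf bg; rewrite /Ex RintegralD//; exact: integrable_bmeas. Qed.

Lemma ExB f g : bmeas f -> bmeas g -> Ex (fun w => f w - g w) = Ex f - Ex g.
Proof. by move=> bf bg; rewrite /Ex RintegralB//; exact: integrable_bmeas. Qed.

Lemma ExZ c f : bmeas f -> Ex (fun w => c * f w) = c * Ex f.
Proof. by move=> bf; rewrite /Ex RintegralZl//; exact: integrable_bmeas. Qed.

Lemma Ex_sum (I : Type) (r : seq I) (p : pred I) (F : I -> Omega -> R) :
  (forall i, p i -> bmeas (F i)) ->
  Ex (fun w => \sum_(i <- r | p i) F i w) = \sum_(i <- r | p i) Ex (F i).
Proof.
move=> h; elim: r => [|i r IH].
  by rewrite big_nil -[RHS]Ex_cst; congr Ex; apply/funext => w; rewrite big_nil.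
rewrite big_cons -IH; under eq_fun do rewrite big_cons.
by case: ifPn => // pi; rewrite ExD//; [exact: h|exact: bmeas_sum].
Qed.

Lemma Ex_le f g : bmeas f -> bmeas g -> (forall w, f w <= g w) -> Ex f <= Ex g.
Proof.
by move=> bf bg fg; apply: le_Rintegral => //; exact: integrable_bmeas.
Qed.

Lemma Ex_ge0 f : (forall w, 0 <= f w) -> 0 <= Ex f.
Proof. by move=> f0; apply: Rintegral_ge0. Qed.

Lemma Ex_norm f : bmeas f -> `|Ex f| <= Ex (fun w => `|f w|).
Proof. by move=> bf; apply: le_normr_Rintegral => //; exact: integrable_bmeas. Qed.

Lemma Ex_indic (A : set Omega) : measurable A -> Ex \1_A = fine (P A).
Proof. by move=> mA; rewrite /Ex /Rintegral integral_indic// setIT. Qed.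

(** A substitute for the Cauchy-Schwarz inequality: [2 * c * |f| <= c ^+ 2 + f ^+ 2], with [c] to be
    chosen as the expected size of [f]. *)
Lemma Ex_abs_le f (c : R) : bmeas f -> 0 < c ->
  Ex (fun w => `|f w|) <= (c + Ex (fun w => f w ^+ 2) / c) / 2.
Proof.
move=> bf c0; have bf2 := bmeasX 2 bf.
have -> : (c + Ex (fun w => f w ^+ 2) / c) / 2 =
    Ex (fun w => c / 2 + (2 * c)^-1 * f w ^+ 2).
  rewrite ExD; [|exact: bmeas_cst|by apply: bmeasM => //; exact: bmeas_cst].
  rewrite (Ex_cst (c / 2)) (ExZ (2 * c)^-1 bf2); field; lra.
apply: Ex_le; first exact: bmeas_norm.
  by apply: bmeasD; [exact: bmeas_cst|apply: bmeasM; [exact: bmeas_cst|exact: bmeasX]].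
move=> w; rewrite -real_normK ?num_real//.
have -> : c / 2 + (2 * c)^-1 * `|f w| ^+ 2 = `|f w| + (2 * c)^-1 * (`|f w| - c) ^+ 2.
  field; lra.
by rewrite lerDl mulr_ge0 ?sqr_ge0// invr_ge0; lra.
Qed.

Lemma markov_even f q u : bmeas f -> 0 < u ->
  fine (P [set w | u < `|f w|]) <= Ex (fun w => f w ^+ q.*2) / u ^+ q.*2.
Proof.
move=> bf u0.
have mA : measurable [set w | u < `|f w|].
  have := measurable_funTS (D := setT) (bmeas_norm bf).1.
  move=> /(_ measurableT _ (measurable_itv `]u, +oo[)); rewrite setTI.
  by congr measurable; apply/seteqP; split=> w /=; rewrite in_itv/= andbT.
rewrite -Ex_indic// ler_pdivlMr ?exprn_gt0// mulrC -ExZ; last first.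
  split; first exact: measurable_indic.
  by exists 1 => w; rewrite indicE; case: (_ \in _); rewrite ?normr1 ?normr0.
apply: Ex_le.
- apply: bmeasM; first exact: bmeas_cst.
  split; first exact: measurable_indic.
  by exists 1 => w; rewrite indicE; case: (_ \in _); rewrite ?normr1 ?normr0.
- exact: bmeasX.
move=> w; rewrite indicE; have [|_] := boolP (w \in _).
  rewrite inE/= mulr1 -mul2n !exprM -(real_normK (num_real (f w))) => h.
  rewrite -!exprM; apply: lerXn2r; rewrite ?nnegrE//; exact: ltW.
by rewrite mulr0 -mul2n exprM exprn_ge0// sqr_ge0.
Qed.

End expectation.

Ltac bm := repeat first
  [ assumption | apply: bmeas_cst | apply: bmeasD | apply: bmeasN
  | apply: bmeasM | apply: bmeas_norm | apply: bmeasX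
  | (apply: bmeas_sum => ? ?) ].
Section local_dependence.
Context d (Omega : measurableType d) (R : realType) (P : probability Omega R).
Context (V : finType).
Local Notation Ex := (Ex P).

(* [dep I f] is to be read: f is a function of the randomness indexed by I. *)
Record independent_system (dep : {set V} -> (Omega -> R) -> Prop) : Prop := {
  dep_bmeas : forall I f, dep I f -> bmeas f ;
  dep_sub : forall (I J : {set V}) f, I \subset J -> dep I f -> dep J f ;
  dep_cst : forall I c, dep I (fun=> c) ;
  depD : forall I f g, dep I f -> dep I g -> dep I (fun w => f w + g w) ;
  depM : forall I f g, dep I f -> dep I g -> dep I (fun w => f w * g w) ;
  dep_comp : forall I f (u : R -> R), continuous u -> dep I f ->
    dep I (fun w => u (f w)) ;
  dep_indep : forall (I J : {set V}) f g, disjoint (mem I) (mem J) -> dep I f -> dep J g ->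
    Ex (fun w => f w * g w) = Ex f * Ex g }.

Context (dep : {set V} -> (Omega -> R) -> Prop) (hdep : independent_system dep).

Lemma dep_sum (I : {set V}) (T : Type) (r : seq T) (p : pred T) (F : T -> Omega -> R) :
  (forall i, p i -> dep I (F i)) -> dep I (fun w => \sum_(i <- r | p i) F i w).
Proof.
move=> h; elim: r => [|i r IH].
  under eq_fun do rewrite big_nil; exact: dep_cst.
have [pi|pi] := boolP (p i).
  under eq_fun do rewrite big_cons pi.
  by apply: depD => //; exact: h.
by under eq_fun do rewrite big_cons (negbTE pi).
Qed.

Definition interacting (S : V -> {set V}) (c : V) : {set V} :=
  [set j | ~~ disjoint (mem (S j)) (mem (S c))].

Lemma norm_sum_le (A : {set V}) (F : V -> R) (b : R) :
  (forall c, `|F c| <= b) -> `|\sum_(c in A) F c| <= #|A|%:R * b.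
Proof.
move=> h; apply: le_trans (ler_norm_sum _ _ _) _.
apply: (@le_trans _ _ (\sum_(c in A) b)); first exact: ler_sum.
by rewrite sumr_const mulr_natl.
Qed.

Section sums.
Variables (S : V -> {set V}) (X : V -> Omega -> R) (b D : R) (J : {set V}).
Hypothesis depX : forall c, dep (S c) (X c).
Hypothesis X_le : forall c w, `|X c w| <= b.
Hypothesis EX0 : forall c, Ex (X c) = 0.
Hypothesis D_le : forall c, #|interacting S c|%:R <= D.

Local Notation N := (interacting S).
Local Notation beta := (D * b).

Definition locsum w := \sum_(c in J) X c w.
Definition locsum_near i w := \sum_(c in J :&: N i) X c w.
Definition locsum_far i w := \sum_(c in J :\: N i) X c w.

(** The sign of [b] is read off from a summand, so an index is required: [V] may be empty. *)
Let b0 : V -> 0 <= b.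
Proof. by move=> c; apply: le_trans (X_le c point). Qed.

Lemma bmeas_locX c : bmeas (X c). Proof. exact: dep_bmeas hdep _ _ (depX c). Qed.

Lemma bmeas_locsum : bmeas locsum.
Proof. by apply: bmeas_sum => c _; exact: bmeas_locX. Qed.

Lemma bmeas_locsum_near i : bmeas (locsum_near i).
Proof. by apply: bmeas_sum => c _; exact: bmeas_locX. Qed.

Lemma bmeas_locsum_far i : bmeas (locsum_far i).
Proof. by apply: bmeas_sum => c _; exact: bmeas_locX. Qed.

Lemma locsum_split i w : locsum w = locsum_near i w + locsum_far i w.
Proof. by rewrite /locsum (big_setID (N i)). Qed.

Lemma locsum_near_le i w : `|locsum_near i w| <= beta.
Proof.
apply: le_trans (norm_sum_le _ (fun c => X_le c w)) _.
rewrite ler_wpM2r ?(b0 i)//; apply: le_trans (D_le i).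
by rewrite ler_nat subset_leq_card// subsetIr.
Qed.

(** The far sum involves only variables whose index sets avoid [S i], so it is a function of the
    randomness in the complement of [S i]; independence from the centred [X i] follows. *)
Lemma Ex_far (u : R -> R) i : continuous u ->
  Ex (fun w => X i w * u (locsum_far i w)) = 0.
Proof.
move=> cu; rewrite (dep_indep hdep (I := S i) (J := ~: S i)).
- by rewrite EX0 mul0r.
- by rewrite finset.disjoints_subset finset.setCK.
- exact: depX.
apply: (dep_comp hdep) => //; apply: dep_sum => j; rewrite !inE negbK => /andP[jN _].
apply: (dep_sub hdep) (depX j).
by rewrite -finset.disjoints_subset.
Qed.

(** The vanishing term of [Ex_far] is subtracted from each summand. This identity is used three
    times: with odd powers for moments, with the identity for the variance, and with the solution of
    Stein's equation. *)
Lemma Ex_locsum_mul (u : R -> R) : continuous u ->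
  Ex (fun w => locsum w * u (locsum w)) =
  \sum_(i in J) Ex (fun w => X i w * (u (locsum w) - u (locsum_far i w))).
Proof.
move=> cu; have bu : bmeas (fun w => u (locsum w)).
  by apply: bmeas_comp => //; exact: bmeas_locsum.
under eq_fun do rewrite /locsum mulr_suml.
rewrite Ex_sum; last by move=> i _; apply: bmeasM => //; exact: bmeas_locX.
apply: eq_bigr => i _.
under [in RHS]eq_fun do rewrite mulrBr.
rewrite ExB; first by rewrite Ex_far// subr0.
  by apply: bmeasM => //; exact: bmeas_locX.
apply: bmeasM; first exact: bmeas_locX.
by apply: bmeas_comp => //; exact: bmeas_locsum_far.
Qed.

(** The recursion is that of [locsum_moment]: a difference of powers of order 2q + 1 factors into
    the near sum and 2q + 1 products, each bounded by 4 ^ q times the sum of the moment of order 2q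
    and [m ^+ q]. *)
Fixpoint moment_cst (q : nat) : R :=
  if q is q'.+1 then (q'.*2.+1)%:R * 4 ^+ q' * (moment_cst q' + 1) else 1.

Lemma moment_cst_ge0 q : 0 <= moment_cst q.
Proof. by elim: q => //= q IH; rewrite !mulr_ge0// addr_ge0. Qed.

(** Induction on [q], by [Ex_locsum_mul] with the power of order 2q + 1. The parameter [m] has to
    dominate both the natural size [#|J| * b * beta] of the variance and the square of one
    neighbourhood sum. *)
Lemma locsum_moment (m : R) q :
  #|J|%:R * b * beta <= m -> beta ^+ 2 <= m ->
  Ex (fun w => locsum w ^+ q.*2) <= moment_cst q * m ^+ q.
Proof.
move=> m1 m2.
have m0 : 0 <= m by apply: le_trans m2; exact: sqr_ge0.
elim: q => [|q IH]; first by rewrite /= mulr1 (_ : (fun _ => _) = fun=> 1) ?Ex_cst//.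
have -> : (fun w => locsum w ^+ q.+1.*2) = (fun w => locsum w * locsum w ^+ q.*2.+1).
  by apply/funext => w; rewrite doubleS exprS.
rewrite (Ex_locsum_mul (u := fun x => x ^+ q.*2.+1)); last exact: exprn_continuous.
have bW := bmeas_locsum.
set M := (q.*2.+1)%:R * 4 ^+ q * (moment_cst q + 1) * m ^+ q.
have M0 : 0 <= M by rewrite !mulr_ge0 ?exprn_ge0// addr_ge0// moment_cst_ge0.
suff h i : Ex (fun w => X i w * (locsum w ^+ q.*2.+1 - locsum_far i w ^+ q.*2.+1))
    <= b * beta * M.
  apply: (@le_trans _ _ (\sum_(i in J) b * beta * M)); first exact: ler_sum.
  rewrite sumr_const -mulr_natl /= exprS.
  rewrite [leRHS](_ : _ = m * M); last by rewrite /M; ring.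
  by rewrite mulrA ler_wpM2r// mulrA.
have b0' := b0 i.
have D0 : 0 <= beta by exact: le_trans (locsum_near_le i point).
have bf : bmeas (fun w => X i w * (locsum w ^+ q.*2.+1 - locsum_far i w ^+ q.*2.+1)).
  have ? := bmeas_locX i; have ? := bmeas_locsum_far i; bm.
apply: (@le_trans _ _ (Ex (fun w => b * beta * ((q.*2.+1)%:R * 4 ^+ q) * (locsum w ^+ q.*2 + m ^+ q)))).
  apply: Ex_le => //; first by bm.
  move=> w; apply: le_trans (ler_norm _) _; rewrite normrM.
  rewrite [leRHS](_ : _ = b * (beta * ((q.*2.+1)%:R * (4 ^+ q * (locsum w ^+ q.*2 + m ^+ q))))); last by ring.
  apply: ler_pM => //.
  rewrite subrXX normrM.
  have Ed : locsum w - locsum_far i w = locsum_near i w by rewrite (locsum_split i) addrK.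
  rewrite Ed; apply: ler_pM => //; first exact: locsum_near_le.
  set x := locsum w; set y := locsum_far i w.
  (* Both the sum and its far part are at most [z] in absolute value, and [z] is at most twice the
     larger of [|x|] and [beta]; the even power of that factor 2 gives 4 ^ q, and [beta ^+ 2 <= m]
     handles the case where [beta] is the larger. *)
  pose z := `|x| + beta.
  have xz : `|x| <= z by rewrite /z lerDl.
  have yz : `|y| <= z.
    have -> : y = x - locsum_near i w by rewrite -Ed /y opprB addrC subrK.
    by apply: le_trans (ler_normB _ _) _; rewrite lerD2l locsum_near_le.
  have z0 : 0 <= z by exact: le_trans xz.
  apply: le_trans (ler_norm_sum _ _ _) _.
  apply: (@le_trans _ _ (\sum_(j < q.*2.+1) z ^+ q.*2)).
    apply: ler_sum => j _; rewrite normrM !normrX.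
    have jq : (j <= q.*2)%N by rewrite -ltnS.
    rewrite /= -[in leRHS](subnK jq) exprD.
    by apply: ler_pM; rewrite ?exprn_ge0//; apply: lerXn2r; rewrite ?nnegrE.
  rewrite sumr_const card_ord -[leLHS]mulr_natl; apply: ler_wpM2l => //.
  have m_ge : beta ^+ q.*2 <= m ^+ q.
    by rewrite -mul2n exprM; apply: lerXn2r; rewrite ?nnegrE// sqr_ge0.
  have x2 : x ^+ q.*2 = `|x| ^+ q.*2 by rewrite -!mul2n !exprM real_normK ?num_real.
  have E4 (y' : R) : (2 * y') ^+ q.*2 = 4 ^+ q * y' ^+ q.*2.
    by rewrite exprMn -mul2n !exprM; congr (_ ^+ _ * _); ring.
  rewrite x2 -/x.
  have [h|h] := leP `|x| beta.
    apply: (@le_trans _ _ ((2 * beta) ^+ q.*2)).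
      apply: lerXn2r; rewrite ?nnegrE//; rewrite /z; lra.
    rewrite E4; apply: ler_pM => //.
    - by rewrite exprn_ge0.
    - by apply: le_trans m_ge _; rewrite lerDr exprn_ge0.
  apply: (@le_trans _ _ ((2 * `|x|) ^+ q.*2)).
    apply: lerXn2r; rewrite ?nnegrE ?mulr_ge0//; rewrite /z; lra.
  by rewrite E4; apply: ler_pM => //; rewrite lerDl exprn_ge0.
have bX : bmeas (fun w => locsum w ^+ q.*2) by bm.
rewrite ExZ ?ExD ?Ex_cst//; [|exact: bmeas_cst|by bm].
rewrite [leRHS](_ : _ = b * beta * ((q.*2.+1)%:R * 4 ^+ q) *
  ((moment_cst q + 1) * m ^+ q)); last by rewrite /M; ring.
apply: ler_wpM2l; first by rewrite (mulr_ge0 (mulr_ge0 b0' D0))// mulr_ge0// exprn_ge0.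
by rewrite mulrDl mul1r lerD2r.
Qed.

End sums.

Section berry_esseen.
Variables (S : V -> {set V}) (X : V -> Omega -> R) (b D K : R) (J : {set V}).
Hypothesis depX : forall c, dep (S c) (X c).
Hypothesis X_le : forall c w, `|X c w| <= b.
Hypothesis EX0 : forall c, Ex (X c) = 0.

(** The randomness on which the product of [X c] with its near sum depends. The variance of the sum
    of these products enters Stein's method, so the bound [D] has to count interactions between
    second neighbourhoods. *)
Definition second_nbhd c : {set V} :=
  S c :|: \bigcup_(j in interacting S c) S j.

Hypothesis D_le : forall c, #|interacting second_nbhd c|%:R <= D.
Hypothesis b_gt0 : 0 < b.
Hypothesis b_le1 : b <= 1.
Hypothesis D_ge1 : 1 <= D.
Hypothesis K_ge1 : 1 <= K.
Hypothesis JK : #|J|%:R * b ^+ 2 <= K.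

Local Notation W := (locsum X J).
Local Notation near := (locsum_near S X J).
Local Notation far := (locsum_far S X J).
Local Notation beta := (D * b).
Local Notation v := (Ex (fun w => W w ^+ 2)).

Let D_le1 c : #|interacting S c|%:R <= D.
Proof.
apply: le_trans (D_le c); rewrite ler_nat subset_leq_card//.
apply/fintype.subsetP => j; rewrite !inE; apply: contra.
by apply: disjointW; exact: finset.subsetUl.
Qed.

Let bX c : bmeas (X c). Proof. exact: (bmeas_locX depX). Qed.
Let bW : bmeas W. Proof. exact: (bmeas_locsum J depX). Qed.
Let bnear i : bmeas (near i). Proof. exact: (bmeas_locsum_near J depX). Qed.
Let bfar i : bmeas (far i). Proof. exact: (bmeas_locsum_far J depX). Qed.
Let near_le i w : `|near i w| <= beta.
Proof. exact: locsum_near_le X_le D_le1 i w. Qed.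
Let beta0 : 0 < beta.
Proof. by rewrite mulr_gt0// (lt_le_trans _ D_ge1). Qed.

Let Y i w := X i w * near i w.
Let Z i w := Y i w - Ex (Y i).

Let bY i : bmeas (Y i). Proof. by apply: bmeasM. Qed.

Let Y_le i w : `|Y i w| <= b * beta.
Proof. by rewrite normrM ler_pM. Qed.

Let depZ i : dep (second_nbhd i) (Z i).
Proof.
apply: (depD hdep); last exact: (dep_cst hdep).
apply: (depM hdep).
  by apply: (dep_sub hdep) (depX i); exact: finset.subsetUl.
apply: dep_sum => j; rewrite inE => /andP[_ jN].
apply: (dep_sub hdep) (depX j).
apply: fintype.subset_trans (finset.subsetUr _ _).
exact: finset.bigcup_sup.
Qed.

Let EY_le i : `|Ex (Y i)| <= b * beta.
Proof.
apply: le_trans (Ex_norm _ (bY i)) _; rewrite -[leRHS](Ex_cst P).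
by apply: Ex_le => //; bm.
Qed.

Let Z_le i w : `|Z i w| <= 2 * (b * beta).
Proof.
apply: le_trans (ler_normB _ _) _; have := Y_le i w; have := EY_le i; lra.
Qed.

Let EZ0 i : Ex (Z i) = 0.
Proof. by rewrite /Z (ExB P (bY i) (bmeas_cst _ _)) Ex_cst subrr. Qed.

(** [Ex_locsum_mul] for the identity function. Thus the sum of the [Z i] is the fluctuation of an
    unbiased local estimate of the variance. *)
Let sum_EY : \sum_(i in J) Ex (Y i) = v.
Proof.
have := @Ex_locsum_mul S X J depX EX0 id (fun x => cvg_id).
have -> : (fun w => W w * W w) = (fun w => W w ^+ 2) by apply/funext => w; rewrite expr2.
move=> ->; apply: eq_bigr => i _; congr Ex; apply/funext => w.
by rewrite (locsum_split S X J i w) addrK.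
Qed.

(** The products form a locally dependent family again, with bound [2 * (b * beta)]. [locsum_moment]
    with exponent 1 bounds the second moment of their sum by a multiple of [K * D ^+ 4 * b ^+ 2],
    and [Ex_abs_le] is applied with [c = b]. *)
Let EZ_abs : Ex (fun w => `|\sum_(i in J) Z i w|) <= b / 2 + 4 * K * D ^+ 4 * b.
Proof.
have bS : bmeas (locsum Z J) by exact: (bmeas_locsum J depZ).
apply: le_trans (Ex_abs_le P bS b_gt0) _.
have JK0 : 0 <= #|J|%:R * b ^+ 2 by rewrite mulr_ge0// sqr_ge0.
have := @locsum_moment second_nbhd Z (2 * (b * beta)) D J depZ Z_le EZ0 D_le
  (4 * K * D ^+ 4 * b ^+ 2) 1.
rewrite !expr1 /= double0 expr0 mulr1 mul1r => h.
have D2 : 1 <= D ^+ 2 by rewrite expr_ge1// (le_trans _ D_ge1).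
have D3 : 0 <= D ^+ 3 by rewrite exprn_ge0// (le_trans _ D_ge1).
have D4 : 0 <= D ^+ 4 by rewrite exprn_ge0// (le_trans _ D_ge1).
have b2 : 0 <= b ^+ 2 by exact: sqr_ge0.
have b2' : b ^+ 2 <= 1 by rewrite expr_le1// ltW.
have {}h : Ex (fun w => locsum Z J w ^+ 2) <= (1 + 1) * (4 * K * D ^+ 4 * b ^+ 2).
  apply: h.
    have -> : #|J|%:R * (2 * (b * (D * b))) * (D * (2 * (b * (D * b)))) =
      (#|J|%:R * b ^+ 2) * (4 * D ^+ 3 * b ^+ 2) by ring.
    have -> : 4 * K * D ^+ 4 * b ^+ 2 = K * (4 * (D * D ^+ 3) * b ^+ 2) by ring.
    apply: ler_pM => //; first by rewrite mulr_ge0// mulr_ge0.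
    by rewrite ler_wpM2r// ler_wpM2l// ler_peMl.
  have -> : (D * (2 * (b * (D * b)))) ^+ 2 = b ^+ 2 * (4 * D ^+ 4 * b ^+ 2) by ring.
  have -> : 4 * K * D ^+ 4 * b ^+ 2 = K * (4 * D ^+ 4 * b ^+ 2) by ring.
  rewrite ler_wpM2r//; last exact: le_trans b2' K_ge1.
  by rewrite mulr_ge0// mulr_ge0.
have -> : b / 2 + 4 * K * D ^+ 4 * b =
   (b + (1 + 1) * (4 * K * D ^+ 4 * b ^+ 2) / b) / 2 by field; rewrite ?gt_eqF//; lra.
by rewrite ler_pM2r ?invr_gt0// lerD2l ler_pM2r ?invr_gt0.
Qed.

(** By Stein's equation the left side is the difference of the expectations of f'(W) and W f(W).
    After [Ex_locsum_mul], each increment of f is replaced by the near sum times f'(W): the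
    remainder gives the terms with [beta], and the deviation of the sum of the [Y i] from 1 gives
    the others. *)
Let stein_error (z e : R) (e0 : 0 < e) :
  `|Ex (fun w => ramp z e (W w)) - gmean (ramp z e)| <= 2 * `|1 - v| + b + 8 * K * D ^+ 4 * b
   + K * D * (2 * beta * (Ex (fun w => `|W w|) + beta) + 6 * beta
     + beta / e * Ex (fun w => \1_[set x | z - beta <= x <= z + e + beta] (W w))).
Proof.
pose h := ramp z e; rewrite -/h; have h01 : forall x, 0 <= h x <= 1 by move=> x; exact: ramp01.
have hc : continuous h by exact: ramp_continuous.
pose f := stein_sol h; pose f' := stein_sol' h.
have fc : continuous f by exact: continuous_stein_sol.
have f'c : continuous f' by exact: continuous_stein_sol'.
have bf : bmeas (fun w => f (W w)) by exact: bmeas_comp.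
have bf' : bmeas (fun w => f' (W w)) by exact: bmeas_comp.
have bh : bmeas (fun w => h (W w)) by exact: bmeas_comp.
pose I := [set x : R | z - beta <= x <= z + e + beta].
have mI : measurable I.
  rewrite (_ : I = [set` `[z - beta, z + e + beta]]); first exact: measurable_itv.
  by apply/seteqP; split=> x /=; rewrite in_itv.
have bI : bmeas (fun w => \1_I (W w) : R) by exact: bmeas_indic_comp.
have -> : Ex (fun w => h (W w)) - gmean h = Ex (fun w => f' (W w)) - Ex (fun w => W w * f (W w)).
  have bWf : bmeas (fun w => W w * f (W w)) by bm.
  rewrite -{1}[gmean h](Ex_cst P) -(ExB P bh (bmeas_cst _ _)) -(ExB P bf' bWf).
  by congr Ex; apply/funext => w; rewrite /f' /stein_sol' -/f; ring.
rewrite (Ex_locsum_mul J depX EX0 fc).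
pose G w := 2 * beta * (`|W w| + beta) + 6 * beta + beta / e * \1_I (W w).
have bG : bmeas G by rewrite /G; bm.
have G0 w : 0 <= G w.
  have b0 := ltW beta0; have e0' := ltW e0; have n0 := normr_ge0 (W w).
  rewrite /G indicE; apply: addr_ge0; first apply: addr_ge0.
  - by rewrite mulr_ge0 ?addr_ge0//; apply: mulr_ge0.
  - by apply: mulr_ge0.
  - by apply: mulr_ge0 => //; apply: divr_ge0.
have key i w : `|X i w * (f (W w) - f (far i w)) - Y i w * f' (W w)| <= b * beta * G w.
  have EW := locsum_split S X J i w.
  have [c hc1 ->] := stein_sol_incr h01 hc (far i w) (W w).
  have -> : W w - far i w = near i w by rewrite EW addrK.
  rewrite -/f' (_ : _ - _ = X i w * near i w * (f' c - f' (W w))); last by rewrite /Y; ring.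
  rewrite normrM; apply: ler_pM => //; first exact: Y_le.
  have {}hc1 : `|c - W w| <= beta.
    apply: le_trans hc1 _; rewrite EW opprD addrCA subrr addr0 normrN.
    exact: near_le.
  have cW : `|c| <= `|W w| + beta.
    have -> : c = W w + (c - W w) by ring.
    by apply: le_trans (ler_normD _ _) _; rewrite lerD2l.
  have [c' _ hc'] := stein_sol_incr h01 hc (W w) c.
  have f'2 := stein_sol'_le h01 hc c'.
  have f6 := stein_sol_le h01 hc (W w).
  (* The increment of f' is expanded through Stein's equation, so that no second derivative is
     involved and [h] only has to be Lipschitz. The factors 2 and 6 below are the bounds on f' and
     f. *)
  rewrite /f' /stein_sol' -/f.
  rewrite (_ : _ - _ = c * (f c - f (W w)) + (c - W w) * f (W w) + (h c - h (W w))); last by ring.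
  rewrite /f hc'.
  apply: le_trans (ler_normD _ _) _; apply: lerD; last exact: ramp_lip_near.
  apply: le_trans (ler_normD _ _) _; apply: lerD.
    rewrite !normrM mulrC; apply: ler_pM; rewrite ?mulr_ge0//.
    by apply: ler_pM.
  by rewrite normrM mulrC; apply: ler_pM.
have step1 : `|\sum_(i in J) Ex (fun w => X i w * (f (W w) - f (far i w)))
     - Ex (fun w => (\sum_(i in J) Y i w) * f' (W w))| <= K * D * Ex G.
  under [X in _ - Ex X]eq_fun do rewrite mulr_suml.
  rewrite Ex_sum; last by move=> i _; have ? := bY i; bm.
  rewrite -sumrB; apply: le_trans (ler_norm_sum _ _ _) _.
  have bff i : bmeas (fun w => f (far i w)) by exact: bmeas_comp.
  apply: (@le_trans _ _ (\sum_(i in J) b * beta * Ex G)).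
    apply: ler_sum => i _; have ? := bff i; have ? := bX i; have ? := bY i.
    rewrite -ExB; [|by bm|by bm].
    apply: le_trans (Ex_norm _ _) _; first by bm.
    rewrite -ExZ//; apply: Ex_le; [by bm|by bm|exact: key].
  rewrite sumr_const -mulr_natl mulrA ler_wpM2r//; first exact: Ex_ge0.
  rewrite [leLHS](_ : _ = #|J|%:R * b ^+ 2 * D); last by ring.
  by rewrite ler_wpM2r// (le_trans _ D_ge1).
(* The factor of f'(W) is 1 minus the sum of the [Y i], that is [1 - v] minus the centred sum of the
   [Z i]. *)
have step2 : `|Ex (fun w => f' (W w)) - Ex (fun w => (\sum_(i in J) Y i w) * f' (W w))|
    <= 2 * `|1 - v| + b + 8 * K * D ^+ 4 * b.
  rewrite -ExB//; last by bm.
  apply: le_trans (Ex_norm _ _) _; first by bm.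
  apply: (@le_trans _ _ (Ex (fun w => 2 * `|1 - v| + 2 * `|\sum_(i in J) Z i w|))).
    have bZ i : bmeas (Z i) by exact: dep_bmeas (depZ i).
    apply: Ex_le; [by bm|by bm|move=> w].
    rewrite (_ : _ - _ = ((1 - v) - \sum_(i in J) Z i w) * f' (W w)); last first.
      by rewrite /Z sumrB sum_EY; ring.
    rewrite normrM -mulrDr mulrC; apply: ler_pM => //; first exact: stein_sol'_le.
    exact: ler_normB.
  have bZ i : bmeas (Z i) by exact: dep_bmeas (depZ i).
  rewrite ExD; [|exact: bmeas_cst|by bm].
  rewrite (Ex_cst P (2 * `|1 - v|)) ExZ; last by bm.
  by have := EZ_abs; lra.
have -> : 2 * beta * (Ex (fun w => `|W w|) + beta) + 6 * beta
     + beta / e * Ex (fun w => \1_I (W w)) = Ex G.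
  have bN : bmeas (fun w => `|W w| + beta) by bm.
  rewrite /G ExD; [|by bm|by bm].
  rewrite ExD; [|by bm|by bm].
  rewrite (Ex_cst P (6 * beta)) (ExZ P _ bN) (ExZ P _ bI).
  by rewrite ExD ?Ex_cst//; by bm.
set a := Ex (fun w => f' _) in step2 *; set s := \sum_(i in J) _ in step1 *.
set t := Ex _ in step1 step2.
have -> : a - s = (a - t) - (s - t) by ring.
by apply: le_trans (ler_normB _ _) _; exact: lerD.
Qed.

Local Notation F t := (fine (P [set w | W w <= t])).
Local Notation Phi := (@std_normal_cdf R).

Let mW (t : R) : measurable [set w | W w <= t].
Proof.
have := bW.1 measurableT _ (measurable_itv `]-oo, t]); rewrite setTI.
by congr measurable; apply/seteqP; split=> w /=; rewrite in_itv/=.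
Qed.

Let F_indic (t : R) : F t = Ex (fun w => \1_[set x : R | x <= t] (W w) : R).
Proof.
rewrite -Ex_indic//; congr Ex; exact/funext.
Qed.

Let bFt (t : R) : bmeas (fun w => \1_[set x : R | x <= t] (W w) : R).
Proof.
apply: bmeas_indic_comp => //.
rewrite (_ : [set x | x <= t] = [set` `]-oo, t]]); first exact: measurable_itv.
by apply/seteqP; split=> x /=; rewrite in_itv.
Qed.

(* The error of smoothing is bounded by the Kolmogorov distance itself, with a
   factor 1/2 when the width is of order [K * D ^+ 2 * b]; the supremum of the
   distance can then be absorbed. *)
Lemma local_berry_esseen_step (Delta : R) : v <= 2 ->
  (forall t : R, `|F t - Phi t| <= Delta) ->
  forall t : R, `|F t - Phi t| <= Delta / 2 + (2 * `|1 - v| + 26 * K * D ^+ 4 * b).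
Proof.
move=> v2 hD t.
(* With this width the probability of the short interval has coefficient [K * D * beta / e = 1 / 4];
   as it is at most [2 * Delta + e + 3 * beta], the distance [Delta] enters with the factor 1/2. *)
pose e := 4 * K * D * beta.
have K0 : 0 < K by exact: lt_le_trans K_ge1.
have D0 : 0 < D by exact: lt_le_trans D_ge1.
have e0 : 0 < e by rewrite /e !mulr_gt0.
have EW : Ex (fun w => `|W w|) <= 3 / 2.
  by apply: le_trans (Ex_abs_le P bW ltr01) _; lra.
have main z : `|Ex (fun w => ramp z e (W w)) - gmean (ramp z e)|
   <= Delta / 2 + (2 * `|1 - v| + 22 * K * D ^+ 4 * b).
  apply: le_trans (stein_error z e0) _.
  have EI : Ex (fun w => \1_[set x | z - beta <= x <= z + e + beta] (W w)) <=
      2 * Delta + e + 3 * beta.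
    (* The left end is moved from [z - beta] to [z - 2 * beta] because the difference of two
       distribution functions does not count its left end point. *)
    have : Ex (fun w => \1_[set x | z - beta <= x <= z + e + beta] (W w)) <=
        F (z + e + beta) - F (z - 2 * beta).
      rewrite !F_indic -ExB//; apply: Ex_le.
      - apply: bmeas_indic_comp => //.
        rewrite (_ : [set x | _] = [set` `[z - beta, z + e + beta]]); first exact: measurable_itv.
        by apply/seteqP; split=> x /=; rewrite in_itv.
      - by bm.
      move=> w; rewrite !indicE.
      case: (boolP (_ \in [set x | z - _ <= x <= _])); rewrite ?inE => /=.
        move=> /andP[h1 h2].
        rewrite mem_set// memNset ?subr0//= => h3.
        by have := beta0; lra.
      move=> _; rewrite subr_ge0 ler_nat.
      case: (boolP (_ \in [set x | x <= z - _])) => //; rewrite inE /= => h1.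
      by rewrite mem_set//=; have := beta0; lra.
    have := hD (z + e + beta); have := hD (z - 2 * beta).
    rewrite !ler_norml => /andP[h2 h3] /andP[h4 h5].
    have : Phi (z + e + beta) <= Phi (z - 2 * beta) + (z + e + beta - (z - 2 * beta)).
      suff /andP[] : Phi (z - 2 * beta) <= Phi (z + e + beta) <=
        Phi (z - 2 * beta) + (z + e + beta - (z - 2 * beta)) by [].
      by apply: std_normal_cdf_lip; have := beta0; lra.
    lra.
  have -> : K * D * (2 * beta * (Ex (fun w => `|W w|) + beta) + 6 * beta +
    beta / e * Ex (fun w => \1_[set x | z - beta <= x <= z + e + beta] (W w))) =
    K * D * (2 * beta * (Ex (fun w => `|W w|) + beta) + 6 * beta) +
    Ex (fun w => \1_[set x | z - beta <= x <= z + e + beta] (W w)) / 4.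
    rewrite mulrDr; congr (_ + _); rewrite /e; field; rewrite ?gt_eqF//; lra.
  have h1 : K * D * (2 * beta * (Ex (fun w => `|W w|) + beta) + 6 * beta) <=
     11 * (K * D ^+ 4 * b).
    have -> : 11 * (K * D ^+ 4 * b) = K * D * (11 * (D ^+ 3 * b)) by ring.
    rewrite ler_pM2l ?mulr_gt0//.
    have hb : D <= D ^+ 3 by rewrite -[leLHS]expr1 ler_weXn2l.
    have hb2 : D ^+ 2 <= D ^+ 3 by rewrite ler_weXn2l.
    have hb3 : D * b <= D ^+ 3 * b by rewrite ler_pM2r.
    have hb4 : D ^+ 2 * b ^+ 2 <= D ^+ 3 * b.
      have bb : b ^+ 2 <= b by rewrite expr2 ler_piMl// ltW.
      by apply: ler_pM => //; exact: sqr_ge0.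
    have : beta * Ex (fun w => `|W w|) <= beta * (3 / 2) by rewrite ler_pM2l.
    have -> : 2 * beta * (Ex (fun w => `|W w|) + beta) + 6 * beta =
      2 * (beta * Ex (fun w => `|W w|)) + 2 * (D ^+ 2 * b ^+ 2) + 6 * (D * b) by ring.
    lra.
  have D41 : 1 <= D ^+ 4 by rewrite expr_ge1// ltW.
  have D42 : D ^+ 2 <= D ^+ 4 by rewrite ler_weXn2l.
  have D14 : D <= D ^+ 4 by rewrite -[leLHS]expr1 ler_weXn2l.
  have h2 : e <= 4 * (K * D ^+ 4 * b).
    rewrite /e (_ : 4 * K * D * (D * b) = 4 * (K * D ^+ 2 * b)); last by ring.
    by rewrite ler_pM2l// ler_pM2r// ler_pM2l.
  have h3 : beta <= K * D ^+ 4 * b.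
    by rewrite ler_pM2r// (le_trans D14)// ler_peMl// exprn_ge0// ltW.
  have h4 : b <= K * D ^+ 4 * b.
    rewrite ler_peMl ?(ltW b_gt0)// (le_trans D41)// ler_peMl// exprn_ge0//.
    exact: ltW.
  lra.
have eb : e <= 4 * K * D ^+ 4 * b.
  rewrite /e (_ : 4 * K * D * (D * b) = 4 * K * b * D ^+ 2); last by ring.
  rewrite (_ : 4 * K * D ^+ 4 * b = 4 * K * b * D ^+ 4); last by ring.
  by rewrite ler_pM2l ?mulr_gt0// ler_weXn2l.
have Kb0 : 0 <= K * D ^+ 4 * b by rewrite !mulr_ge0 ?exprn_ge0 ?(ltW K0) ?(ltW D0) ?(ltW b_gt0).
have bramp z : bmeas (fun w => ramp z e (W w)).
  by apply: bmeas_comp => //; exact: ramp_continuous.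
have up : F t <= Ex (fun w => ramp t e (W w)).
  rewrite F_indic; apply: Ex_le => // w; rewrite indicE.
  case: (boolP (_ \in _)); rewrite ?inE => /= h; last by case/andP: (ramp01 t e (W w)).
  by rewrite ramp1.
have dn : Ex (fun w => ramp (t - e) e (W w)) <= F t.
  rewrite F_indic; apply: Ex_le => // w; rewrite indicE.
  case: (boolP (_ \in _)) => [_|]; first by case/andP: (ramp01 (t - e) e (W w)).
  by rewrite notin_setE /= => /negP; rewrite -ltNge => h; rewrite ramp0// subrK ltW.
have := main t; have := main (t - e).
have g1 : gmean (ramp t e) <= Phi (t + e).
  by apply: gmean_le => [x|x|x]; [exact: ramp01|exact: ramp_continuous|exact: ramp0].
have g2 : Phi (t - e) <= gmean (ramp (t - e) e).
  by apply: gmean_ge => [x|x|x]; [exact: ramp01|exact: ramp_continuous|exact: ramp1].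
have /andP[_ p1] : Phi t <= Phi (t + e) <= Phi t + (t + e - t).
  by apply: std_normal_cdf_lip; lra.
have /andP[_ p2] : Phi (t - e) <= Phi t <= Phi (t - e) + (t - (t - e)).
  by apply: std_normal_cdf_lip; lra.
rewrite !ler_norml => /andP[? ?] /andP[? ?]; apply/andP; split; lra.
Qed.

(** The supremum of the distances is at most 1, hence finite, and the preceding step applies to it:
    it is at most half of itself plus the error, which doubles the constants. *)
Lemma local_berry_esseen (t : R) : v <= 2 ->
  `|F t - Phi t| <= 4 * `|1 - v| + 52 * K * D ^+ 4 * b.
Proof.
move=> v2.
pose E := [set `|F t - Phi t| | t in [set: R]].
have E1 : ubound E 1.
  move=> _ [s _ <-].
  have f0 : 0 <= F s by rewrite fine_ge0.
  have f1 : F s <= 1.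
    rewrite -lee_fin fineK; last exact: fin_num_measure.
    exact: probability_le1.
  have := std_normal_cdf_ge0 s; have := std_normal_cdf_le1 s.
  by rewrite ler_norml => *; lra.
have hs : has_sup E by split; [exists `|F 0 - Phi 0|, 0|exists 1].
have hD s : `|F s - Phi s| <= sup E by apply: sup_upper_bound => //; exists s.
have : sup E <= sup E / 2 + (2 * `|1 - v| + 26 * K * D ^+ 4 * b).
  apply: sup_le_ub; first by case: hs.
  by move=> _ [s _ <-]; apply: local_berry_esseen_step.
by have := hD t; lra.
Qed.

End berry_esseen.
End local_dependence.

(** * Measurability on configurations *)

Section configuration_sums.
Context dE (E : measurableType dE) (R : realType).
Context dT (T : measurableType dT).
Implicit Types (X : {fset E}) (B : set E).

Lemma npoints_sum X B : (npoints X B)%:R = \sum_(z <- X) \1_B z :> R.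
Proof.
rewrite /npoints card_fset_sum1 natr_sum -big_fset_condE /= big_mkcond /=.
by apply: eq_bigr => z _; rewrite indicE; case: ifP.
Qed.

Lemma measurable_npointsP (f : T -> {fset E}) :
  (forall B k, measurable B -> measurable [set t | npoints (f t) B = k]) ->
  measurable_fun setT f.
Proof.
move=> h; apply: (@measurability _ _ T _ setT f (@counting_events _ E) erefl).
by move=> _ [_ [B [k [mB ->]]] <-]; rewrite setTI; exact: h.
Qed.

Lemma measurable_npoints_eq (f : T -> {fset E}) B k : measurable_fun setT f ->
  measurable B -> measurable [set t | npoints (f t) B = k].
Proof.
move=> mf mB; have := mf measurableT [set X | npoints X B = k].
by rewrite setTI; apply; apply: sub_sigma_algebra; exists B, k.
Qed.

Lemma measurable_npoints (f : T -> {fset E}) B : measurable_fun setT f ->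
  measurable B -> measurable_fun setT (fun t => (npoints (f t) B)%:R : R).
Proof.
move=> mf mB _ Y mY; rewrite setTI.
rewrite (_ : _ @^-1` Y = \bigcup_(k in [set k : nat | Y k%:R])
    [set t | npoints (f t) B = k]); last first.
  apply/seteqP; split=> t /=; first by move=> Yt; exists (npoints (f t) B).
  by move=> [k /= Yk ->].
by apply: bigcup_measurable => k _; exact: measurable_npoints_eq.
Qed.

Lemma measurable_npointsRP (f : T -> {fset E}) :
  (forall B, measurable B ->
    measurable_fun setT (fun t => (npoints (f t) B)%:R : R)) ->
  measurable_fun setT f.
Proof.
move=> h; apply: measurable_npointsP => B k mB.
have := h _ mB measurableT _ (measurable_set1 (k%:R : R)); rewrite setTI.
congr measurable; apply/seteqP; split=> t /=; last by move=> ->.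
by move=> /eqP; rewrite eqr_nat => /eqP.
Qed.

Lemma sum_indic_bigcup (X : {fset E}) (t : T) (F : (set (E * T))^nat) :
  (forall n, measurable (F n)) -> trivIset setT F ->
  ((\sum_(z <- X) \1_(\bigcup_k F k) (z, t))%:E =
   \sum_(n <oo) (\sum_(z <- X) \1_(F n) (z, t))%:E :> \bar R)%E.
Proof.
move=> mF tF.
under [in RHS]eq_eseriesr do rewrite -sumEFin.
rewrite nneseries_sum; last by move=> *; rewrite lee_fin.
rewrite -sumEFin; apply: eq_bigr => z _.
transitivity (\d_(z, t) (\bigcup_k F k) : \bar R); first by rewrite diracE indicE.
by rewrite measure_semi_bigcup//; exact: bigcup_measurable.
Qed.

(** Dynkin's argument in [H]: for a rectangle the sum is a count times an indicator. If [T] is the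
    space of configurations and [f] the identity, the summand may depend on the whole configuration,
    as scores do. *)
Lemma measurable_sum_indic (f : T -> {fset E}) (H : set (E * T)) :
  measurable_fun setT f -> measurable H ->
  measurable_fun setT (fun t => \sum_(z <- f t) \1_H (z, t) : R).
Proof.
move=> mf mH.
pose C := [set A `*` B | A in @measurable _ E & B in @measurable _ T].
apply: (@dynkin_induction _ (E * T)%type C
  (fun H => measurable_fun setT (fun t => \sum_(z <- f t) \1_H (z, t) : R))) => //.
- by rewrite measurable_prod_measurableType.
- move=> _ _ [A1 mA1 [B1 mB1 <-]] [A2 mA2 [B2 mB2 <-]].
  exists (A1 `&` A2); first exact: measurableI.
  exists (B1 `&` B2); first exact: measurableI.
  by rewrite setXI.
- rewrite (_ : (fun _ => _) = fun t => (npoints (f t) setT)%:R); last first.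
    by apply/funext => t; rewrite npoints_sum !indicT.
  exact: measurable_npoints.
- move=> _ [A mA [B mB <-]].
  rewrite (_ : (fun _ => _) = fun t => (npoints (f t) A)%:R * \1_B t); last first.
    apply/funext => t; rewrite npoints_sum mulr_suml; apply: eq_bigr => z _.
    by rewrite !indicE in_setX /=; case: (_ \in A); case: (_ \in B); rewrite ?mulr1 ?mulr0.
  by apply: measurable_funM; [exact: measurable_npoints|exact: measurable_indic].
- move=> S mS hS.
  rewrite (_ : (fun _ => _) = fun t => (npoints (f t) setT)%:R - \sum_(z <- f t) \1_S (z, t)).
    by apply: measurable_funB => //; exact: measurable_npoints.
  apply/funext => t; rewrite npoints_sum -sumrB; apply: eq_bigr => z _.
  by rewrite !indicE in_setC in_setT; case: (_ \in S); rewrite ?subr0 ?subrr.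
- move=> F mF tF hF.
  apply/measurable_EFinP.
  rewrite (_ : EFin \o _ = fun t => (\sum_(n <oo) (\sum_(z <- f t) \1_(F n) (z, t))%:E)%E).
    apply: ge0_emeasurable_sum => [n t _ _|n _].
      by rewrite lee_fin sumr_ge0.
    exact/measurable_EFinP.
  by apply/funext => t /=; exact: sum_indic_bigcup.
- by rewrite -measurable_prod_measurableType.
Qed.

Import HBNNSimple.

Lemma measurable_sum_nnsfun (f : T -> {fset E}) (g : {nnsfun (E * T)%type >-> R}) :
  measurable_fun setT f ->
  measurable_fun setT (fun t => \sum_(z <- f t) g (z, t) : R).
Proof.
move=> mf.
rewrite (_ : (fun _ => _) = fun t => \sum_(r <- fset_set (range g))
    r * \sum_(z <- f t) \1_(g @^-1` [set r]) (z, t)); last first.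
  apply/funext => t.
  under eq_bigr do rewrite (fimfunE g) fsbig_finite//=.
  by rewrite exchange_big /=; apply: eq_bigr => r _; rewrite mulr_sumr.
apply: measurable_sum => r; apply: measurable_funM => //.
by apply: measurable_sum_indic => //; exact: measurable_funPTI.
Qed.

Lemma measurable_sum_ge0 (f : T -> {fset E}) (g : E * T -> \bar R) :
  measurable_fun setT f -> measurable_fun setT g -> (forall u, (0 <= g u)%E) ->
  @measurable_fun _ _ T (\bar R) setT (fun t => (\sum_(z <- f t) g (z, t))%E).
Proof.
move=> mf mg g0.
pose G (n : nat) (u : E * T) : R := nnsfun_approx measurableT mg n u.
apply: (@emeasurable_fun_cvg _ T R setT
  (fun n t => (\sum_(z <- f t) (G n (z, t))%:E)%E)
  (fun t => (\sum_(z <- f t) g (z, t))%E)) => [n|t _].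
  under eq_fun do rewrite sumEFin; apply/measurable_EFinP.
  exact: measurable_sum_nnsfun.
apply: cvg_nnesum => [z _|z _].
  by apply: nearW => n; rewrite lee_fin.
exact: cvg_nnsfun_approx.
Qed.

Lemma measurable_sum_real (f : T -> {fset E}) (g : E * T -> R) :
  measurable_fun setT f -> measurable_fun setT g ->
  measurable_fun setT (fun t => \sum_(z <- f t) g (z, t) : R).
Proof.
move=> mf mg.
have pos (h : E * T -> R) : measurable_fun setT h -> (forall u, 0 <= h u) ->
    measurable_fun setT (fun t => \sum_(z <- f t) h (z, t) : R).
  move=> mh h0; apply/measurable_EFinP.
  rewrite (_ : _ \o _ = fun t => (\sum_(z <- f t) (EFin \o h) (z, t))%E).
    by apply: measurable_sum_ge0 => //; exact/measurable_EFinP.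
  by apply/funext => t /=; rewrite sumEFin.
rewrite (_ : (fun _ => _) = fun t =>
  \sum_(z <- f t) Num.max (g (z, t)) 0 - \sum_(z <- f t) Num.max (- g (z, t)) 0).
  apply: measurable_funB.
    apply: (pos (fun u => Num.max (g u) 0)); first exact: measurable_maxr.
    by move=> u; rewrite le_max lexx orbT.
  apply: (pos (fun u => Num.max (- g u) 0)).
    by apply: measurable_maxr => //; exact: measurableT_comp.
  by move=> u; rewrite le_max lexx orbT.
apply/funext => t; rewrite -sumrB; apply: eq_bigr => z _.
rewrite /Num.max; case: (ltP (g (z, t)) 0) => ?; case: (ltP (- g (z, t)) 0) => ?; lra.
Qed.

End configuration_sums.

Section configuration_maps.
Context dE (E : measurableType dE) (R : realType).
Context dT (T : measurableType dT).

Lemma measurable_filter_config (f : T -> {fset E}) (H : set (E * T)) :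
  measurable_fun setT f -> measurable H ->
  measurable_fun setT (fun t => [fset z in f t | (z, t) \in H]%fset).
Proof.
move=> mf mH; apply: (@measurable_npointsRP _ _ R) => B mB.
rewrite (_ : (fun _ => _) = fun t => \sum_(z <- f t) \1_(H `&` (B `*` setT)) (z, t)).
  by apply: measurable_sum_indic => //; apply: measurableI => //; exact: measurableX.
apply/funext => t; rewrite npoints_sum -big_fset_condE /= big_mkcond /=.
apply: eq_bigr => z _; rewrite !indicE in_setI in_setX /= in_setT andbT.
by case: (_ \in H).
Qed.

(** Injectivity prevents points from merging, so a count of the image is a sum over the original
    points. *)
Lemma measurable_image_config dE' (E' : measurableType dE') (f : T -> {fset E})
    (phi : E * T -> E') :
  measurable_fun setT f -> measurable_fun setT phi ->
  (forall t, injective (fun z => phi (z, t))) ->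
  measurable_fun setT (fun t => [fset phi (z, t) | z in f t]%fset).
Proof.
move=> mf mphi iphi; apply: (@measurable_npointsRP _ _ R) => B mB.
rewrite (_ : (fun _ => _) = fun t => \sum_(z <- f t) \1_(phi @^-1` B) (z, t)).
  by apply: measurable_sum_indic => //; rewrite -[_ @^-1` _]setTI; exact: mphi.
apply/funext => t; rewrite npoints_sum big_imfset /=; last first.
  by move=> ? ? _ _; exact: iphi.
by apply: eq_bigr => z _; rewrite !indicE.
Qed.

Lemma npoints_add (X : {fset E}) (z : E) (B : set E) : z \notin X ->
  (npoints (z |` X)%fset B)%:R = (npoints X B)%:R + \1_B z :> R.
Proof.
by move=> zX; rewrite !npoints_sum big_fsetU1//= addrC.
Qed.

(** On [D] the point is new, so that each count is raised by an indicator. Without such a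
    restriction the event that the point is already present would have to be measurable. *)
Lemma measurable_add_config (f : T -> {fset E}) (z : T -> E) (D : set T) :
  measurable_fun setT f -> measurable_fun setT z -> measurable D ->
  (forall t, D t -> z t \notin f t) ->
  measurable_fun setT (fun t => if t \in D then (z t |` f t)%fset else f t).
Proof.
move=> mf mz mD hD; apply: (@measurable_npointsRP _ _ R) => B mB.
rewrite (_ : (fun _ => _) = fun t => (npoints (f t) B)%:R + \1_(D `&` z @^-1` B) t).
  apply: measurable_funD; first exact: measurable_npoints.
  apply: measurable_indic; apply: measurableI => //.
  by rewrite -[_ @^-1` _]setTI; exact: mz.
apply/funext => t; rewrite indicE in_setI; case: ifPn => [|_]; last by rewrite addr0.
by rewrite inE => /hD/npoints_add -> /=; rewrite indicE.
Qed.

End configuration_maps.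

(** * Measurable extension from a trace sigma-algebra *)

Section trace_extension.
Context d (T : measurableType d) (R : realType).

(** For rational q, the part of [D] where [q < g] is the trace of a measurable set [H q]. The
    supremum over q of the positive part of q on [H q] is measurable and recovers [g] on [D]; off
    [D] it may be infinite, hence the extended values. *)
Lemma trace_measurable_extension (D : set T) (g : T -> R) :
  (forall t, 0 <= g t) ->
  preimage_set_system D g measurable `<=` preimage_set_system D id measurable ->
  exists G : T -> \bar R, [/\ measurable_fun setT G, (forall t, (0 <= G t)%E) &
    forall t, D t -> G t = (g t)%:E].
Proof.
move=> g0 hg.
have /choice[H hH] : forall q : rat, exists H : set T, measurable H /\
    D `&` H = D `&` [set t | ratr q < g t].
  move=> q; have [|H mH /= HE] := hg (D `&` [set t | ratr q < g t]).
    exists [set` `]ratr q, +oo[]; first exact: measurable_itv.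
    by congr (_ `&` _); apply/seteqP; split=> t /=; rewrite in_itv/= andbT.
  by exists H; split => //; rewrite -HE preimage_id.
pose F (n : nat) (t : T) : \bar R :=
  (* An enumeration of the rationals; the default 0 for integers that code no rational is harmless,
     since it contributes the value 0. *)
  let q := odflt 0%R (choice.unpickle n : option rat) in ((Num.max 0 (ratr q)) * \1_(H q) t)%:E.
pose G t := ereal_sup [set F n t | n in [set: nat]].
exists G; split.
- rewrite (_ : G = fun t => esups (F ^~ t) 0%N); last first.
    apply/funext => t; rewrite /G /esups /=; congr ereal_sup.
    by apply/seteqP; split=> _ [n _ <-]; exists n.
  apply: measurable_fun_esups => n; apply/measurable_EFinP.
  apply: measurable_funM => //; apply: measurable_indic.
  by have [] := hH (odflt 0%R (choice.unpickle n : option rat)).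
- move=> t; apply: (@le_trans _ _ (F 0%N t)).
    by rewrite lee_fin mulr_ge0// le_max lexx.
  by apply: ereal_sup_ubound; exists 0%N.
move=> t Dt; apply/eqP; rewrite eq_le; apply/andP; split.
  apply: ge_ereal_sup => _ [n _ <-]; rewrite /F lee_fin indicE.
  set q := odflt _ _; have [mH HE] := hH q.
  case: (boolP (t \in H q)) => [|_]; last by rewrite mulr0.
  rewrite inE => Ht; have : (D `&` H q) t by [].
  by rewrite HE => -[_ /= h]; rewrite mulr1 ge_max g0 ltW.
apply/lee_subgt0Pr => e e0.
have [gt0|gt0] := ltP 0 (g t - e); last first.
  apply: le_trans (_ : 0%E <= _)%E; first by rewrite -EFinB lee_fin.
  apply: (@le_trans _ _ (F 0%N t)).
    by rewrite lee_fin mulr_ge0// le_max lexx.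
  by apply: ereal_sup_ubound; exists 0%N.
have [q] : exists q : rat, ratr q \in `](g t - e), (g t)[.
  have lt : g t - e < g t by rewrite ltrBlDr ltrDl.
  by have [q qi] := rat_in_itvoo lt; exists q.
rewrite in_itv/= => /andP[q1 q2].
have [mH HE] := hH q.
have Ht : H q t by have : (D `&` [set t | ratr q < g t]) t by []; rewrite -HE => -[].
apply: (@le_trans _ _ (F (choice.pickle q) t)); last by apply: ereal_sup_ubound; exists (choice.pickle q).
rewrite /F choice.pickleK /= indicE mem_set// mulr1 -EFinB lee_fin le_max.
by rewrite (ltW q1) orbT.
Qed.

End trace_extension.

(** * Poisson processes: independence and the Mecke formula *)

Section image_measure.
Context d1 d2 (T1 : measurableType d1) (T2 : measurableType d2) (R : realType).
Variables (m : {measure set T1 -> \bar R}) (f : T1 -> T2).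
Hypothesis mf : measurable_fun setT f.

Definition image_measure : set T2 -> \bar R := pushforward m f.

HB.instance Definition _ := Measure.copy image_measure
  (measure_function_pushforward__canonical__measure_function_Measure m mf).

Definition image_meas : {measure set T2 -> \bar R} := image_measure.

Lemma image_measE A : image_meas A = m (f @^-1` A).
Proof. by []. Qed.
End image_measure.

(** * Measures on configurations are determined by counts on partitions *)

Section config_uniqueness.
Context dE (E : measurableType dE) (R : realType).
Implicit Types (X : {fset E}) (B : set E).

Definition counts (I : finType) (A : I -> set E) (n : I -> nat) : set {fset E} :=
  [set X | forall i, npoints X (A i) = n i].

Lemma measurable_counts (I : finType) (A : I -> set E) n :
  (forall i, measurable (A i)) -> measurable (counts A n).
Proof.
move=> mA; rewrite (_ : counts A n =
  \bigcap_(i in [set: I]) [set X | npoints X (A i) = n i]); last first.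
  by apply/seteqP; split=> X /= h i; [move=> _; exact: h|exact: (h i Logic.I)].
apply: fin_bigcap_measurable => [|i _]; first exact: finite_finset.
by apply: (@measurable_npoints_eq _ _ _ _ id) => //; exact: measurable_id.
Qed.

(** Its fibres are the atoms of the finite algebra generated by the sets [B i]. *)
Definition signature (I : finType) (B : I -> set E) (z : E) : {set I} :=
  [set i | z \in B i].

Lemma measurable_signature (I : finType) (B : I -> set E) (a : {set I}) :
  (forall i, measurable (B i)) -> measurable [set z | signature B z = a].
Proof.
move=> mB; rewrite (_ : [set z | _] = \bigcap_(i in [set: I])
    (if i \in a then B i else ~` B i)); last first.
  apply/seteqP; split=> z /=.
    by move=> <- i _; rewrite inE; case: ifPn; rewrite ?inE ?notin_setE.
  move=> h; apply/setP => i; rewrite inE; have := h i Logic.I.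
  by case: ifPn => _ hz; [rewrite mem_set|rewrite memNset].
apply: fin_bigcap_measurable => [|i _]; first exact: finite_finset.
by case: ifPn => // _; exact: measurableC.
Qed.

Lemma npoints_signature (I : finType) (B : I -> set E) X i :
  npoints X (B i) = (\sum_(a : {set I} | i \in a) npoints X [set z | signature B z = a])%N.
Proof.
apply/eqP; rewrite -(eqr_nat R) natr_sum npoints_sum.
under [X in _ == X]eq_bigr do rewrite npoints_sum.
rewrite exchange_big /=; apply/eqP; apply: eq_bigr => z _.
rewrite (big_mkcond (fun a : {set I} => i \in a)) /= (bigD1 (signature B z)) //= big1 ?addr0.
  by rewrite !inE indicE [in RHS]indicE (mem_set (A := [set _ | _])); case: (z \in B i).
move=> a az; case: ifP => // _; rewrite indicE memNset//=.
by move=> h; move: az; rewrite -h eqxx.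
Qed.

Lemma npoints_setT_signature (I : finType) (B : I -> set E) X :
  npoints X setT = (\sum_(a : {set I}) npoints X [set z | signature B z = a])%N.
Proof.
apply/eqP; rewrite -(eqr_nat R) natr_sum npoints_sum.
under [X in _ == X]eq_bigr do rewrite npoints_sum.
rewrite exchange_big /=; apply/eqP; apply: eq_bigr => z _.
rewrite (bigD1 (signature B z)) //= big1 ?addr0.
  by rewrite indicT indicE mem_set.
by move=> a az; rewrite indicE memNset//= => h; move: az; rewrite -h eqxx.
Qed.

(** Events about counts on arbitrary sets split into events about the counts on the atoms they
    generate, so agreement on partitions is enough. Adding [B0] to the generators makes each atom
    lie on one side of [B0], which Mecke's formula requires. Finiteness is asked only for a fixed
    total count because it is not known beforehand for the Campbell measure. *)
Lemma config_measure_unique (m1 m2 : {measure set {fset E} -> \bar R}) (B0 : set E) :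
  measurable B0 ->
  (forall k, m1 [set X | npoints X setT = k] < +oo)%E ->
  (forall (I : finType) (A : I -> set E) (n : I -> nat) (b : pred I),
    (forall i, measurable (A i)) -> trivIset setT A -> \bigcup_i A i = setT ->
    (forall i, A i `<=` if b i then B0 else ~` B0) ->
    m1 (counts A n) = m2 (counts A n)) ->
  forall C, measurable C -> m1 C = m2 C.
Proof.
move=> mB0 m1oo h.
pose cyl (I : finType) (B : I -> set E) (n : I -> nat) k :=
  [set X : {fset E} | npoints X setT = k] `&` counts B n.
pose G := [set C | exists (I : finType) (B : I -> set E) (n : I -> nat) k,
   (forall i, measurable (B i)) /\ C = cyl I B n k].
have mG C : G C -> measurable C.
  move=> [I [B [n [k [mB ->]]]]]; apply: measurableI; last exact: measurable_counts.
  by apply: (@measurable_npoints_eq _ _ _ _ id) => //; exact: measurable_id.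
have Gk k : G [set X | npoints X setT = k].
  exists void, (fun _ => setT), (fun=> 0%N), k; split => //.
  by apply/seteqP; split=> X; [move=> h'; split => //; case|case].
apply: (measure_unique G (fun k => [set X | npoints X setT = k])) => //.
- apply/seteqP; split.
    apply: smallest_sub; first exact: smallest_sigma_algebra.
    move=> _ [B [k [mB ->]]].
    rewrite (_ : [set X | _] = \bigcup_k0 cyl unit (fun=> B) (fun=> k) k0); last first.
      apply/seteqP; split=> X /=; last by move=> [k0 _ [_ /(_ tt)]].
      by move=> Xk; exists (npoints X setT) => //; split.
    apply: sigma_algebra_bigcup => k0; apply: sub_sigma_algebra.
    by exists unit, (fun=> B), (fun=> k), k0.
  apply: smallest_sub; first exact: smallest_sigma_algebra.
  by move=> C /mG.
- move=> _ _ [I1 [B1 [n1 [k1 [mB1 ->]]]]] [I2 [B2 [n2 [k2 [mB2 ->]]]]].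
  exists (option (I1 + I2))%type, (fun j => match j with None => setT | Some (inl i) => B1 i | Some (inr i) => B2 i end),
    (fun j => match j with None => k2 | Some (inl i) => n1 i | Some (inr i) => n2 i end), k1.
  split; first by case => // -[].
  apply/seteqP; split=> X /=.
    by move=> [[X1 X2] [X3 X4]]; split => // -[[i|i]|] //=.
  move=> [X1 X2]; split; split => //; first by move=> i; exact: (X2 (Some (inl i))).
    exact: (X2 None).
  by move=> i; exact: (X2 (Some (inr i))).
- by apply/seteqP; split=> X // _; exists (npoints X setT).
move=> _ [I [B [n [k [mB ->]]]]].
pose B' (j : option I) := if j is Some i then B i else B0.
have mB' j : measurable (B' j) by case: j.
pose At (a : {set option I}) := [set z | signature B' z = a].
have mAt a : measurable (At a) by exact: measurable_signature.
(* The total count being [k], each atom contains at most [k] points, and only finitely many count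
   vectors on the atoms are compatible with the event. *)
pose good (c : {ffun {set option I} -> 'I_k.+1}) : bool :=
  ((\sum_a c a)%N == k) && [forall i, (\sum_(a : {set option I} | Some i \in a) c a)%N == n i].
pose F (c : {ffun {set option I} -> 'I_k.+1}) := counts At (fun a => c a : nat).
have CE : cyl I B n k = \bigcup_(c in [set c | good c]) F c.
  apply/seteqP; split=> X /=.
    move=> [Xk Xn].
    have le_k a : (npoints X (At a) < k.+1)%N.
      rewrite ltnS -Xk (npoints_setT_signature B' X).
      by rewrite (bigD1 a)//= leq_addr.
    exists [ffun a => Ordinal (le_k a)]; last by move=> a; rewrite ffunE.
    apply/andP; split.
      rewrite -[X in _ == X]Xk (npoints_setT_signature B' X); apply/eqP.
      by apply: eq_bigr => a _; rewrite ffunE.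
    apply/forallP => i; rewrite -Xn.
    rewrite (npoints_signature B' X (Some i)); apply/eqP.
    by apply: eq_bigr => a _; rewrite ffunE.
  move=> [c /andP[/eqP ck /forallP cn] Xc]; split.
    rewrite /= (npoints_setT_signature B' X) -ck.
    by apply: eq_bigr => a _; rewrite Xc.
  move=> i; rewrite -(eqP (cn i)).
  rewrite -[B i]/(B' (Some i)) (npoints_signature B' X).
  by apply: eq_bigr => a _; rewrite Xc.
have FE : trivIset [set c | good c] F.
  apply/trivIsetP => c c' _ _ cc'; rewrite -subset0 => X [Xc Xc'].
  apply: (negP cc'); apply/eqP/ffunP => a; apply: val_inj.
  exact: etrans (esym (Xc a)) (Xc' a).
have mF c : measurable (F c) by exact: measurable_counts.
rewrite CE !measure_fin_bigcup//; [|exact: finite_finset|exact: finite_finset].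
apply: eq_fsbigr => c _.
apply: (h _ At _ (fun a => None \in a)) => //.
- by apply/trivIsetP => a a' _ _ aa'; rewrite -subset0 => z [/= h1 h2]; move: aa'; rewrite -h1 -h2 eqxx.
- by apply/seteqP; split=> z // _; exists (signature B' z).
- move=> a z /= <-; rewrite inE.
  by case: ifPn; rewrite /B' ?inE ?notin_setE.
Qed.

End config_uniqueness.

Section poisson_counts.
Context dO (Omega : measurableType dO) (R : realType) (P : probability Omega R).
Context dE (E : measurableType dE).
Implicit Types (B : set E).

Definition pois (a : R) (k : nat) : R :=
  if 0 < a then poisson_pmf a k else (k == 0%N)%:R.

Lemma poisson_prob1 (a : R) k : poisson_prob a 0 [set k] = (pois a k)%:E.
Proof.
rewrite /poisson_prob /pois; case: ifPn => a0.
  by rewrite esum_set1// lee_fin poisson_pmf_ge0.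
rewrite diracE; congr (_%:R%:E); congr nat_of_bool.
by apply/idP/idP => [|/eqP ->]; rewrite ?inE// => /= ->.
Qed.

Lemma pois_ge0 a k : 0 <= pois a k.
Proof. by rewrite /pois; case: ifP => // _; exact: poisson_pmf_ge0. Qed.

(** The recursion of Poisson weights on which Mecke's formula rests. *)
Lemma pois_succ a k : 0 <= a -> a * pois a k = k.+1%:R * pois a k.+1.
Proof.
rewrite le_eqVlt /pois => /orP[/eqP <-|a0]; first by rewrite ltxx mul0r mulr0.
rewrite a0 /poisson_pmf a0 factS natrM exprS.
field.
by rewrite nat1r !pnatr_eq0 -lt0n fact_gt0.
Qed.

Context (mu : {finite_measure set E -> \bar R}) (X : {RV P >-> {fset E}}).
Hypothesis hX : poisson_process mu X.

Lemma counts_law (I : finType) (A : I -> set E) (n : I -> nat) :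
  (forall i, measurable (A i)) -> trivIset setT A ->
  P (X @^-1` counts A n) = (\prod_i pois (fine (mu (A i))) (n i))%:E.
Proof.
move=> mA tA; have [h1 h2] := hX.
have -> : X @^-1` counts A n = \bigcap_(j in [set: 'I_#|I|])
    [set w | npoints (X w) (A (enum_val j)) = n (enum_val j)].
  apply/seteqP; split=> w /= h; first by move=> j _; exact: h.
  by move=> i; have := h (enum_rank i) Logic.I; rewrite /= enum_rankK.
rewrite h2//; last first.
  apply/trivIsetP => i j _ _ ij; move/trivIsetP : tA => /(_ (enum_val i) (enum_val j) Logic.I Logic.I).
  by apply; rewrite (inj_eq enum_val_inj).
rewrite -prodEFin (big_enum_val (A := I) (fun i => (pois (fine (mu (A i))) (n i))%:E)).
by apply: eq_bigr => j _; rewrite h1// poisson_prob1.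
Qed.

Definition restr B (Y : {fset E}) : {fset E} := [fset z in Y | z \in B]%fset.

Lemma measurable_restr B : measurable B -> measurable_fun setT (restr B).
Proof.
move=> mB.
have := @measurable_filter_config _ E R _ {fset E} id (B `*` setT) (@measurable_id _ _ _).
move=> /(_ (measurableX mB measurableT)).
congr measurable_fun; apply/funext => Y; apply/fsetP => z.
by rewrite !inE in_setX /= in_setT andbT.
Qed.

Lemma npoints_restr B Y A : npoints (restr B Y) A = npoints Y (A `&` B).
Proof.
rewrite /npoints; congr (#|` _|); apply/fsetP => z; rewrite !inE in_setI.
by case: (z \in Y) => //=; rewrite andbC.
Qed.

Let mr B : measurable B -> measurable_fun setT (restr B \o X).
Proof.
by move=> mB; apply: measurableT_comp; [exact: measurable_restr|exact: measurable_funPT].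
Qed.

Lemma measurable_restr_preimage B C : measurable B -> measurable C ->
  measurable ((restr B \o X) @^-1` C).
Proof. by move=> mB mC; rewrite -[_ @^-1` _]setTI; exact: mr. Qed.

Let indep_counts B (I J : finType) (A1 : I -> set E) (A2 : J -> set E) n1 n2 :
  measurable B -> (forall i, measurable (A1 i)) -> (forall i, measurable (A2 i)) ->
  trivIset setT A1 -> trivIset setT A2 ->
  P ((restr B \o X) @^-1` counts A1 n1 `&` (restr (~` B) \o X) @^-1` counts A2 n2) =
  (P ((restr B \o X) @^-1` counts A1 n1) * P ((restr (~` B) \o X) @^-1` counts A2 n2))%E.
Proof.
move=> mB mA1 mA2 tA1 tA2; have mBC := measurableC mB.
have cE (K : finType) (A : K -> set E) n D : (restr D \o X) @^-1` counts A n =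
    X @^-1` counts (fun i => A i `&` D) n.
  by apply/seteqP; split=> w /= h i; have := h i; rewrite npoints_restr.
pose A (j : (I + J)%type) := match j with inl i => A1 i `&` B | inr i => A2 i `&` ~` B end.
pose n (j : (I + J)%type) := match j with inl i => n1 i | inr i => n2 i end.
have -> : (restr B \o X) @^-1` counts A1 n1 `&` (restr (~` B) \o X) @^-1` counts A2 n2
    = X @^-1` counts A n.
  rewrite !cE; apply/seteqP; split=> w /=; first by move=> [h1 h2] [i|i]; [exact: h1|exact: h2].
  by move=> h; split=> i; [exact: (h (inl i))|exact: (h (inr i))].
rewrite !cE !counts_law//.
- by rewrite big_sumType /= EFinM.
- by move=> i; exact: measurableI.
- exact: trivIset_setIr.
- by move=> i; exact: measurableI.
- exact: trivIset_setIr.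
- by case=> i; exact: measurableI.
apply/trivIsetP => -[i|i] [j|j] _ _ ij; rewrite /A.
- move/trivIsetP : tA1 => /(_ i j Logic.I Logic.I); rewrite setIACA => ->.
    by rewrite set0I.
  by apply: contra ij => /eqP ->.
- by rewrite setIACA setICr setI0.
- by rewrite setIACA setICl setI0.
- move/trivIsetP : tA2 => /(_ i j Logic.I Logic.I); rewrite setIACA => ->.
    by rewrite set0I.
  by apply: contra ij => /eqP ->.
Qed.

Let indep_aux B C2 : measurable B -> measurable C2 ->
  (forall (I : finType) (A : I -> set E) (n : I -> nat),
    (forall i, measurable (A i)) -> trivIset setT A ->
    P ((restr B \o X) @^-1` counts A n `&` (restr (~` B) \o X) @^-1` C2) =
    (P ((restr B \o X) @^-1` counts A n) * P ((restr (~` B) \o X) @^-1` C2))%E) ->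
  forall C1, measurable C1 ->
    P ((restr B \o X) @^-1` C1 `&` (restr (~` B) \o X) @^-1` C2) =
    (P ((restr B \o X) @^-1` C1) * P ((restr (~` B) \o X) @^-1` C2))%E.
Proof.
move=> mB mC2 h C1 mC1; have mBC := measurableC mB.
have mD := measurable_restr_preimage mBC mC2.
have c0 : (0 <= P ((restr (~` B) \o X) @^-1` C2))%E by exact: measure_ge0.
have cfin : P ((restr (~` B) \o X) @^-1` C2) \is a fin_num by exact: fin_num_measure.
pose c : {nonneg R} := NngNum (fine_ge0 c0).
pose m1 := image_meas (mrestr P mD) (mr mB).
pose m2 : {measure set {fset E} -> \bar R} := mscale c (image_meas P (mr mB)).
have m2E C : m2 C = (P ((restr B \o X) @^-1` C) * P ((restr (~` B) \o X) @^-1` C2))%E.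
  by rewrite /m2 /= /mscale /= fineK// muleC.
rewrite -m2E -[LHS]/(m1 C1); apply: (config_measure_unique (B0 := setT)) => //.
- move=> k; rewrite /m1 image_measE /mrestr.
  apply: (@le_lt_trans _ _ (P setT)); last by rewrite probability_setT ltry.
  apply: le_measure; rewrite ?inE//; apply: measurableI => //.
  apply: measurable_restr_preimage => //.
  by apply: (@measurable_npoints_eq _ _ _ _ id) => //; exact: measurable_id.
- by move=> I A n b mA tA _ _; rewrite m2E -h.
Qed.

(** Uniqueness of measures is used once for each factor: first for [C1] with counts on a partition
    in place of [C2], and then for [C2]; the symmetric step exchanges [B] and its complement. *)
Lemma poisson_indep B C1 C2 : measurable B -> measurable C1 -> measurable C2 ->
  P ((restr B \o X) @^-1` C1 `&` (restr (~` B) \o X) @^-1` C2) =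
  (P ((restr B \o X) @^-1` C1) * P ((restr (~` B) \o X) @^-1` C2))%E.
Proof.
move=> mB mC1 mC2; apply: indep_aux => // I A n mA tA.
have mBC := measurableC mB.
rewrite setIC muleC.
have := @indep_aux (~` B) (counts A n) mBC (measurable_counts _ mA).
rewrite setCK; apply => // J A' n' mA' tA'.
by rewrite setIC muleC indep_counts.
Qed.

(** By [poisson_indep] the joint law of the two restrictions is the product of their laws; Fubini's
    theorem does the rest. *)
Lemma poisson_indep_Ex B (f g : {fset E} -> R) :
  measurable B -> bmeas f -> bmeas g ->
  Ex P (fun w => f (restr B (X w)) * g (restr (~` B) (X w))) =
  Ex P (fun w => f (restr B (X w))) * Ex P (fun w => g (restr (~` B) (X w))).
Proof.
move=> mB bf bg; have mBC := measurableC mB.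
have m1 := mr mB; have m2 := mr mBC.
have r1_sub : (restr B \o X) \in mfun by rewrite inE.
have r2_sub : (restr (~` B) \o X) \in mfun by rewrite inE.
pose p1 := distribution P (mfun_Sub r1_sub).
pose p2 := distribution P (mfun_Sub r2_sub).
have mpair : measurable_fun setT (fun w => (restr B (X w), restr (~` B) (X w))).
  exact/measurable_fun_pairP.
pose m' := image_meas P mpair.
have prodE A : measurable A -> (p1 \x p2)%E A = m' A.
  move=> mA; apply: product_measure_unique => // A1 A2 mA1 mA2.
  by rewrite /m' image_measE -poisson_indep.
pose h (u : {fset E} * {fset E}) := f u.1 * g u.2.
have bh : bmeas h.
  have [mf [K hK]] := bf; have [mg [L hL]] := bg; split.
    apply: measurable_funM.
      by apply: (measurableT_comp mf); exact: measurable_fst.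
    by apply: (measurableT_comp mg); exact: measurable_snd.
  by exists (K * L) => w; rewrite normrM ler_pM.
have Eprod : (\int[p1 \x p2]_u (h u)%:E)%E =
    (\int[P]_w (h (restr B (X w), restr (~` B) (X w)))%:E)%E.
  rewrite (eq_measure_integral m'); last by move=> A mA _; exact: prodE.
  rewrite /m' /= /image_measure integral_pushforward//.
  - by apply/measurable_EFinP; case: bh.
  - apply: integrable_bmeas; split; first by apply: (measurableT_comp _ mpair); case: bh.
    by case: bh => _ [K hK]; exists K => w; exact: hK.
have hK : exists K, forall u, `|h u| <= K by case: bh.
have mh : measurable_fun setT h by case: bh.
have ih : (p1 \x p2)%E.-integrable setT (EFin \o h).
  have [K {}hK] := hK.
  apply: (@le_integrable _ _ _ _ _ measurableT _ (cst K%:E)).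
  - exact/measurable_EFinP.
  - by move=> w _ /=; rewrite lee_fin (le_trans (hK w))// ler_norm.
  - apply/integrableP; split; first exact: measurable_cst.
    have ptot : (p1 \x p2)%E setT = 1%E.
      rewrite -setXTT product_measure1E//; transitivity (1 * 1 : \bar R)%E.
        by congr (_ * _)%E; exact: probability_setT.
      by rewrite mule1.
    rewrite integral_cst// (_ : (_ * _)%E = `|K%:E|%E) ?ltry//.
    by rewrite -[RHS]mule1; congr (_ * _)%E.
have p1E (phi : {fset E} -> R) : bmeas phi ->
    (\int[p1]_y (phi y)%:E)%E = (Ex P (fun w => phi (restr B (X w))))%:E.
  move=> bphi; have bc : bmeas (fun w => phi (restr B (X w))).
    split; first by apply: (measurableT_comp (f := phi)) m1; case: bphi.
    by case: bphi => _ [K' hK']; exists K' => w; exact: hK'.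
  rewrite /Ex /Rintegral fineK; last first.
    by apply: integrable_fin_num => //; exact: integrable_bmeas.
  rewrite /p1 /distribution integral_pushforward//.
    by apply/measurable_EFinP; case: bphi.
  exact: integrable_bmeas.
have p2E (phi : {fset E} -> R) : bmeas phi ->
    (\int[p2]_y (phi y)%:E)%E = (Ex P (fun w => phi (restr (~` B) (X w))))%:E.
  move=> bphi; have bc : bmeas (fun w => phi (restr (~` B) (X w))).
    split; first by apply: (measurableT_comp (f := phi)) m2; case: bphi.
    by case: bphi => _ [K' hK']; exists K' => w; exact: hK'.
  rewrite /Ex /Rintegral fineK; last first.
    by apply: integrable_fin_num => //; exact: integrable_bmeas.
  rewrite /p2 /distribution integral_pushforward//.
    by apply/measurable_EFinP; case: bphi.
  exact: integrable_bmeas.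
have := integral12_prod_meas1 ih; rewrite [RHS]Eprod => Efub.
rewrite [LHS]/Ex /Rintegral -Efub.
rewrite (eq_integral (fun x => (f x * Ex P (fun w => g (restr (~` B) (X w))))%:E)); last first.
  move=> x _; rewrite /fubini_F /= /h /=.
  under eq_integral do rewrite EFinM.
  rewrite integralZl//; last exact: integrable_bmeas.
  by rewrite p2E// EFinM.
under eq_integral do rewrite EFinM.
rewrite integralZr//; last exact: integrable_bmeas.
by rewrite p1E.
Qed.

End poisson_counts.

(** * Mecke's formula as an equality of two measures on pairs of a point and a configuration *)

Section mecke.
Context dO (Omega : measurableType dO) (R : realType) (P : probability Omega R).
Context dE (E : measurableType dE).
Context (mu : {finite_measure set E -> \bar R}) (X : {RV P >-> {fset E}}).
Hypothesis hX : poisson_process mu X.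

Let mX : measurable_fun setT X. Proof. exact: measurable_funPT. Qed.

Let mS (H : set (E * {fset E})) : measurable H ->
  measurable_fun setT (fun w => \sum_(z <- X w) \1_H (z, X w) : R).
Proof.
move=> mH; have := @measurable_sum_indic _ E R _ {fset E} id H (@measurable_id _ _ _) mH.
by move=> h; exact: (measurableT_comp h mX).
Qed.

(** The Campbell measure, the left side of Mecke's formula for indicators; [palm] below is the right
    side. *)
Definition campbell (H : set (E * {fset E})) : \bar R :=
  (\int[P]_w (\sum_(z <- X w) \1_H (z, X w))%:E)%E.

Let campbell0 : campbell set0 = 0%E.
Proof.
rewrite /campbell integral0_eq// => w _.
by rewrite big1// => z _; rewrite indic0.
Qed.

Let campbell_ge0 H : (0 <= campbell H)%E.
Proof. by apply: integral_ge0 => w _; rewrite lee_fin sumr_ge0. Qed.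

Let campbell_sigma_additive : semi_sigma_additive campbell.
Proof.
move=> F mF tF mUF; rewrite /campbell.
apply: cvg_toP.
  apply: ereal_nondecreasing_is_cvgn => a b ab.
  by apply: lee_sum_nneg_natr => // n _ _; exact: campbell_ge0.
rewrite -integral_nneseries//; last 2 first.
- by move=> n; apply/measurable_EFinP; exact: mS.
- by move=> n w _; rewrite lee_fin sumr_ge0.
by apply: eq_integral => w _; rewrite -sum_indic_bigcup.
Qed.

HB.instance Definition _ := isMeasure.Build _ _ _ campbell
  campbell0 campbell_ge0 campbell_sigma_additive.

Context (D : set (E * {fset E})).
Hypothesis mD : measurable D.
Hypothesis hD : forall z Y, D (z, Y) -> z \notin Y.
Hypothesis PD : forall z, P [set w | ~ D (z, X w)] = 0%E.

(** The guard [D] makes insertion measurable, as the bare condition that the point is new need not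
    be. For each fixed point the guard fails only with probability 0, so the formula is not
    affected. *)
Definition add_point (u : E * {fset E}) : {fset E} :=
  if u \in D then (u.1 |` u.2)%fset else u.2.

Lemma measurable_add_point : measurable_fun setT add_point.
Proof.
apply: (@measurable_add_config _ E R _ (E * {fset E})%type snd fst D) => //.
by move=> [z Y] /hD.
Qed.

Let psi (u : E * Omega) : E * {fset E} := (u.1, add_point (u.1, X u.2)).

Let mpsi : measurable_fun setT psi.
Proof.
apply/measurable_fun_pairP; split; first exact: measurable_fst.
apply: (measurableT_comp measurable_add_point).
apply/measurable_fun_pairP; split; first exact: measurable_fst.
by apply: (measurableT_comp mX); exact: measurable_snd.
Qed.

Let palm : {measure set (E * {fset E}) -> \bar R} :=
  image_meas (mu \x P)%E mpsi.

Let palmE H : measurable H ->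
  palm H = (\int[mu]_z P [set w | H (z, add_point (z, X w))])%E.
Proof.
move=> mH; rewrite /palm image_measE /product_measure1.
apply: eq_integral => z _ /=; congr (P _).
by apply/seteqP; split=> w; rewrite /xsection /= inE.
Qed.

Let mPX (S : set {fset E}) : measurable S -> measurable [set w | S (X w)].
Proof. by move=> mS'; rewrite -[X in measurable X]setTI; exact: mX. Qed.

Let mDz z : measurable [set w | ~ D (z, X w)].
Proof.
have : measurable_fun setT (fun w => (z, X w)).
  by apply/measurable_fun_pairP; split => //; exact: measurable_cst.
by move=> /(_ measurableT _ (measurableC mD)); rewrite setTI.
Qed.

Let P_eq_null (S1 S2 N : set Omega) : measurable S1 -> measurable S2 ->
  measurable N -> P N = 0%E -> (forall w, ~ N w -> S1 w <-> S2 w) -> P S1 = P S2.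
Proof.
move=> m1 m2 mN N0 h.
have half T1 T2 : measurable T1 -> measurable T2 ->
    (forall w, ~ N w -> T1 w -> T2 w) -> (P T1 <= P T2)%E.
  move=> mT1 mT2 hT; apply: (@le_trans _ _ (P (T2 `|` N))).
    apply: le_measure; rewrite ?inE//; first exact: measurableU.
    by move=> w T1w; have [Nw|Nw] := pselect (N w); [right|left; exact: hT].
  by rewrite -[leRHS]adde0 -N0; exact: measureU2.
by apply/eqP; rewrite eq_le; apply/andP; split; apply: half => // w Nw; case: (h w Nw).
Qed.

Let npoints_addn (Y : {fset E}) (z : E) (B : set E) : z \notin Y ->
  npoints (z |` Y)%fset B = (npoints Y B + (z \in B))%N.
Proof.
move=> zY; apply/eqP; rewrite -(eqr_nat R) npoints_add// natrD indicE.
by case: (z \in B).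
Qed.

(** Both sides are explicit. On the left the number of points in [B] is the sum of the [n i] over
    the cells inside [B]; on the right, inserting a point in [A i] asks the process for one point
    less there. The terms agree by [pois_succ]. *)
Let mecke_partition (B : set E) (I : finType) (A : I -> set E) (n : I -> nat) (b : pred I) :
  measurable B -> (forall i, measurable (A i)) -> trivIset setT A ->
  \bigcup_i A i = setT -> (forall i, A i `<=` if b i then B else ~` B) ->
  campbell (B `*` counts A n) = palm (B `*` counts A n).
Proof.
move=> mB mA tA cA hb.
have mC : measurable (counts A n) by exact: measurable_counts.
pose p := \prod_i pois (fine (mu (A i))) (n i).
have indB z : \1_B z = \sum_(i | b i) \1_(A i) z :> R.
  have [i _ Aiz] : (\bigcup_i A i) z by rewrite cA.
  have uniqA j : j != i -> ~ A j z.
    move=> ji Ajz; move/trivIsetP : tA => /(_ _ _ Logic.I Logic.I ji).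
    by rewrite -subset0 => /(_ z); apply.
  rewrite big_mkcond (bigD1 i)//= big1 ?addr0; last first.
    by move=> j ji; case: ifP => // _; rewrite indicE memNset//; exact: uniqA.
  by have := hb i _ Aiz; case: ifP => _ ?; rewrite !indicE; [rewrite !mem_set|rewrite memNset].
have -> : campbell (B `*` counts A n) = ((\sum_(i | b i) (n i)%:R) * p)%:E.
  rewrite /campbell (eq_integral (fun w => ((\sum_(i | b i) (n i)%:R) * \1_(X @^-1` counts A n) w)%:E)); last first.
    move=> w _; congr EFin.
    transitivity ((\sum_(z <- X w) \1_B z) * \1_(X @^-1` counts A n) w : R).
      rewrite mulr_suml; apply: eq_bigr => z _; rewrite !indicE in_setX /=.
      rewrite (_ : (w \in X @^-1` _) = (X w \in counts A n)); last by apply/idP/idP; rewrite !inE.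
      by case: (z \in B); case: (X w \in _); rewrite ?mulr1 ?mulr0.
    rewrite [in LHS]indicE [in RHS]indicE; case: (boolP (w \in _)); rewrite ?mulr0// ?mulr1 inE => Xw.
    under eq_bigr do rewrite indB.
    by rewrite exchange_big /=; apply: eq_bigr => i _; rewrite -npoints_sum Xw.
  under eq_integral do rewrite EFinM.
  rewrite ge0_integralZl//; last first.
  - by rewrite lee_fin sumr_ge0.
  - by apply/measurable_EFinP; apply: measurable_indic; exact: mPX.
  rewrite integral_indic//; last exact: mPX.
  by rewrite [RHS]EFinM; congr (_ * _)%E; rewrite setIT; exact: (counts_law hX n mA tA).
rewrite palmE; last exact: measurableX.
(* The counts before a point of [A i] is inserted. If [n i] is 0 the event is impossible and [c i]
   is set to 0, so the truncated subtraction is never met. *)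
pose n' i j := (n j - (j == i))%N.
pose c i := if n i is _.+1 then \prod_j pois (fine (mu (A j))) (n' i j) else 0.
have c0 i : 0 <= c i by rewrite /c; case: (n i) => // _; apply: prodr_ge0 => j _; exact: pois_ge0.
have Pc i z : A i z -> P [set w | counts A n (add_point (z, X w))] = (c i)%:E.
  move=> Aiz.
  have mS1 : measurable [set w | counts A n (add_point (z, X w))].
    have : measurable_fun setT (fun w => add_point (z, X w)).
      apply: (measurableT_comp measurable_add_point).
      by apply/measurable_fun_pairP; split => //; exact: measurable_cst.
    by move=> /(_ measurableT _ mC); rewrite setTI.
  have zA j : (z \in A j) = (j == i).
    apply/idP/idP => [|/eqP ->]; rewrite inE// => Ajz.
    apply/negPn/negP => ji; move/trivIsetP : tA => /(_ _ _ Logic.I Logic.I ji).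
    by rewrite -subset0 => /(_ z); apply.
  have addE w : ~ (~ D (z, X w)) ->
      counts A n (add_point (z, X w)) <-> forall j, (npoints (X w) (A j) + (j == i))%N = n j.
    move=> /contrapT Dw; rewrite /add_point mem_set//=.
    by split=> h j; have := h j; rewrite npoints_addn ?zA//; exact: hD.
  rewrite /c; case ni : (n i) => [|k].
    transitivity (P set0); last exact: measure0.
    apply: (P_eq_null _ _ (mDz z)) => // w /addE hw.
    by split => // /hw /(_ i); rewrite eqxx addn1 ni.
  rewrite -(counts_law hX)//.
  apply: (P_eq_null _ _ (mDz z)) => // [|w /addE hw].
    by apply: mPX; exact: measurable_counts.
  rewrite /n'; split=> [/hw h j /=|h]; first by rewrite -h addnK.
  apply/hw => j; rewrite (h j) subnK//.
  by case: eqP => // ->; rewrite ni.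
rewrite (eq_integral (fun z => (\sum_(i | b i) (c i) * \1_(A i) z)%:E)); last first.
  move=> z _; have [i _ Aiz] : (\bigcup_i A i) z by rewrite cA.
  have uniqA j : j != i -> ~ A j z.
    move=> ji Ajz; move/trivIsetP : tA => /(_ _ _ Logic.I Logic.I ji).
    by rewrite -subset0 => /(_ z); apply.
  rewrite big_mkcond (bigD1 i)//= big1 ?addr0; last first.
    by move=> j ji; case: ifP => // _; rewrite indicE memNset ?mulr0//; exact: uniqA.
  have := hb i _ Aiz; case: ifP => _ Bz.
    rewrite indicE mem_set// mulr1 -(Pc i z Aiz); congr (P _).
    by apply/seteqP; split=> w /= => [[]|].
  transitivity (P set0); last exact: measure0.
  congr (P _).
  by apply/seteqP; split=> w //= -[].
have -> : (\sum_(i | b i) (n i)%:R) * p = \sum_(i | b i) c i * fine (mu (A i)).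
  rewrite mulr_suml; apply: eq_bigr => i _.
  rewrite /c; case ni : (n i) => [|k]; first by rewrite !mul0r.
  rewrite /p (bigD1 i)//= [in RHS](bigD1 i)//= /n' eqxx ni subn1 /= mulrA.
  rewrite -pois_succ; last exact: fine_ge0.
  rewrite (eq_bigr (fun j => pois (fine (mu (A j))) (n j - (j == i))%N)); last first.
    by move=> j /negbTE ->; rewrite subn0.
  by ring.
rewrite -sumEFin -big_filter.
under [RHS]eq_integral do rewrite -sumEFin -big_filter.
rewrite ge0_integral_sum//; last 2 first.
- by move=> i; apply/measurable_EFinP; apply: measurable_funM => //; exact: measurable_indic.
- by move=> i z _; rewrite lee_fin mulr_ge0.
apply: eq_bigr => i _; under eq_integral do rewrite EFinM.
rewrite ge0_integralZl//; last 2 first.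
- by apply/measurable_EFinP; exact: measurable_indic.
- by rewrite lee_fin.
rewrite integral_indic// setIT EFinM fineK//.
exact: fin_num_measure.
Qed.

Let campbell_count_fin (k : nat) (H : set (E * {fset E})) : measurable H ->
  (forall z Y, H (z, Y) -> npoints Y setT = k) -> (campbell H < +oo)%E.
Proof.
move=> mH hH; apply: (@le_lt_trans _ _ (\int[P]_w (k%:R)%:E)%E); last first.
  rewrite integral_cst// (_ : (_ * _)%E = (k%:R)%:E) ?ltry//.
  by rewrite -[RHS]mule1; congr (_ * _)%E; exact: probability_setT.
apply: ge0_le_integral => //.
- by move=> w _; rewrite lee_fin sumr_ge0.
- by apply/measurable_EFinP; exact: mS.
move=> w _; rewrite lee_fin.
have [hk|hk] := pselect (npoints (X w) setT = k).
  rewrite -hk npoints_sum; apply: ler_sum => z _.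
  by rewrite indicT indicE; case: (_ \in _).
rewrite big1// => z _; rewrite indicE memNset// => /hH; exact: hk.
Qed.

(** Rectangles generate, and for a fixed first factor [B] both sides are measures in the second one,
    compared by [config_measure_unique] with [B0 := B]. On configurations of exactly [k] points the
    Campbell measure is at most [k], which gives the finiteness. *)
Lemma mecke_sets H : measurable H -> campbell H = palm H.
Proof.
have mN k : measurable [set Y : {fset E} | npoints Y setT = k].
  by apply: (@measurable_npoints_eq _ _ _ _ id) => //; exact: measurable_id.
pose G := [set B `*` C | B in @measurable _ E & C in @measurable _ {fset E}].
apply: (measure_unique G (fun k => setT `*` [set Y | npoints Y setT = k])).
- by rewrite measurable_prod_measurableType.
- move=> _ _ [A1 mA1 [B1 mB1 <-]] [A2 mA2 [B2 mB2 <-]].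
  exists (A1 `&` A2); first exact: measurableI.
  exists (B1 `&` B2); first exact: measurableI.
  by rewrite setXI.
- by move=> k; exists setT => //; exists [set Y | npoints Y setT = k].
- by apply/seteqP; split=> -[z Y] // _; exists (npoints Y setT).
- move=> _ [B mB [C mC <-]].
  have mBT : measurable (B `*` [set: {fset E}]) by exact: measurableX.
  have ms : measurable_fun setT (@snd E {fset E}) by exact: measurable_snd.
  pose m1 := image_meas (mrestr campbell mBT) ms.
  pose m2 := image_meas (mrestr palm mBT) ms.
  have hset C' : snd @^-1` C' `&` (B `*` setT) = B `*` C'.
    by apply/seteqP; split=> -[z Y] /=; [move=> [? []]|move=> []].
  have E1 C' : m1 C' = campbell (B `*` C') by exact: (congr1 campbell (hset _ C')).
  have E2 C' : m2 C' = palm (B `*` C') by exact: (congr1 palm (hset _ C')).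
  transitivity (m1 C); first exact/esym/E1.
  transitivity (m2 C); last exact: E2.
  apply: (config_measure_unique mB) => //.
    move=> k; rewrite E1; apply: (campbell_count_fin (k := k)); first exact: measurableX.
    by move=> z Y [].
  move=> I A n b mA tA cA hb; rewrite E1 E2; exact: mecke_partition mB mA tA cA hb.
- move=> k; apply: (campbell_count_fin (k := k)); first exact: measurableX.
  by move=> z Y [].
Qed.

Import HBNNSimple.

Lemma integral_campbell (g : E * {fset E} -> \bar R) :
  measurable_fun setT g -> (forall u, (0 <= g u)%E) ->
  (\int[campbell]_u g u = \int[P]_w (\sum_(z <- X w) g (z, X w))%R)%E.
Proof.
move=> mg g0; pose G n := nnsfun_approx measurableT mg n.
have mGS n : measurable_fun setT (fun w => \sum_(z <- X w) G n (z, X w) : R).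
  have := @measurable_sum_nnsfun _ E R _ {fset E} id (G n) (@measurable_id _ _ _).
  by move=> h; exact: (measurableT_comp h mX).
have Gn n : (\int[campbell]_u (G n u)%:E =
    \int[P]_w (\sum_(z <- X w) G n (z, X w))%:E)%E.
  rewrite integralT_nnsfun sintegralE fsbig_finite//=.
  rewrite (eq_integral (fun w => (\sum_(r <- fset_set (range (G n)))
      (r * \sum_(z <- X w) \1_(G n @^-1` [set r]) (z, X w))%:E)%R)); last first.
    move=> w _; rewrite sumEFin; congr EFin.
    under eq_bigr do rewrite (fimfunE (G n)) fsbig_finite//=.
    by rewrite exchange_big /=; apply: eq_bigr => r _; rewrite mulr_sumr.
  have mr r : measurable (G n @^-1` [set r]) by exact: measurable_funPTI.
  have neg0 r : r < 0 -> G n @^-1` [set r] = set0.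
    by move=> r0; rewrite -subset0 => u /= Gu; move: r0; rewrite -Gu ltNge => /negP; apply.
  have term0 r w : 0 <= r * \sum_(z <- X w) \1_(G n @^-1` [set r]) (z, X w).
    have [r0|/neg0 ->] := leP 0 r; first by rewrite mulr_ge0// sumr_ge0.
    by rewrite big1 ?mulr0// => z _; rewrite indic0.
  rewrite ge0_integral_sum//; last 2 first.
  - by move=> r; apply/measurable_EFinP; apply: measurable_funM => //; exact: mS.
  - by move=> r w _; rewrite lee_fin.
  apply: eq_bigr => r _; have [r0|/neg0 ->] := leP 0 r; last first.
    rewrite measure0 mule0 integral0_eq// => w _.
    by rewrite big1 ?mulr0// => z _; rewrite indic0.
  under [RHS]eq_integral do rewrite EFinM.
  rewrite ge0_integralZl//.
  - by apply/measurable_EFinP; exact: mS.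
  - by move=> w _; rewrite lee_fin sumr_ge0.
rewrite (eq_integral (fun u => limn (fun n => (G n u)%:E))); last first.
  by move=> u _; apply/esym/cvg_lim => //; exact: cvg_nnsfun_approx.
rewrite monotone_convergence//; last 3 first.
- by move=> n; apply/measurable_EFinP.
- by move=> n u _; rewrite lee_fin.
- by move=> u _ a b ab; rewrite lee_fin; exact/lefP/nd_nnsfun_approx.
rewrite (eq_integral (fun w => limn (fun n => (\sum_(z <- X w) G n (z, X w))%:E))); last first.
  move=> w _; apply/esym/cvg_lim => //.
  under eq_cvg do rewrite -sumEFin.
  apply: cvg_nnesum => [z _|z _]; first by apply: nearW => n; rewrite lee_fin.
  exact: cvg_nnsfun_approx.
rewrite monotone_convergence//.
- by apply: congr_lim; apply/funext => n; rewrite Gn.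
- by move=> n; apply/measurable_EFinP.
- by move=> n u _; rewrite lee_fin sumr_ge0.
- move=> u _ a b ab; rewrite lee_fin; apply: ler_sum => z _.
  by exact/lefP/nd_nnsfun_approx.
Qed.

Lemma mecke (g : E * {fset E} -> \bar R) :
  measurable_fun setT g -> (forall u, (0 <= g u)%E) ->
  (\int[P]_w (\sum_(z <- X w) g (z, X w))%R =
   \int[mu]_z \int[P]_w g (z, add_point (z, X w)))%E.
Proof.
move=> mg g0; rewrite -integral_campbell//.
rewrite (eq_measure_integral palm); last by move=> H mH _; exact: mecke_sets.
rewrite /palm /image_meas /= /image_measure ge0_integral_pushforward//.
rewrite fubini_tonelli1//; first exact: (measurableT_comp mg mpsi).
by move=> u; exact: g0.
Qed.

End mecke.

(** * Densities, Poisson moments and marked configurations *)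

Section integral_monotone.
Context d (T : measurableType d) (R : realType) (nu : {measure set T -> \bar R}).

(** The integral of a nonnegative function is a supremum over simple functions below it, hence
    monotone without measurability. This is useful for scores, whose measurability is known only on
    a trace. *)
Lemma ge0_le_integral_any (f g : T -> \bar R) : (forall x, (0 <= f x)%E) ->
  (forall x, (f x <= g x)%E) -> (\int[nu]_x f x <= \int[nu]_x g x)%E.
Proof.
move=> f0 fg; have g0 x : (0 <= g x)%E by exact: le_trans (fg x).
rewrite !ge0_integralTE//; apply: le_ereal_sup.
by move=> _ [h hf <-]; exists h => // x; exact: le_trans (hf x) (fg x).
Qed.

Lemma ge0_integral_le_cst (P : probability T R) (f : T -> \bar R) (c : R) :
  (forall x, (0 <= f x)%E) -> (forall x, (f x <= c%:E)%E) ->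
  (\int[P]_x f x <= c%:E)%E.
Proof.
move=> f0 fc; apply: (@le_trans _ _ (\int[P]_x c%:E)%E).
  rewrite !ge0_integralTE//.
    apply: le_ereal_sup.
    by move=> _ [h hf <-]; exists h => // x; exact: le_trans (hf x) (fc x).
  by move=> x; exact: le_trans (fc x).
rewrite integral_cst// (_ : (_ * _)%E = c%:E)//.
by rewrite -[RHS]mule1; congr (_ * _)%E; exact: probability_setT.
Qed.

End integral_monotone.

Section density_measure.
Context d (T : measurableType d) (R : realType) (nu : {measure set T -> \bar R}).
Variable k : T -> R.
Hypothesis mk : measurable_fun setT k.
Hypothesis k0 : forall x, 0 <= k x.

Definition density_measure : set T -> \bar R :=
  fun B => (\int[nu]_(x in B) (k x)%:E)%E.

Let density0 : density_measure set0 = 0%E.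
Proof. by rewrite /density_measure integral_set0. Qed.

Let density_ge0 B : (0 <= density_measure B)%E.
Proof. by apply: integral_ge0 => x _; rewrite lee_fin. Qed.

Let density_sigma_additive : semi_sigma_additive density_measure.
Proof.
move=> F mF tF mUF; rewrite /density_measure ge0_integral_bigcup//.
- by apply: is_cvg_ereal_nneg_natsum_cond => n _ _; exact: density_ge0.
- by apply/measurable_EFinP; exact: measurable_funTS.
- by move=> x _; rewrite lee_fin.
Qed.

HB.instance Definition _ := isMeasure.Build _ _ _ density_measure
  density0 density_ge0 density_sigma_additive.

Hypothesis k_fin : (\int[nu]_x (k x)%:E < +oo)%E.

Let density_fin : fin_num_fun density_measure.
Proof.
move=> B mB; rewrite ge0_fin_numE ?density_ge0//; apply: le_lt_trans k_fin.
apply: ge0_subset_integral => //; first exact/measurable_EFinP.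
by move=> x _; rewrite lee_fin.
Qed.

HB.instance Definition _ := @Measure_isFinite.Build _ _ _ density_measure density_fin.

Definition density_fmeasure : {finite_measure set T -> \bar R} := density_measure.

End density_measure.

Section finite_product.
Context d1 d2 (T1 : measurableType d1) (T2 : measurableType d2) (R : realType).
Context (m1 : {finite_measure set T1 -> \bar R}) (m2 : probability T2 R).

Definition finite_product : set (T1 * T2) -> \bar R := (m1 \x m2)%E.

HB.instance Definition _ := Measure.on finite_product.

Let finite_product_fin : fin_num_fun finite_product.
Proof.
move=> B mB; rewrite ge0_fin_numE ?measure_ge0//.
apply: (@le_lt_trans _ _ (finite_product setT)).
  by apply: le_measure; rewrite ?inE.
rewrite /finite_product -setXTT product_measure1E// -ge0_fin_numE.
  by rewrite fin_numM// fin_num_measure.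
by rewrite mule_ge0.
Qed.

HB.instance Definition _ := @Measure_isFinite.Build _ _ _ finite_product finite_product_fin.

Definition finite_prod : {finite_measure set (T1 * T2)%type -> \bar R} := finite_product.

End finite_product.

Section lebesgue_null.
Context (R : realType) (d : nat).

(** The point is a corner of a box of side [h <= 1], of volume at most [h]. In dimension 0 the
    measure is a point mass. *)
Lemma lebesgue_rV_set1 (x : 'rV[R]_d) : (0 < d)%N -> lebesgue_rV R d [set x] = 0%E.
Proof.
case: d x => // n x _.
apply/eqP; rewrite eq_le measure_ge0 andbT.
apply/lee_addgt0Pr => e e0; rewrite add0e.
pose h := Num.min 1 e.
have h0 : 0 < h by rewrite lt_min ltr01.
have h1 : h <= 1 by rewrite ge_min lexx.
pose a : 'rV[R]_n.+1 := \row_i (x ord0 i - h).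
pose b : 'rV[R]_n.+1 := x.
have ab i : a ord0 i <= b ord0 i by rewrite mxE /b lerBlDr lerDl ltW.
have mbox : measurable [set v : 'rV[R]_n.+1 | forall i, a ord0 i < v ord0 i <= b ord0 i].
  rewrite (_ : [set v | _] = \bigcap_(i in [set: 'I_n.+1]) [set v : 'rV[R]_n.+1 |
     a ord0 i < v ord0 i <= b ord0 i]); last first.
    by apply/seteqP; split=> v /= => [bv i _|bv i]; [exact: bv|exact: (bv i Logic.I)].
  apply: fin_bigcap_measurable => [|i _]; first exact: finite_finset.
  have := @measurable_coord_rV R n.+1 i measurableT _ (measurable_itv `]a ord0 i, b ord0 i]).
  by rewrite setTI; congr measurable.
apply: (@le_trans _ _ (lebesgue_rV R n.+1 [set v | forall i, a ord0 i < v ord0 i <= b ord0 i])).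
  apply: le_measure; rewrite ?inE//.
    rewrite (_ : [set x] = \bigcap_(i in [set: 'I_n.+1]) [set v : 'rV[R]_n.+1 | v ord0 i = x ord0 i]).
      apply: fin_bigcap_measurable => [|i _]; first exact: finite_finset.
      have := @measurable_coord_rV R n.+1 i measurableT _ (measurable_set1 (x ord0 i)).
      by rewrite setTI; congr measurable.
    apply/seteqP; split=> v /=; first by move=> ->.
    by move=> h'; apply/rowP => i; exact: (h' i Logic.I).
  by move=> v /= -> i; rewrite mxE /b lexx andbT ltrBlDr ltrDl.
rewrite lebesgue_rV_box// lee_fin.
rewrite (eq_bigr (fun=> h)); last by move=> i _; rewrite mxE /b; ring.
rewrite prodr_const card_ord exprS.
apply: (@le_trans _ _ h); last by rewrite ge_min lexx orbT.
by rewrite ler_piMr ?(ltW h0)// exprn_ile1// ltW.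
Qed.

End lebesgue_null.

(** * Moments and tails of Poisson counts *)

Section poisson_moments.
Context dO (Omega : measurableType dO) (R : realType) (P : probability Omega R).
Context dE (E : measurableType dE).
Context (mu : {finite_measure set E -> \bar R}) (X : {RV P >-> {fset E}}).
Hypothesis hX : poisson_process mu X.
Context (D : set (E * {fset E})).
Hypothesis mD : measurable D.
Hypothesis hD : forall z Y, D (z, Y) -> z \notin Y.
Hypothesis PD : forall z, P [set w | ~ D (z, X w)] = 0%E.

Fixpoint pois_moment_cst (k : nat) : R :=
  if k is k'.+1 then 2 ^+ k' * (pois_moment_cst k' + 1) else 1.

Lemma pois_moment_cst_ge0 k : 0 <= pois_moment_cst k.
Proof. by elim: k => //= k IH; rewrite mulr_ge0// addr_ge0. Qed.

Lemma npoints_add_point B z Y : (npoints (add_point D (z, Y)) B <= (npoints Y B).+1)%N.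
Proof.
rewrite /add_point; case: ifPn => [|_ //]; rewrite inE => /hD zY /=.
rewrite -(ler_nat R) npoints_add// -natr1 lerD2l indicE.
by case: (_ \in _).
Qed.

(** Mecke's formula, with one factor of the power written as a sum over the points in [B], bounds
    the moment of order k + 1 by [mu B] times the moment of order k of the count plus one; then (n +
    1)^k is at most 2^k (n^k + 1). *)
Lemma poisson_moment B k : measurable B ->
  (\int[P]_w ((npoints (X w) B)%:R ^+ k)%:E <=
   (pois_moment_cst k * (1 + fine (mu B)) ^+ k)%:E)%E.
Proof.
move=> mB.
have mX : measurable_fun setT X by exact: measurable_funPT.
have mN : measurable_fun setT (fun w => (npoints (X w) B)%:R : R).
  exact: measurable_npoints.
have b0 : 0 <= fine (mu B) by exact: fine_ge0.
elim: k => [|k IH].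
  under eq_integral do rewrite expr0.
  rewrite integral_cst// mul1e /= mulr1.
  exact: probability_le1.
pose g (u : E * {fset E}) : \bar R := (\1_B u.1 * (npoints u.2 B)%:R ^+ k)%:E.
have mg : measurable_fun setT g.
  apply/measurable_EFinP; apply: measurable_funM.
    have mB1 : measurable_fun [set: E] (\1_B : E -> R) by exact: measurable_indic.
    by apply: (measurableT_comp mB1); exact: measurable_fst.
  apply: measurable_funX.
  by apply: (@measurable_npoints _ E R _ _ snd) => //; exact: measurable_snd.
have g0 u : (0 <= g u)%E by rewrite lee_fin mulr_ge0// exprn_ge0.
have -> : (\int[P]_w ((npoints (X w) B)%:R ^+ k.+1)%:E =
   \int[P]_w (\sum_(z <- X w) g (z, X w))%R)%E.
  apply: eq_integral => w _; rewrite sumEFin; congr EFin.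
  by rewrite exprS {1}npoints_sum mulr_suml.
rewrite (mecke hX mD hD PD mg g0).
set a := fine (mu B).
pose c := 2 ^+ k * (pois_moment_cst k + 1) * (1 + a) ^+ k.
have c0 : 0 <= c.
  by rewrite /c !mulr_ge0 ?exprn_ge0 ?addr_ge0// pois_moment_cst_ge0.
have succ_le (n : nat) : n.+1%:R ^+ k <= 2 ^+ k * (n%:R ^+ k + 1) :> R.
  case: n => [|n].
    rewrite expr1n; apply: (@le_trans _ _ (2 ^+ k)); first by rewrite exprn_ege1// ler1n.
    by rewrite ler_peMr ?exprn_ge0// lerDr exprn_ge0.
  apply: (@le_trans _ _ ((2 * n.+1%:R) ^+ k)).
    by apply: lerXn2r; rewrite ?nnegrE// -natrM ler_nat; lia.
  by rewrite exprMn ler_wpM2l ?exprn_ge0// lerDl.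
have inner z : (\int[P]_w g (z, add_point D (z, X w)) <= (c * \1_B z)%:E)%E.
  have [zB|zB] := boolP (z \in B); last first.
    apply: ge0_integral_le_cst => // w; rewrite /g /= indicE (negbTE zB) !mul0r.
    by rewrite mulr0.
  rewrite indicE zB mulr1.
  apply: (@le_trans _ _ (\int[P]_w ((2 ^+ k)%:E * (((npoints (X w) B)%:R ^+ k)%:E + 1)))%E).
    apply: ge0_le_integral_any => // w.
    rewrite /g /= indicE zB mul1r -EFinD -EFinM lee_fin.
    apply: le_trans (succ_le _); apply: lerXn2r; rewrite ?nnegrE// ler_nat.
    exact: npoints_add_point.
  rewrite ge0_integralZl//; first last.
  - by move=> w _; rewrite -EFinD lee_fin addr_ge0// exprn_ge0.
  - by apply/measurable_EFinP; apply: measurable_funD => //; exact: measurable_funX.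
  rewrite ge0_integralD//; last by apply/measurable_EFinP; exact: measurable_funX.
  rewrite /c -mulrA EFinM lee_wpmul2l ?lee_fin ?exprn_ge0// mulrDl EFinD mul1r.
  apply: leeD => //; apply: ge0_integral_le_cst => // w.
  by rewrite lee_fin exprn_ege1// lerDl.
apply: (@le_trans _ _ (\int[mu]_z (c * \1_B z)%:E)%E).
  apply: ge0_le_integral_any => // z; exact: integral_ge0.
under eq_integral do rewrite EFinM.
rewrite ge0_integralZl//; last by apply/measurable_EFinP; exact: measurable_indic.
have -> : (\int[mu]_x (\1_B x)%:E)%E = a%:E.
  by rewrite integral_indic// setIT /a fineK// fin_num_measure.
rewrite -EFinM lee_fin.
rewrite [leRHS](_ : _ = c * (1 + a)); last by rewrite /c /= exprSr; ring.
by rewrite ler_wpM2l// lerDr.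
Qed.

Lemma poisson_tail B k (u : R) : measurable B -> 0 < u ->
  fine (P [set w | u < (npoints (X w) B)%:R]) <=
  pois_moment_cst k * (1 + fine (mu B)) ^+ k / u ^+ k.
Proof.
move=> mB u0; have mX : measurable_fun setT X by exact: measurable_funPT.
have mN : measurable_fun setT (fun w => (npoints (X w) B)%:R : R).
  exact: measurable_npoints.
have mA : measurable [set w | u < (npoints (X w) B)%:R].
  have := mN measurableT _ (measurable_itv `]u, +oo[); rewrite setTI.
  by congr measurable; apply/seteqP; split=> w /=; rewrite in_itv/= andbT.
rewrite ler_pdivlMr ?exprn_gt0// -lee_fin EFinM fineK ?fin_num_measure//.
apply: le_trans (poisson_moment k mB).
rewrite muleC -[X in P X]setIT -integral_indic// -ge0_integralZl//; last 2 first.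
- by apply/measurable_EFinP; exact: measurable_indic.
- by rewrite lee_fin exprn_ge0// ltW.
apply: ge0_le_integral_any => w; first by rewrite mule_ge0// lee_fin exprn_ge0// ltW.
rewrite -EFinM lee_fin indicE; case: (boolP (_ \in _)); rewrite ?mulr0 ?exprn_ge0//.
rewrite inE /= mulr1 => /ltW h; apply: lerXn2r => //; rewrite ?nnegrE//.
exact: ltW.
Qed.

End poisson_moments.

(** * Insertion, rescaling and restriction to balls in the marked space *)

Section marked_space.
Context (R : realType) (d : nat) dM (M : measurableType dM).
Local Notation space := 'rV[R]_d.
Local Notation point := (space * M)%type.
Local Notation config := {fset (space * M)}.

Lemma measurable_rV_fun dT (T : measurableType dT) (f : T -> space) :
  measurable_fun setT f -> forall i, measurable_fun setT (fun t => f t ord0 i).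
Proof. by move=> mf i; apply: (measurableT_comp (@measurable_coord_rV R d i)). Qed.

Lemma measurable_rV_add dT (T : measurableType dT) (f g : T -> space) :
  measurable_fun setT f -> measurable_fun setT g ->
  measurable_fun setT (fun t => f t + g t : space).
Proof.
move=> mf mg; apply: measurable_fun_rVP => i.
under eq_fun do rewrite mxE.
by apply: measurable_funD; exact: measurable_rV_fun.
Qed.

Lemma measurable_rV_scale dT (T : measurableType dT) (a : R) (f : T -> space) :
  measurable_fun setT f -> measurable_fun setT (fun t => a *: f t : space).
Proof.
move=> mf; apply: measurable_fun_rVP => i.
under eq_fun do rewrite mxE.
by apply: measurable_funM => //; exact: measurable_rV_fun.
Qed.

Lemma measurable_rV_opp dT (T : measurableType dT) (f : T -> space) :
  measurable_fun setT f -> measurable_fun setT (fun t => - f t : space).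
Proof.
move=> mf; under eq_fun do rewrite -scaleN1r; exact: measurable_rV_scale.
Qed.

Lemma measurable_enorm dT (T : measurableType dT) (f : T -> space) :
  measurable_fun setT f -> measurable_fun setT (fun t => enorm (f t)).
Proof.
move=> mf; rewrite /enorm; apply: measurableT_comp.
  exact: continuous_measurable_fun (@sqrt_continuous R).
apply: measurable_sum => i; apply: measurable_funX; exact: measurable_rV_fun.
Qed.

Lemma measurable_rV_eq dT (T : measurableType dT) (f g : T -> space) :
  measurable_fun setT f -> measurable_fun setT g ->
  measurable [set t | f t = g t].
Proof.
move=> mf mg.
rewrite (_ : [set t | _] = \bigcap_(i in [set: 'I_d]) [set t | f t ord0 i - g t ord0 i = 0]).
  apply: fin_bigcap_measurable => [|i _]; first exact: finite_finset.
  have : measurable_fun setT (fun t => f t ord0 i - g t ord0 i).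
    by apply: measurable_funB; exact: measurable_rV_fun.
  by move=> /(_ measurableT _ (measurable_set1 0)); rewrite setTI.
apply/seteqP; split=> t.
  by move=> /= fg i _ /=; rewrite (congr1 (fun v : space => v ord0 i) fg) subrr.
by move=> h /=; apply/rowP => i; apply/eqP; rewrite -subr_eq0; apply/eqP; exact: (h i Logic.I).
Qed.

(* For a general mark space [z \notin Y] need not be a measurable condition on
   (z, Y); [fresh] is a measurable condition that implies it and holds almost
   surely for a Poisson process. *)
Definition fresh : set (point * config) :=
  [set u : point * config | forall z, z \in u.2 -> z.1 <> u.1.1].

(** The condition says that the number of points with the given location is 0, and equality of
    locations is measurable. *)
Lemma measurable_fresh : measurable fresh.
Proof.
pose H : set (point * (point * config)) := [set v | v.1.1 = v.2.1.1].
have mH : measurable H.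
  apply: (@measurable_rV_eq _ _ (fun v => v.1.1) (fun v => v.2.1.1)).
    by apply: measurableT_comp measurable_fst; exact: measurable_fst.
  apply: (measurableT_comp (f := fun u : point * config => u.1.1)); last exact: measurable_snd.
  by apply: measurableT_comp measurable_fst; exact: measurable_fst.
have := @measurable_sum_indic _ point R _ (point * config)%type snd H
  (@measurable_snd _ _ _ _) mH.
move=> /(_ measurableT _ (measurable_set1 0)); rewrite setTI.
congr measurable; apply/seteqP; split=> -[z Y] /=.
  rewrite /fresh /= => /eqP; rewrite psumr_eq0// => /allP h z' z'Y z'z.
  by have /= := h _ z'Y; rewrite indicE mem_set ?oner_eq0.
by move=> h; rewrite big_seq big1// => z' z'Y; rewrite indicE memNset// => /h; apply.
Qed.

Lemma fresh_notin z Y : fresh (z, Y) -> z \notin Y.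
Proof. by move=> h; apply/negP => /h; apply. Qed.

Variable (l : R).
Hypothesis l0 : 0 < l.

Definition rescale (z : point) (X : config) : config :=
  affine_config z.1 (l `^ d%:R^-1) (affine_config (- z.1) 1 X).

Let a : R := l `^ d%:R^-1.
Let a0 : a != 0. Proof. by rewrite gt_eqF// powR_gt0. Qed.

Let shift (z z' : point) : point := (z.1 + a *: (- z.1 + 1 *: z'.1), z'.2).

Let shift_inj z : injective (shift z).
Proof.
move=> [x s] [x' s'] [/addrI /(scalerI a0) /addrI]; rewrite !scale1r.
by move=> -> ->.
Qed.

Let rescaleE z X : rescale z X = [fset shift z z' | z' in X]%fset.
Proof.
apply/fsetP => u; apply/imfsetP/imfsetP => /= -[].
  by move=> v /imfsetP[z' /= z'X ->] ->; exists z'.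
move=> z' z'X ->; exists (- z.1 + 1 *: z'.1, z'.2) => //.
by apply/imfsetP; exists z'.
Qed.

Let shift_id z : shift z z = z.
Proof. by case: z => x s; rewrite /shift /= scale1r addNr scaler0 addr0. Qed.

(** The rescaling is centred at [z], which it therefore fixes. *)
Lemma rescale_add z X : rescale z (z |` X)%fset = (z |` rescale z X)%fset.
Proof.
rewrite !rescaleE; apply/fsetP => u; rewrite in_fset1U; apply/imfsetP/orP => /=.
  move=> [z']; rewrite in_fset1U => /orP[/eqP ->|z'X] ->.
    by left; rewrite shift_id.
  by right; apply/imfsetP; exists z'.
move=> [/eqP ->|/imfsetP[z' /= z'X ->]].
  by exists z; rewrite ?shift_id// in_fset1U eqxx.
by exists z' => //; rewrite in_fset1U z'X orbT.
Qed.

Lemma measurable_rescale :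
  measurable_fun setT (fun u : point * config => rescale u.1 u.2).
Proof.
rewrite (_ : (fun _ => _) = fun u : point * config => [fset shift u.1 z' | z' in u.2]%fset); last first.
  by apply/funext => u; exact: rescaleE.
apply: (@measurable_image_config _ point R _ (point * config)%type _ point snd
  (fun v => shift v.2.1 v.1)).
- exact: measurable_snd.
- have m21 : measurable_fun setT (fun v : point * (point * config) => v.2.1.1).
    apply: (measurableT_comp (f := fun u : point * config => u.1.1)); last exact: measurable_snd.
    by apply: measurableT_comp measurable_fst; exact: measurable_fst.
  have m1 : measurable_fun setT (fun v : point * (point * config) => v.1.1).
    by apply: measurableT_comp measurable_fst; exact: measurable_fst.
  apply/measurable_fun_pairP; split; last first.
    by apply: (measurableT_comp (f := fun u : point => u.2)) measurable_fst; exact: measurable_snd.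
  apply: measurable_rV_add => //; apply: measurable_rV_scale.
  apply: measurable_rV_add; first exact: measurable_rV_opp.
  exact: measurable_rV_scale.
- by move=> u; exact: shift_inj.
Qed.

Variable xi : space -> M -> config -> {nonneg R}.

Lemma xi_scaledE z X : xi_scaled xi l z.1 z.2 X = xi z.1 z.2 (z |` rescale z X)%fset.
Proof. by rewrite /xi_scaled /xi_add -surjective_pairing. Qed.

Definition cut (r : R) (z : point) (X : config) : config :=
  restrict_config X (eball z.1 r%:E).

Lemma mem_cut r z X : 0 <= r -> z \in X -> z \in cut r z X.
Proof.
move=> r0 zX; rewrite !inE zX /=; apply/asboolP; rewrite /eball /= subrr lee_fin /enorm.
by rewrite big1 ?sqrtr0// => i _; rewrite mxE expr0n.
Qed.

Lemma cut_add r z X : 0 <= r -> cut r z (z |` X)%fset = (z |` cut r z X)%fset.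
Proof.
move=> r0; apply/fsetP => u; rewrite !inE; case: (u =P z) => //= ->.
have := mem_cut r0 (fset1U1 z X); rewrite !inE eqxx /= => ->.
by [].
Qed.

Lemma measurable_cut r : measurable_fun setT (fun u : point * config => cut r u.1 u.2).
Proof.
pose H : set (point * (point * config)) := [set v | enorm (v.1.1 - v.2.1.1) <= r].
have mH : measurable H.
  have mf : measurable_fun setT (fun v : point * (point * config) => enorm (v.1.1 - v.2.1.1)).
    apply: measurable_enorm; apply: measurable_rV_add.
      by apply: measurableT_comp measurable_fst; exact: measurable_fst.
    apply: measurable_rV_opp.
    apply: (measurableT_comp (f := fun u : point * config => u.1.1)); last exact: measurable_snd.
    by apply: measurableT_comp measurable_fst; exact: measurable_fst.
  have := mf measurableT _ (measurable_itv `]-oo, r]); rewrite setTI.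
  by congr measurable; apply/seteqP; split=> v /=; rewrite in_itv.
have := @measurable_filter_config _ point R _ (point * config)%type snd H
  (@measurable_snd _ _ _ _) mH.
congr measurable_fun; apply/funext => -[z X]; apply/fsetP => u; by rewrite !inE /=.
Qed.

Hypothesis xi_meas : measurable_functional xi.

Lemma xi_extension : exists Xi : point * config -> \bar R,
  [/\ measurable_fun setT Xi, (forall u, (0 <= Xi u)%E) &
    forall z X, z \in X -> Xi (z, X) = (xi z.1 z.2 X)%:num%:E].
Proof.
have [|G [mG G0 GE]] := trace_measurable_extension _ xi_meas.
  by move=> t.
by exists G; split => // z X zX; rewrite GE.
Qed.

(* [xs (z, Y)] is a junk value when z is not in Y. *)
Lemma xi_scaled_extension : exists xs : point * config -> R,
  [/\ measurable_fun setT xs, (forall u, 0 <= xs u) &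
    forall z X, xs (z, z |` X)%fset = (xi_scaled xi l z.1 z.2 X)%:num].
Proof.
have [Xi [mXi Xi0 XiE]] := xi_extension.
have mpair : measurable_fun setT (fun u : point * config => (u.1, rescale u.1 u.2)).
  by apply/measurable_fun_pairP; split; [exact: measurable_fst|exact: measurable_rescale].
have mXr := measurableT_comp mXi mpair.
exists (fine \o (Xi \o (fun u : point * config => (u.1, rescale u.1 u.2)))); split.
- exact: (measurableT_comp (fine_measurable measurableT) mXr).
- by move=> u; exact/fine_ge0/Xi0.
- move=> z X; rewrite [LHS]/(fine (Xi (z, rescale z (z |` X)%fset))).
  by rewrite rescale_add XiE ?xi_scaledE// fset1U1.
Qed.

End marked_space.

(** * Palm estimates for a stabilizing functional *)

Section integral_independent.
Context dO (Omega : measurableType dO) (R : realType) (P : probability Omega R).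
Context d1 d2 (T1 : measurableType d1) (T2 : measurableType d2).
Context (V : {RV P >-> T1}) (X : {RV P >-> T2}) (m : probability T1 R).

Lemma integral_independent (g : T1 * T2 -> \bar R) :
  (forall B, measurable B -> distribution P V B = m B) -> independent_RV V X ->
  measurable_fun setT g -> (forall u, (0 <= g u)%E) ->
  (\int[m]_s \int[P]_w g (s, X w) = \int[P]_w g (V w, X w))%E.
Proof.
move=> Vm VX mg g0.
have mpair : measurable_fun setT (fun w => (V w, X w)).
  by apply/measurable_fun_pairP; split; exact: measurable_funPT.
transitivity (\int[m]_s \int[distribution P X]_y g (s, y))%E.
  apply: eq_integral => s _; rewrite ge0_integral_distribution//.
  exact: (measurableT_comp mg (pair1_measurable s)).
rewrite -fubini_tonelli1// (eq_measure_integral (image_meas P mpair)); last first.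
  move=> H mH _; apply: product_measure_unique => // B1 B2 mB1 mB2.
  transitivity (distribution P V B1 * distribution P X B2)%E; first exact: VX.
  by congr (_ * _)%E; exact: Vm.
by rewrite ge0_integral_pushforward.
Qed.

End integral_independent.

Section marked_poisson.
Context (R : realType) (d : nat) (d_gt0 : (0 < d)%N).
Context dM (M : measurableType dM) (PM : probability M R).
Local Notation space := 'rV[R]_d.
Local Notation point := (space * M)%type.
Local Notation config := {fset (space * M)}.
Context (nu : {finite_measure set space -> \bar R}).
Hypothesis nu_atomless : forall x, nu [set x] = 0%E.
Context dO (Omega : measurableType dO) (P : probability Omega R).
Context (X : {RV P >-> config}) (U : {RV P >-> M}).
Local Notation mu := (finite_prod nu PM).
Hypothesis hX : poisson_process mu X.

Let mX : measurable_fun setT X. Proof. exact: measurable_funPT. Qed.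

Lemma measurable_rV_set1 (x : space) : measurable [set x].
Proof.
have := @measurable_rV_eq R d _ space id (fun=> x) (@measurable_id _ _ _) (measurable_cst x).
by congr measurable.
Qed.

Lemma poisson_null B : measurable B -> mu B = 0%E ->
  P [set w | npoints (X w) B != 0%N] = 0%E.
Proof.
move=> mB B0.
have m0 : measurable [set w | npoints (X w) B = 0%N].
  exact: (@measurable_npoints_eq _ _ _ _ X).
have -> : [set w | npoints (X w) B != 0%N] = ~` [set w | npoints (X w) B = 0%N].
  by apply/seteqP; split=> w /=; [move/eqP|move=> /eqP].
rewrite probability_setC// (hX.1 B mB 0%N) B0 /=.
have -> : poisson_prob 0 0 [set 0%N] = 1%E :> \bar R.
  by rewrite /poisson_prob ltxx diracE mem_set.
by rewrite subee.
Qed.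

Lemma finite_prod_cyl B : measurable B -> mu (B `*` setT) = nu B.
Proof.
move=> mB; rewrite [LHS](product_measure1E nu PM)//.
by rewrite -[RHS]mule1; congr (_ * _)%E; exact: probability_setT.
Qed.

Lemma poisson_fresh (z : point) : P [set w | ~ fresh (z, X w)] = 0%E.
Proof.
have mB : measurable ([set z.1] `*` [set: M]).
  by apply: measurableX => //; exact: measurable_rV_set1.
rewrite -(poisson_null mB) ?finite_prod_cyl//; last exact: measurable_rV_set1.
congr (P _); apply/seteqP; split=> w /=; last first.
  rewrite -lt0n cardfs_gt0 => /fset0Pn[z']; rewrite !inE /= => /andP[z'X /asboolP[zz _]].
  by move=> /(_ z' z'X).
move=> nf; apply/negP => /eqP/cardfs0_eq n0; apply: nf => z' z'X zz.
have : z' \in fset0 by rewrite -n0 !inE z'X; apply/asboolP.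
by rewrite inE.
Qed.

Hypothesis U_law : forall B, measurable B -> distribution P U B = PM B.
Hypothesis U_indep : independent_RV U X.

Lemma poisson_fresh_mark (x : space) : P [set w | ~ fresh ((x, U w), X w)] = 0%E.
Proof.
exact: (poisson_fresh (x, classical_sets.point)).
Qed.

(** Mecke's formula integrates over a location and a mark. As [U] has the law of a mark and is
    independent of the process, the integral over marks is absorbed into the expectation, and an
    estimate at fixed locations with mark [U] controls the sum over all points. *)
Lemma palm_bound (B : set space) (g : point * config -> \bar R) (c : R) :
  measurable B -> measurable_fun setT g -> (forall u, (0 <= g u)%E) -> 0 <= c ->
  (forall x, B x ->
    \int[P]_w g ((x, U w), add_point (@fresh R d dM M) ((x, U w), X w)) <= c%:E)%E ->
  (\int[P]_w (\sum_(z <- X w | z.1 \in B) g (z, X w))%R <= nu B * c%:E)%E.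
Proof.
move=> mB mg g0 c0 hg.
pose gB (u : point * config) : \bar R := (g u * (\1_B u.1.1)%:E)%E.
have m11 : measurable_fun setT (fun u : point * config => u.1.1).
  by apply: measurableT_comp measurable_fst; exact: measurable_fst.
have mB1 : measurable_fun [set: space] (\1_B : space -> R) by exact: measurable_indic.
have mgB : measurable_fun setT gB.
  apply: emeasurable_funM => //; apply/measurable_EFinP.
  exact: (measurableT_comp mB1 m11).
have gB0 u : (0 <= gB u)%E by rewrite /gB mule_ge0// lee_fin.
have -> : (\int[P]_w (\sum_(z <- X w | z.1 \in B) g (z, X w))%R =
   \int[P]_w (\sum_(z <- X w) gB (z, X w))%R)%E.
  apply: eq_integral => w _; rewrite big_mkcond; apply: eq_bigr => z _.
  by rewrite /gB /= indicE; case: ifP => _; rewrite ?mule1 ?mule0.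
rewrite (mecke hX (@measurable_fresh R d dM M) (@fresh_notin R d dM M) poisson_fresh mgB gB0).
have madd := measurable_add_point R (@measurable_fresh R d dM M) (@fresh_notin R d dM M).
pose h (u : point * config) : \bar R := gB (u.1, add_point (@fresh R d dM M) u).
have mh : measurable_fun setT h.
  apply: (measurableT_comp (f := gB)) => //.
  by apply/measurable_fun_pairP; split => //; exact: measurable_fst.
have h0 u : (0 <= h u)%E by exact: gB0.
pose k (v : point * Omega) : \bar R := h (v.1, X v.2).
have mk : measurable_fun setT k.
  apply: (measurableT_comp (f := h)) => //; apply/measurable_fun_pairP; split.
    exact: measurable_fst.
  by apply: (measurableT_comp mX); exact: measurable_snd.
have k0 v : (0 <= k v)%E by exact: h0.
have mF := @measurable_fun_fubini_tonelli_F _ _ _ _ R P k mk k0.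
rewrite [leLHS](_ : _ = \int[nu]_x \int[PM]_s \int[P]_w k ((x, s), w))%E; last first.
  have F0 v : (0 <= fubini_F P k v)%E by apply: integral_ge0.
  exact: (@fubini_tonelli1 _ _ _ _ R nu PM _ mF F0).
apply: (@le_trans _ _ (\int[nu]_x (c%:E * (\1_B x)%:E))%E).
  apply: ge0_le_integral_any => x; first by do 2 (apply: integral_ge0 => ? _).
  pose gx (u : M * config) : \bar R := h ((x, u.1), u.2).
  have mgx : measurable_fun setT gx.
    apply: (measurableT_comp (f := h)) => //; apply/measurable_fun_pairP; split.
      by apply: (measurableT_comp (pair1_measurable x)); exact: measurable_fst.
    exact: measurable_snd.
  have gx0 u : (0 <= gx u)%E by exact: h0.
  rewrite (integral_independent (g := gx) U_law U_indep mgx gx0) /gx /h /gB /=.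
  have [xB|xB] := boolP (x \in B); rewrite indicE ?xB ?(negbTE xB).
    under eq_integral do rewrite mule1.
    by rewrite mule1; apply: hg; move: xB; rewrite inE.
  under eq_integral do rewrite mule0.
  by rewrite integral0 mule0.
rewrite ge0_integralZl//; last by apply/measurable_EFinP; exact: measurable_indic.
by rewrite integral_indic// setIT muleC.
Qed.

(** Existence is positivity of a sum of indicators over the points. The default point in the proof
    only fills a coordinate on which nothing depends. *)
Lemma measurable_exists_point (B : set space) (H : set (point * config)) :
  measurable B -> measurable H ->
  measurable [set w | exists2 z, z \in X w & B z.1 /\ H (z, X w)].
Proof.
move=> mB mH.
pose G : set (point * (point * config)) := [set v | B v.1.1 /\ H (v.1, v.2.2)].
have mG : measurable G.
  apply: (@measurableI _ _ [set v | B v.1.1] [set v | H (v.1, v.2.2)]).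
    have m1 : measurable_fun setT (fun v : point * (point * config) => v.1.1).
      by apply: measurableT_comp measurable_fst; exact: measurable_fst.
    by have := m1 measurableT _ mB; rewrite setTI.
  have m2 : measurable_fun setT (fun v : point * (point * config) => (v.1, v.2.2)).
    apply/measurable_fun_pairP; split; first exact: measurable_fst.
    by apply: (measurableT_comp (f := snd)) measurable_snd; exact: measurable_snd.
  by have := m2 measurableT _ mH; rewrite setTI.
have mXp : measurable_fun setT (fun w => (classical_sets.point, X w) : point * config).
  by apply/measurable_fun_pairP; split => //; exact: measurable_cst.
have mS := @measurable_sum_indic _ point R _ (point * config)%type snd G
  (@measurable_snd _ _ _ _) mG.
have := measurableT_comp mS mXp.
move=> /(_ measurableT _ (measurable_itv `]0, +oo[)); rewrite setTI; congr measurable.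
apply/seteqP; split=> w /=; rewrite in_itv /= andbT.
  move=> h; apply: contrapT => nh; move: h; rewrite big_seq big1 ?ltxx// => z zX.
  by rewrite indicE memNset// => -[/= Bz Hz]; apply: nh; exists z.
move=> [z zX [Bz Hz]]; rewrite (big_fsetD1 z) //= indicE mem_set//.
by rewrite ltr_pwDl// sumr_ge0.
Qed.

(** First-moment method: the probability that some point is of the given kind is at most the
    expected number of such points. *)
Lemma palm_prob (B : set space) (H : set (point * config)) (c : R) :
  measurable B -> measurable H -> 0 <= c ->
  (forall x, B x ->
    P [set w | H ((x, U w), add_point (@fresh R d dM M) ((x, U w), X w))] <= c%:E)%E ->
  (P [set w | exists2 z, z \in X w & B z.1 /\ H (z, X w)] <= nu B * c%:E)%E.
Proof.
move=> mB mH c0 hc.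
have mE := measurable_exists_point mB mH.
have madd := measurable_add_point R (@measurable_fresh R d dM M) (@fresh_notin R d dM M).
apply: (@le_trans _ _ (\int[P]_w (\sum_(z <- X w | z.1 \in B) (\1_H (z, X w))%:E)%R)%E).
  rewrite -[X in P X]setIT -integral_indic//.
  apply: ge0_le_integral_any => [w|w]; first by rewrite lee_fin.
  rewrite indicE; case: (boolP (_ \in _)) => [|_]; last by rewrite sume_ge0// => z _; rewrite lee_fin.
  rewrite inE => -[z zX [Bz Hz]]; rewrite sumEFin lee_fin big_mkcond/= (big_fsetD1 z) //=.
  rewrite mem_set// indicE mem_set//= lerDl sumr_ge0// => z' _; by case: ifP.
apply: (palm_bound (g := fun u => (\1_H u)%:E)) => //.
  by apply/measurable_EFinP; exact: measurable_indic.
move=> x Bx; apply: le_trans (hc x Bx).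
pose h w := ((x, U w), add_point (@fresh R d dM M) ((x, U w), X w)).
have mh : measurable_fun setT h.
  have mp : measurable_fun setT (fun w => ((x, U w), X w)).
    apply/measurable_fun_pairP; split => //.
    apply/measurable_fun_pairP; split; [exact: measurable_cst|exact: measurable_funPT].
  apply/measurable_fun_pairP; split; first by apply/measurable_fun_pairP; split; [exact: measurable_cst|exact: measurable_funPT].
  exact: (measurableT_comp madd mp).
have mhH : measurable (h @^-1` H) by rewrite -[_ @^-1` _]setTI; exact: mh.
rewrite -[X in P X]setIT -(integral_indic _ _ mhH)//.
Qed.

End marked_poisson.

(** A negative upper limit lies below some [- c], also when it is -oo, and this bound holds beyond
    some [t0]; it remains to undo the logarithm. *)
Lemma exp_tail_of_limf_esup (R : realType) (S : R -> \bar R) :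
  (limf_esup (fun t : R => t^-1%:E * lne (S t)) +oo%R < 0)%E ->
  exists c t0 : R, [/\ 0 < c, 0 < t0 & forall t, t0 < t -> (0 <= S t)%E ->
    (S t <= (expR (- (c * t)))%:E)%E].
Proof.
rewrite /limf_esup => /ereal_inf_lt[_ [V [t0 [_ tV]] <-]].
set s := ereal_sup _ => s0.
have [c [c0 sc]] : exists c : R, 0 < c /\ (s <= (- c)%:E)%E.
  case: s s0 => [r| |] //; last by exists 1; rewrite leNye.
  by rewrite lte_fin => r0; exists (- r); rewrite oppr_gt0 opprK.
exists c, (Num.max t0 1); split => //; first by rewrite lt_max ltr01 orbT.
move=> t; rewrite gt_max => /andP[tt0 t1] St0.
have t0' : 0 < t by apply: lt_trans t1.
have := @ereal_sup_ubound _ [set t^-1%:E * lne (S t) | t in V]%E (t^-1%:E * lne (S t))%E.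
move=> /(_ (ex_intro2 _ _ t (tV t tt0) erefl)) /le_trans /(_ sc).
rewrite muleC lee_pdivrMr// => h.
rewrite -[S t]lneK ?in_itv/= ?St0 ?leey//.
by rewrite (_ : (expR _)%:E = expeR (- (c * t))%:E)// lee_expeR -mulNr EFinM.
Qed.

Lemma sum_expr4_le (R : realFieldType) (I : Type) (s : seq I) (F : I -> R) :
  (\sum_(i <- s) F i) ^+ 4 <= (size s)%:R ^+ 3 * \sum_(i <- s) F i ^+ 4.
Proof.
set S := \sum_(i <- s) F i; set N : R := (size s)%:R.
have [N0|N0] := eqVneq (size s) 0%N.
  by rewrite /N /S (size0nil N0) !big_nil expr0n mulr0.
have Np : 0 < N by rewrite ltr0n lt0n.
pose a := S / N.
have aN : N * a = S by rewrite /a mulrC divfK// gt_eqF.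
(* tangent line of [x ^+ 4] at the mean *)
have tan x : 4 * a ^+ 3 * x - 3 * a ^+ 4 <= x ^+ 4.
  rewrite -subr_ge0 [leRHS](_ : _ = (x - a) ^+ 2 * ((x + a) ^+ 2 + 2 * a ^+ 2)); last by ring.
  apply: mulr_ge0; first exact: sqr_ge0.
  by apply: addr_ge0; [exact: sqr_ge0|apply: mulr_ge0 => //; exact: sqr_ge0].
have sum_tan : \sum_(i <- s) (4 * a ^+ 3 * F i - 3 * a ^+ 4) = N * a ^+ 4.
  rewrite big_split /= -mulr_sumr -/S -aN sumrN big_const_seq count_predT iter_addr_0 /N.
  by rewrite -[in X in - X]mulr_natl; ring.
apply: (@le_trans _ _ (N ^+ 3 * (N * a ^+ 4))).
  by rewrite -aN (_ : _ ^+ 4 = N ^+ 3 * (N * a ^+ 4))//; ring.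
by rewrite ler_wpM2l ?exprn_ge0 ?(ltW Np)// -sum_tan ler_sum.
Qed.

(** * Estimates at an inserted point and their transfer to all points *)

Section functional_estimates.
Context (R : realType) (d : nat) (d_gt0 : (0 < d)%N).
Context dM (M : measurableType dM) (PM : probability M R).
Local Notation space := 'rV[R]_d.
Local Notation point := (space * M)%type.
Local Notation config := {fset (space * M)}.
Context (nu : {finite_measure set space -> \bar R}).
Hypothesis nu_atomless : forall x, nu [set x] = 0%E.
Context (A : set space) (mA : measurable A).
Hypothesis nu_supp : nu (~` A) = 0%E.
Context dO (Omega : measurableType dO) (P : probability Omega R).
Context (PP : R -> {RV P >-> config}) (U : {RV P >-> M}) (l : R) (l0 : 0 < l).
Local Notation X := (PP l).
Local Notation mu := (finite_prod nu PM).
Hypothesis hX : poisson_process mu X.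
Hypothesis U_law : forall B, measurable B -> distribution P U B = PM B.
Hypothesis U_indep : independent_RV U X.
Context (xi : space -> M -> config -> {nonneg R}) (xs : point * config -> R).
Hypothesis mxs : measurable_fun setT xs.
Hypothesis xs0 : forall u, 0 <= xs u.
Hypothesis xsE : forall z Y, xs (z, z |` Y)%fset = (xi_scaled xi l z.1 z.2 Y)%:num.

Let mX : measurable_fun setT X. Proof. exact: measurable_funPT. Qed.
Let mU : measurable_fun setT U. Proof. exact: measurable_funPT. Qed.

Definition inserted (x : space) (w : Omega) : point * config :=
  ((x, U w), add_point (@fresh R d dM M) ((x, U w), X w)).

Lemma measurable_marked (x : space) : measurable_fun setT (fun w => ((x, U w), X w)).
Proof.
apply/measurable_fun_pairP; split => //.
by apply/measurable_fun_pairP; split => //; exact: measurable_cst.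
Qed.

Lemma measurable_inserted (x : space) : measurable_fun setT (inserted x).
Proof.
apply/measurable_fun_pairP; split.
  by apply/measurable_fun_pairP; split => //; exact: measurable_cst.
have madd := measurable_add_point R (@measurable_fresh R d dM M) (@fresh_notin R d dM M).
exact: (measurableT_comp madd (measurable_marked x)).
Qed.

Lemma xs_inserted x w : fresh ((x, U w), X w) ->
  xs (inserted x w) = (xi_scaled xi l x (U w) (X w))%:num.
Proof. by move=> h; rewrite /inserted /add_point mem_set// xsE. Qed.

Lemma xs_mem z Y : z \in Y -> xs (z, Y) = (xi_scaled xi l z.1 z.2 Y)%:num.
Proof.
move=> zY; rewrite -[in LHS](_ : (z |` Y)%fset = Y) ?xsE//.
by apply/fsetP => u; rewrite in_fset1U; case: eqP => // ->.
Qed.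

Lemma poisson_in_support : P [set w | ~ (forall z, z \in X w -> A z.1)] = 0%E.
Proof.
have mB : measurable (~` A `*` [set: M]) by apply: measurableX => //; exact: measurableC.
rewrite -(poisson_null hX mB) ?finite_prod_cyl//; last exact: measurableC.
congr (P _); apply/seteqP; split=> w /=; last first.
  rewrite -lt0n cardfs_gt0 => /fset0Pn[z']; rewrite !inE /= => /andP[z'X /asboolP[zz _]].
  by move=> /(_ z' z'X).
move=> nf; apply/negP => /eqP/cardfs0_eq n0; apply: nf => z' z'X.
apply: contrapT => nA.
have : z' \in fset0 by rewrite -n0 !inE z'X; apply/asboolP.
by rewrite inE.
Qed.

Lemma measurable_in_support : measurable [set w | ~ (forall z, z \in X w -> A z.1)].
Proof.
rewrite (_ : [set w | _] = [set w | exists2 z, z \in X w & (~` A) z.1 /\ setT (z, X w)]).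
  by apply: measurable_exists_point => //; exact: measurableC.
apply/seteqP; split=> w /=; last by move=> [z zX [h _]] /(_ z zX).
by move=> /existsNP[z /not_implyP[zX nA]]; exists z.
Qed.

(** The stabilization identity is used twice, with the points outside the random ball in the whole
    configuration and with those in the cut one: both scores equal the score inside the random
    ball. *)
Lemma stabilization_cut x rad (t : R) w :
  stabilization_radius xi PP U A l x rad -> (rad w <= t%:E)%E ->
  (forall z, z \in X w -> A z.1) ->
  xi_scaled xi l x (U w) (X w) =
  xi_scaled xi l x (U w) (cut (l `^ (- d%:R^-1) * t) (x, U w) (X w)).
Proof.
move=> [_ _ hs] rt XA; have := hs w; set B := eball _ _ => hB.
have BB : B `<=` eball x (l `^ (- d%:R^-1) * t)%:E.
  move=> y; rewrite /B /eball /= => h; apply: le_trans h _.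
  by rewrite EFinM; apply: lee_wpmul2l => //; rewrite lee_fin powR_ge0.
pose Y (Z : config) : config := [fset z in Z | z.1 \notin B]%fset.
transitivity (xi_scaled xi l x (U w) (restrict_config (X w) B)).
  rewrite -(hB (Y (X w))).
    congr (xi_scaled _ _ _ _ _); apply/fsetP => z; rewrite !inE.
    by rewrite -andb_orr orbN andbT.
  by move=> z; rewrite !inE /= => /andP[/XA zA]; move=> /asboolPn.
rewrite -(hB (Y (cut (l `^ (- d%:R^-1) * t) (x, U w) (X w)))).
  congr (xi_scaled _ _ _ _ _); apply/fsetP => z; rewrite !inE /=.
  case: (z \in X w) => //=.
  case: (boolP (z.1 \in B)) => [zB|_]; last by rewrite /= andbT.
  by rewrite /=; apply/esym/mem_set/BB; exact: set_mem zB.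
by move=> z; rewrite !inE /= => /andP[/andP[/XA zA _]]; move=> /asboolPn.
Qed.

(** Stated through scores alone: the radii of stabilization are given separately for each location,
    without joint measurability in the location, so an event about the radii of all points might
    fail to be measurable. *)
Definition bad (r L : R) : set (point * config) :=
  [set u | xs u <> xs (u.1, cut r u.1 u.2) \/ L < xs u].

Lemma measurable_xs_cut r : measurable_fun setT (fun u => xs (u.1, cut r u.1 u.2)).
Proof.
apply: (measurableT_comp mxs); apply/measurable_fun_pairP; split.
  exact: measurable_fst.
exact: measurable_cut.
Qed.

Lemma measurable_bad r L : measurable (bad r L).
Proof.
apply: (@measurableU _ _ [set u | xs u <> xs (u.1, cut r u.1 u.2)] [set u | L < xs u]).
  have mf := measurable_funB mxs (measurable_xs_cut r).
  have := mf measurableT _ (measurableC (measurable_set1 0)); rewrite setTI.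
  congr measurable; apply/seteqP; split=> u /= h h'; apply: h.
    by rewrite h' subrr.
  by apply/eqP; rewrite -subr_eq0; apply/eqP.
have := mxs measurableT (measurable_itv `]L, +oo[); rewrite setTI.
by congr measurable; apply/seteqP; split=> w /=; rewrite in_itv/= andbT.
Qed.

Lemma bad_inserted x rad (t L : R) n (e1 Mn : R) : 0 <= t -> 0 < L ->
  stabilization_radius xi PP U A l x rad ->
  (P [set w | t%:E < rad w] <= e1%:E)%E ->
  (\int[P]_w (xs (inserted x w) ^+ n)%:E <= Mn%:E)%E ->
  (P [set w | bad (l `^ (- d%:R^-1) * t) L (inserted x w)] <= (e1 + Mn / L ^+ n)%:E)%E.
Proof.
move=> t0 L0 hs he hm; set r := l `^ _ * t.
have r0 : 0 <= r by rewrite mulr_ge0// powR_ge0.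
have mi := measurable_inserted x.
pose E1 := [set w | ~ fresh ((x, U w), X w)].
pose E2 := [set w | ~ (forall z, z \in X w -> A z.1)].
pose E3 := [set w | t%:E < rad w]%E.
pose E4 := [set w | L < xs (inserted x w)].
have mE1 : measurable E1.
  have := measurable_marked x measurableT (measurableC (@measurable_fresh R d dM M)).
  by rewrite setTI.
have mE2 : measurable E2 by exact: measurable_in_support.
have mE3 : measurable E3.
  have mr : measurable_fun setT rad by exact: measurable_funPT.
  have := mr measurableT _ (emeasurable_itv `]t%:E, +oo[); rewrite setTI.
  by congr measurable; apply/seteqP; split=> w /=; rewrite in_itv/= andbT.
have mE4 : measurable E4.
  have := measurableT_comp mxs mi measurableT (measurable_itv `]L, +oo[); rewrite setTI.
  by congr measurable; apply/seteqP; split=> w /=; rewrite in_itv/= andbT.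
have P4 : (P E4 <= (Mn / L ^+ n)%:E)%E.
  rewrite -[P E4]fineK ?fin_num_measure// lee_fin ler_pdivlMr ?exprn_gt0//.
  rewrite -lee_fin EFinM fineK ?fin_num_measure//; apply: le_trans hm.
  rewrite muleC -[X in P X]setIT -integral_indic// -ge0_integralZl//; last 2 first.
  - by apply/measurable_EFinP; exact: measurable_indic.
  - by rewrite lee_fin exprn_ge0// ltW.
  apply: ge0_le_integral_any => w; first by rewrite mule_ge0// lee_fin exprn_ge0// ltW.
  rewrite -EFinM lee_fin indicE; case: (boolP (_ \in _)); rewrite ?mulr0 ?exprn_ge0//.
  rewrite inE /E4 /= mulr1 => /ltW h; apply: lerXn2r => //; rewrite ?nnegrE//.
  exact: ltW.
have sub : [set w | bad r L (inserted x w)] `<=` (E1 `|` E2) `|` (E3 `|` E4).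
  move=> w; rewrite /bad /= => -[h|h]; last by right; right.
  have [f1|] := pselect (fresh ((x, U w), X w)); last by left; left.
  have [f2|] := pselect (forall z, z \in X w -> A z.1); last by left; right.
  right; left; rewrite /E3 /= ltNge; apply/negP => f3; apply: h.
  rewrite xs_inserted// (stabilization_cut hs f3 f2).
  rewrite /inserted /add_point mem_set// (cut_add _ _ r0).
  by rewrite xsE.
have mS : measurable [set w | bad r L (inserted x w)].
  by have := mi measurableT _ (measurable_bad r L); rewrite setTI.
apply: (@le_trans _ _ (P ((E1 `|` E2) `|` (E3 `|` E4)))).
  by apply: le_measure; rewrite ?inE//; do ?apply: measurableU.
apply: le_trans (measureU2 _ _ _) _; [exact: measurableU|exact: measurableU|].
rewrite EFinD -[leRHS]add0e; apply: leeD.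
  apply: le_trans (measureU2 _ _ _) _ => //.
  rewrite -[leRHS]add0e; apply: leeD.
    by rewrite [leLHS](poisson_fresh_mark nu_atomless U hX x).
  by rewrite [leLHS]poisson_in_support.
by apply: le_trans (measureU2 _ _ _) _ => //; apply: leeD.
Qed.

(** The integrands agree where insertion is effective, which has probability 1. On the right no
    measurability is at hand, so the left one is first cut down to that event and then compared
    pointwise. *)
Lemma inserted_moment x n :
  (\int[P]_w (xs (inserted x w) ^+ n)%:E <=
   \int[P]_w ((xi_scaled xi l x (U w) (X w))%:num ^+ n)%:E)%E.
Proof.
pose h w : \bar R := (xs (inserted x w) ^+ n)%:E.
have mh : measurable_fun setT h.
  apply/measurable_EFinP; apply: measurable_funX.
  exact: (measurableT_comp mxs (measurable_inserted x)).
pose F := [set w | fresh ((x, U w), X w)].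
have mF : measurable F.
  by have := measurable_marked x measurableT (@measurable_fresh R d dM M); rewrite setTI.
have mh' : measurable_fun setT (h \_ F).
  apply/(measurable_restrictT h mF); exact: measurable_funTS.
rewrite (_ : (\int[P]_w h w)%E = (\int[P]_w (h \_ F) w)%E); last first.
  apply: ge0_ae_eq_integral => //.
  - by move=> w _; rewrite lee_fin exprn_ge0.
  - by move=> w _; rewrite /patch; case: ifP => // _; rewrite lee_fin exprn_ge0.
  exists (~` F); split; first exact: measurableC.
    exact: (poisson_fresh_mark nu_atomless U hX x).
  move=> w /= hw fw; apply: hw => _; by rewrite /patch mem_set.
apply: ge0_le_integral_any => w; rewrite /patch; case: ifPn => [|_]; rewrite ?lee_fin ?exprn_ge0//.
by move=> fw; rewrite xs_inserted//; exact: set_mem fw.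
Qed.

Lemma bad_prob (t L : R) n (e1 Mn : R) : 0 <= t -> 0 < L -> 0 <= e1 -> 0 <= Mn ->
  (forall x, A x -> exists2 rad, stabilization_radius xi PP U A l x rad &
     (P [set w | t%:E < rad w] <= e1%:E)%E) ->
  (forall x, A x -> (\int[P]_w (xs (inserted x w) ^+ n)%:E <= Mn%:E)%E) ->
  (P [set w | exists2 z, z \in X w &
      A z.1 /\ bad (l `^ (- d%:R^-1) * t) L (z, X w)] <=
   nu A * (e1 + Mn / L ^+ n)%:E)%E.
Proof.
move=> t0 L0 e0 M0 hs hm; apply: (palm_prob nu_atomless hX U_law U_indep) => //.
- exact: measurable_bad.
- by rewrite addr_ge0// divr_ge0// exprn_ge0// ltW.
- by move=> x Ax; have [rad h1 h2] := hs x Ax; apply: (bad_inserted t0 L0 h1 h2); exact: hm.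
Qed.

(** With N points and scores y, the fourth power of the sum is at most N^3 times the sum of the y^4,
    and N^3 y^4 is at most N^6 + y^8; this separates scores from counts before Mecke's formula is
    applied. The factor 64 = 2^6 accounts for the inserted point in N. *)
Lemma total_moment4 (M8 a : R) : a = fine (nu setT) -> 0 <= M8 ->
  (forall x, A x -> (\int[P]_w (xs (inserted x w) ^+ 8)%:E <= M8%:E)%E) ->
  (\int[P]_w ((\sum_(z <- X w | z.1 \in A) xs (z, X w)) ^+ 4)%:E <=
   (a * (64 * (pois_moment_cst R 6 * (1 + a) ^+ 6 + 1) + M8))%:E)%E.
Proof.
move=> aE M0 hm.
have mNT : measurable_fun setT (fun u : point * config => (npoints u.2 setT)%:R : R).
  by apply: (@measurable_npoints _ point R _ _ snd) => //; exact: measurable_snd.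
pose g (u : point * config) : \bar R := ((npoints u.2 setT)%:R ^+ 6 + xs u ^+ 8)%:E.
have mg : measurable_fun setT g.
  by apply/measurable_EFinP; apply: measurable_funD; exact: measurable_funX.
have g0 u : (0 <= g u)%E by rewrite lee_fin addr_ge0// exprn_ge0.
apply: (@le_trans _ _ (\int[P]_w (\sum_(z <- X w | z.1 \in A) g (z, X w))%R)%E).
  apply: ge0_le_integral_any => w; first by rewrite lee_fin exprn_ge0// sumr_ge0.
  rewrite big_mkcond /= sumEFin lee_fin; apply: le_trans (sum_expr4_le _ _) _.
  have -> : size (X w) = npoints (X w) setT.
    rewrite /npoints; congr size; congr (enum_fset _).
    by apply/fsetP => z; rewrite !inE in_setT andbT.
  rewrite mulr_sumr [leRHS]big_mkcond/=; apply: ler_sum => z _.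
  case: ifP => _; last by rewrite expr0n mulr0.
  set N : R := _%:R; set y := xs _.
  have := sqr_ge0 (N ^+ 3 - y ^+ 4); rewrite sqrrB -!exprM => h.
  have : 0 <= N ^+ 3 * y ^+ 4 by rewrite mulr_ge0// exprn_ge0// /y.
  by move: h; rewrite mulr2n /=; lra.
pose c := 64 * (pois_moment_cst R 6 * (1 + a) ^+ 6 + 1) + M8.
have a0 : 0 <= a by rewrite aE; exact: fine_ge0.
have C0 := pois_moment_cst_ge0 R 6.
have c0 : 0 <= c by rewrite /c; have := mulr_ge0 C0 (exprn_ge0 6 (addr_ge0 ler01 a0)); move: M0; lra.
apply: (@le_trans _ _ (nu A * c%:E)%E); last first.
  rewrite EFinM; apply: lee_wpmul2r; first by rewrite lee_fin.
  by rewrite aE fineK ?fin_num_measure//; apply: le_measure; rewrite ?inE.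
apply: (palm_bound nu_atomless hX U_law U_indep) => // x Ax.
have mi := measurable_inserted x.
rewrite /g -/(inserted x _).
have mN : measurable_fun setT (fun w => (npoints (X w) setT)%:R : R).
  exact: measurable_npoints.
have mx8 : measurable_fun setT (fun w => (xs (inserted x w) ^+ 8)%:E).
  by apply/measurable_EFinP; apply: measurable_funX; exact: (measurableT_comp mxs mi).
apply: (@le_trans _ _ (\int[P]_w (64%:E * ((npoints (X w) setT)%:R ^+ 6 + 1)%:E +
    (xs (inserted x w) ^+ 8)%:E))%E).
  apply: ge0_le_integral_any => w; first exact: g0.
  rewrite -EFinM -EFinD lee_fin lerD// /inserted /=.
  set n := npoints (X w) setT.
  have : ((npoints (add_point (@fresh R d dM M) ((x, U w), X w)) setT)%:R : R) <= n.+1%:R.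
    by rewrite ler_nat; exact: (npoints_add_point R (@fresh_notin R d dM M)).
  move=> h; apply: (@le_trans _ _ (n.+1%:R ^+ 6)); first by apply: lerXn2r; rewrite ?nnegrE.
  case: n {h} => [|n].
    by rewrite expr1n expr0n /=; lra.
  apply: (@le_trans _ _ ((2 * n.+1%:R) ^+ 6)).
    by apply: lerXn2r; rewrite ?nnegrE// -natrM ler_nat; lia.
  by rewrite exprMn (_ : 2 ^+ 6 = 64) ?ler_pM2l ?lerDl//; ring.
rewrite ge0_integralD//; first last.
- by move=> w _; rewrite lee_fin exprn_ge0.
- apply/measurable_EFinP; apply: measurable_funM => //.
  by apply: measurable_funD => //; exact: measurable_funX.
rewrite ge0_integralZl//; last first.
  by apply/measurable_EFinP; apply: measurable_funD => //; exact: measurable_funX.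
rewrite /c [leRHS]EFinD; apply: leeD; last exact: hm.
rewrite [leRHS]EFinM; apply: lee_wpmul2l => //.
under eq_integral do rewrite EFinD.
rewrite ge0_integralD//; last by apply/measurable_EFinP; exact: measurable_funX.
rewrite [leRHS]EFinD; apply: leeD; last by apply: ge0_integral_le_cst.
have := @poisson_moment _ _ _ P _ _ mu X hX _ (@measurable_fresh R d dM M) (@fresh_notin R d dM M) (poisson_fresh nu_atomless hX) setT 6 measurableT.
by rewrite -[setT in fine (mu setT)]setXTT finite_prod_cyl// -aE.
Qed.

End functional_estimates.

(** * Grid cells and boundary cells *)

Section sup_norm.
Context (R : realType) (d : nat).
Implicit Types v w : 'rV[R]_d.

Lemma coord_le_norm v i : `|v ord0 i| <= `|v|.
Proof.
rewrite [leRHS]/Num.norm/= mx_normrE.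
exact: (le_bigmax _ (fun k : 'I_1 * 'I_d => `|v k.1 k.2|) (ord0, i)).
Qed.

Lemma norm_le_coord v (r : R) : 0 <= r -> (forall i, `|v ord0 i| <= r) -> `|v| <= r.
Proof.
move=> r0 h; rewrite [leLHS]/Num.norm/= mx_normrE; apply: bigmax_le => // -[j i] _.
by rewrite ord1.
Qed.

Lemma coord_le_enorm v i : `|v ord0 i| <= enorm v.
Proof.
rewrite /enorm -sqrtr_sqr ler_sqrt; last by apply: sumr_ge0 => j _; exact: sqr_ge0.
by rewrite (bigD1 i)//= lerDl sumr_ge0// => j _; exact: sqr_ge0.
Qed.

Lemma measurable_boundary_nbhd (G : set 'rV[R]_d) (r : R) :
  measurable (boundary_nbhd r G).
Proof.
rewrite -[boundary_nbhd r G]setCK; apply: measurableC; apply: open_measurable_rV.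
rewrite openE => x /=; rewrite /boundary_nbhd /= => /negP; rewrite -ltNge => h.
have [r' rr' hr'] : exists2 r' : R, r < r' &
    (r'%:E <= ereal_inf [set `|x - y|%:E | y in boundary G])%E.
  move: h; case: (ereal_inf _) => [a| |] //; last by exists (r + 1); rewrite ?ltrDl ?leey.
  by rewrite lte_fin => ra; exists a.
apply/nbhs_ballP; exists ((r' - r) / 2) => /=; first by rewrite divr_gt0// subr_gt0.
move=> x'; rewrite -ball_normE /= => xx'; apply/negP; rewrite -ltNge.
apply: (@lt_le_trans _ _ ((r' + r) / 2)%:E); first by rewrite lte_fin; move: rr'; lra.
apply: le_ereal_inf_tmp => _ [y Gy <-].
have : (r'%:E <= `|x - y|%:E)%E.
  by apply: le_trans hr' _; apply: ereal_inf_lbound; exists y.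
rewrite !lee_fin => h1; have := ler_distD x' x y; move: xx'.
by lra.
Qed.

(** If the segment missed the boundary, the closure and the interior of [G] would have the same
    trace on it; this trace would be open and closed in a connected set and contain [p], hence
    [q]. *)
Lemma segment_boundary (G : set 'rV[R]_d) p q : G p -> ~ G q ->
  exists2 t : R, 0 <= t <= 1 & boundary G (p + t *: (q - p)).
Proof.
move=> Gp Gq; apply: contrapT => nb.
pose f (t : R) := p + t *: (q - p).
have cf : {within `[0, 1], continuous f}.
  apply: continuous_subspaceT => t; apply: cvgD; first exact: cvg_cst.
  by apply: cvgZ; [exact: cvg_id|exact: cvg_cst].
have con := connected_continuous_connected (@segment_connected R 0 1) cf.
have f0 : f 0 = p by rewrite /f scale0r addr0.
have f1 : f 1 = q by rewrite /f scale1r addrC subrK.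
have key t : 0 <= t <= 1 -> closure G (f t) -> interior G (f t).
  by move=> t01 cl; apply: contrapT => ni; apply: nb; exists t.
have im0 : (f @` `[0, 1]) p by exists 0; rewrite //= in_itv /= lexx ler01.
have im1 : (f @` `[0, 1]) q by exists 1; rewrite //= in_itv /= lexx ler01.
have E : f @` `[0, 1] `&` interior G = f @` `[0, 1].
  apply: con.
  - exists p; split => //; rewrite -f0; apply: key; rewrite ?lexx ?ler01//.
    by rewrite f0; exact: subset_closure.
  - by exists (interior G) => //; exact: open_interior.
  - exists (closure G); first exact: closed_closure.
    apply/seteqP; split=> x [xi xG]; split => //.
      by apply: subset_closure; exact: interior_subset.
    by case: xi xG => t /=; rewrite in_itv /= => t01 <-; exact: key.
have : (f @` `[0, 1] `&` interior G) q by rewrite E.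
by move=> [_ /interior_subset].
Qed.

End sup_norm.

Lemma card_ord_dist n (i : 'I_n) (k : nat) :
  (#|[pred j : 'I_n | (j <= i + k) && (i <= j + k)]| <= k.*2.+1)%N.
Proof.
rewrite -sum1_card.
pose f (j : 'I_n) : 'I_(k.*2.+1) := inord (j + k - i).
rewrite sum1_card -(card_in_imset (f := f)); first by rewrite -[leqRHS]card_ord max_card.
move=> j j'; rewrite !inE => /andP[j1 j2] /andP[j1' j2'] /(congr1 val).
by rewrite /= !inordK; [move=> h; apply: val_inj => /=; lia|lia|lia].
Qed.

Section grid.
Context (R : realType) (d : nat) (b s : R).
Hypotheses (b_gt0 : 0 < b) (s_gt0 : 0 < s).

(** The number of steps of length [s] that lead from [- b] beyond [b]. *)
Definition grid_size : nat := (Num.truncn (2 * b / s)).+1.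
Local Notation n := grid_size.
Local Notation idx := {ffun 'I_d -> 'I_n}.
Implicit Types (c : idx) (v : 'rV[R]_d) (G : set 'rV[R]_d).

Definition cell c : set 'rV[R]_d :=
  [set v | forall i, - b + (c i)%:R * s < v ord0 i <= - b + (c i).+1%:R * s].

Lemma measurable_cell c : measurable (cell c).
Proof.
rewrite (_ : cell c = \bigcap_(i in [set: 'I_d]) [set v : 'rV[R]_d |
   - b + (c i)%:R * s < v ord0 i <= - b + (c i).+1%:R * s]); last first.
  by apply/seteqP; split=> v /= => [bv i _|bv i]; [exact: bv|exact: (bv i Logic.I)].
apply: fin_bigcap_measurable => [|i _]; first exact: finite_finset.
have := @measurable_coord_rV R d i measurableT _
  (measurable_itv `](- b + (c i)%:R * s), (- b + (c i).+1%:R * s)]).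
by rewrite setTI; congr measurable.
Qed.

Lemma lebesgue_cell c : lebesgue_rV R d (cell c) = (s ^+ d)%:E.
Proof.
pose lo : 'rV[R]_d := \row_i (- b + (c i)%:R * s).
pose hi : 'rV[R]_d := \row_i (- b + (c i).+1%:R * s).
have -> : cell c = [set v : 'rV[R]_d | forall i, lo ord0 i < v ord0 i <= hi ord0 i].
  by apply/seteqP; split=> v /= h i; have := h i; rewrite !mxE.
rewrite lebesgue_rV_box; last by move=> i; rewrite !mxE lerD2l ler_pM2r// ler_nat.
rewrite (eq_bigr (fun=> s)) ?prodr_const ?card_ord// => i _.
by rewrite !mxE -natr1; ring.
Qed.

Lemma cell_coord_lt c c' v v' i (k : nat) : cell c v -> cell c' v' ->
  v' ord0 i - v ord0 i <= k%:R * s -> (c' i <= c i + k)%N.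
Proof.
move=> /(_ i)/andP[_ h1] /(_ i)/andP[h2 _] h.
rewrite -ltnS -(ltr_nat R) -(ltr_pM2r s_gt0) -addSn natrD mulrDl; lra.
Qed.

Lemma cell_inj c c' v : cell c v -> cell c' v -> c = c'.
Proof.
move=> h h'; apply/ffunP => i; apply/val_inj/eqP; rewrite eqn_leq /=.
have e : v ord0 i - v ord0 i <= 0%:R * s by rewrite subrr mul0r.
have := cell_coord_lt h h' e; have := cell_coord_lt h' h e.
by rewrite !addn0 => -> ->.
Qed.

Lemma cell_nonempty c : cell c !=set0.
Proof.
exists (\row_i (- b + (c i).+1%:R * s)) => i; rewrite mxE lexx andbT ltrD2l.
by rewrite ltr_pM2r// ltr_nat.
Qed.

Lemma cell_cover v : (forall i, `|v ord0 i| < b) -> exists c, cell c v.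
Proof.
move=> vb; pose k i := (v ord0 i + b) / s.
have k0 i : 0 < k i.
  by rewrite divr_gt0//; have := vb i; rewrite ltr_norml => /andP[]; lra.
have kn i : k i < n%:R.
  have : 2 * b / s < n%:R by rewrite /grid_size truncnS_gt.
  apply: lt_trans; rewrite ltr_pM2r ?invr_gt0//.
  by have := vb i; rewrite ltr_norml => /andP[]; lra.
have /choice[c hc] i : exists j : 'I_n, (j%:R < k i <= j.+1%:R)%R.
  pose m := (ex_minn (ex_intro (fun j => k i <= j.+1%:R) (grid_size.-1) (ltW (kn i)))).
  have [m1 m2] : k i <= m.+1%:R /\ forall j, k i <= j.+1%:R -> (m <= j)%N.
    by rewrite /m; case: ex_minnP.
  have mn : (m < n)%N by rewrite ltnS; apply: m2; exact: ltW.
  exists (Ordinal mn); rewrite /= m1 andbT.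
  case: m m1 m2 {mn} => [|m] _ m2; first exact: k0.
  by rewrite ltNge; apply/negP => /m2; rewrite ltnn.
exists [ffun i => c i] => i; rewrite ffunE.
have /andP[] := hc i; rewrite /k ltr_pdivlMr// ler_pdivrMr// => h1 h2.
by apply/andP; split; lra.
Qed.

Definition cells_within (k : nat) c : {set idx} :=
  [set c' : idx | [forall i, ((c' i <= c i + k) && (c i <= c' i + k))%N]]%SET.

Lemma cells_withinP k c c' : reflect (forall i, (c' i <= c i + k)%N /\ (c i <= c' i + k)%N)
  (c' \in cells_within k c).
Proof. by rewrite inE; apply: (iffP forallP) => h i; apply/andP; exact: h. Qed.

Lemma card_cells_within k c : (#|cells_within k c| <= k.*2.+1 ^ d)%N.
Proof.
pose F (i : 'I_d) := [pred j : 'I_n | (j <= c i + k) && (c i <= j + k)]%N.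
apply: (@leq_trans #|(family F : simpl_pred {ffun 'I_d -> 'I_n})|).
  apply: subset_leq_card; apply/fintype.subsetP => c' /cells_withinP h.
  by apply/familyP => i; rewrite inE; apply/andP; exact: h.
rewrite card_family foldrE big_map big_enum/=.
rewrite -[in leqRHS](card_ord d) -prod_nat_const.
by apply: leq_prod => i _; exact: card_ord_dist.
Qed.

Lemma cells_within_refl k c : c \in cells_within k c.
Proof. by apply/cells_withinP => i; rewrite leq_addr. Qed.

Lemma cells_within_sym k c c' : (c' \in cells_within k c) = (c \in cells_within k c').
Proof. by apply/cells_withinP/cells_withinP => h i; have [] := h i. Qed.

Lemma cells_within_trans j k c1 c2 c3 : c2 \in cells_within j c1 ->
  c3 \in cells_within k c2 -> c3 \in cells_within (j + k) c1.
Proof.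
move=> /cells_withinP h1 /cells_withinP h2; apply/cells_withinP => i.
by clear b_gt0 s_gt0; have := h1 i; have := h2 i; lia.
Qed.

Lemma ball_cells_within c c' z y : cell c z -> cell c' y -> eball z s%:E y ->
  c' \in cells_within 1 c.
Proof.
move=> cz cy; rewrite /eball /= lee_fin => zy.
have h i : `|y ord0 i - z ord0 i| <= s.
  by apply: le_trans zy; have := coord_le_enorm (y - z) i; rewrite !mxE.
apply/cells_withinP => i; split.
  by apply: (cell_coord_lt cz cy); rewrite mul1r; apply: le_trans (h i); exact: ler_norm.
apply: (cell_coord_lt cy cz); rewrite mul1r; apply: le_trans (h i).
by rewrite distrC ler_norm.
Qed.

Lemma cell_dist c c' z y (k : nat) : c' \in cells_within k c -> cell c z -> cell c' y ->
  `|y - z| <= k.+1%:R * s.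
Proof.
move=> /cells_withinP h cz cy; apply: norm_le_coord; first by rewrite mulr_ge0// ltW.
move=> i; rewrite !mxE ler_norml; have [h1 h2] := h i.
have /andP[z1 z2] := cz i; have /andP[y1 y2] := cy i.
have : (c' i)%:R * s <= (c i)%:R * s + k%:R * s.
  by rewrite -mulrDl -natrD ler_pM2r// ler_nat.
have : (c i)%:R * s <= (c' i)%:R * s + k%:R * s.
  by rewrite -mulrDl -natrD ler_pM2r// ler_nat.
move: z1 z2 y1 y2; rewrite -!natr1 !mulrDl !mul1r => *; apply/andP; split; lra.
Qed.

Definition interior_cells G : {set idx} :=
  [set c : idx | `[< forall c', c' \in cells_within 1 c -> cell c' `<=` G >]]%SET.

Definition boundary_cells G : {set idx} :=
  ([set c : idx | `[< (cell c `&` G !=set0)%classic >]] :\: interior_cells G)%SET.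

(** Such a cell has a point p in [G], and a neighbouring cell or the cell itself has a point outside
    [G] at distance at most 2s from p. The segment between them meets the boundary, and every point
    of the cell is within s of p: hence 3s. *)
Lemma boundary_cells_sub G c : c \in boundary_cells G ->
  cell c `<=` boundary_nbhd (3 * s) G.
Proof.
rewrite !inE => /andP[/asboolPn nint /asboolP[p [cp Gp]]] v cv.
have [c' [c'c [q [c'q nGq]]]] : exists c', c' \in cells_within 1 c /\
    exists q, cell c' q /\ ~ G q.
  apply: contrapT => h; apply: nint => c' c'c q c'q; apply: contrapT => nGq; apply: h.
  by exists c'; split => //; exists q.
have [t /andP[t0 t1] bt] := segment_boundary Gp nGq.
rewrite /boundary_nbhd /=; apply: ge_ereal_inf.
exists `|v - (p + t *: (q - p))|%:E; first by eexists; [exact: bt|].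
have h1 : `|v - p| <= s.
  by have := cell_dist (cells_within_refl 0 c) cp cv; rewrite mul1r.
have h2 : `|q - p| <= 2 * s by exact: cell_dist c'c cp c'q.
rewrite lee_fin opprD addrA; apply: le_trans (ler_normB _ _) _.
have : `|t *: (q - p)| <= 2 * s.
  rewrite normrZ ger0_norm//; apply: le_trans h2.
  by rewrite ler_piMl.
lra.
Qed.

Lemma card_boundary_cells G (r : R) :
  (lebesgue_rV R d (boundary_nbhd (3 * s) G) <= r%:E)%E ->
  #|boundary_cells G|%:R * s ^+ d <= r.
Proof.
move=> hr; rewrite -lee_fin; apply: le_trans hr.
have mb := measurable_boundary_nbhd G (3 * s).
rewrite -[X in lebesgue_rV R d X]setIT -integral_indic//.
apply: (@le_trans _ _ (\int[lebesgue_rV R d]_v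
   (\sum_(c <- enum (boundary_cells G)) (\1_(cell c) v)%:E)%R)%E).
  rewrite ge0_integral_sum//; last first.
    by move=> c; apply/measurable_EFinP; apply: measurable_indic; exact: measurable_cell.
  rewrite (eq_bigr (fun=> (s ^+ d)%:E)); last first.
    move=> c _; rewrite integral_indic//; last exact: measurable_cell.
    by rewrite -(lebesgue_cell c); congr (lebesgue_rV R d _); rewrite setIT.
  by rewrite big_enum /= sumEFin sumr_const mulr_natl.
apply: ge0_le_integral_any => v; first by apply: sume_ge0 => c _; rewrite lee_fin.
rewrite big_enum /= sumEFin lee_fin.
have [[c cb cv]|nc] := pselect (exists2 c, c \in boundary_cells G & cell c v).
  rewrite (bigD1 c)//= big1.
    by rewrite addr0 !indicE mem_set// mem_set//; apply: (boundary_cells_sub cb).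
  move=> c' /andP[_ c'c]; rewrite indicE memNset// => c'v.
  by move/eqP: c'c; apply; exact: cell_inj c'v cv.
rewrite big1// => c cb; rewrite indicE memNset// => cv.
by apply: nc; exists c.
Qed.

Lemma card_cells : s <= 1 -> #|{: idx}|%:R * s ^+ d <= (2 * b + 1) ^+ d.
Proof.
move=> s1; rewrite card_ffun !card_ord natrX -exprMn.
apply: lerXn2r; rewrite ?nnegrE.
- by rewrite mulr_ge0// ltW.
- by rewrite addr_ge0// mulr_ge0// ltW.
rewrite /grid_size -natr1 mulrDl mul1r lerD//.
have h : (Num.truncn (2 * b / s))%:R <= 2 * b / s.
  by rewrite truncn_le divr_ge0 ?mulr_ge0// ltW.
by apply: le_trans (ler_wpM2r (ltW s_gt0) h) _; rewrite divfK// gt_eqF.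
Qed.

End grid.

(** * Local dependence of the Poisson process on the grid *)

Section independent_products.
Context d (Omega : measurableType d) (R : realType) (P : probability Omega R).
Context (V : finType) (dep : {set V} -> (Omega -> R) -> Prop).
Hypothesis hdep : independent_system P dep.

Lemma Ex_prod_indep (I : eqType) (r : seq I) (U : I -> {set V}) (g : I -> Omega -> R) :
  uniq r -> (forall i, dep (U i) (g i)) ->
  (forall i j, i != j -> disjoint (mem (U i)) (mem (U j))) ->
  dep (\bigcup_(i <- r) U i)%SET (fun w => \prod_(i <- r) g i w) /\
  Ex P (fun w => \prod_(i <- r) g i w) = \prod_(i <- r) Ex P (g i).
Proof.
move=> + hg dU; elim: r => [_|i r IH /= /andP[ir /IH[IH1 IH2]]].
  rewrite (_ : (fun w => _) = fun=> 1); last by apply/funext => w; rewrite big_nil.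
  by split; [exact: (dep_cst hdep)|rewrite Ex_cst big_nil].
rewrite (_ : (fun w => _) = (fun w => g i w * \prod_(j <- r) g j w)); last first.
  by apply/funext => w; rewrite big_cons.
rewrite !big_cons; split.
  apply: (depM hdep).
    by apply: (dep_sub hdep) (hg i); exact: finset.subsetUl.
  by apply: (dep_sub hdep) IH1; exact: finset.subsetUr.
rewrite -IH2; apply: (dep_indep hdep) (hg i) IH1.
rewrite finset.disjoints_subset; apply/fintype.subsetP => v vi; rewrite inE.
apply/negP => vr; have [j jr vj] : exists2 j, j \in r & v \in U j.
  clear IH IH2; elim: r ir vr => [_|j r IH']; first by rewrite big_nil inE.
  rewrite inE negb_or => /andP[_ /IH' {}IH']; rewrite big_cons inE => /orP[vj|/IH'[k kr vk]].
    by exists j; rewrite ?mem_head.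
  by exists k; rewrite // inE kr orbT.
have ij : i != j by apply: contraNneq ir => ->.
by have /pred0P/(_ v) := dU _ _ ij; rewrite /= vi vj.
Qed.

Hypothesis dep_indic : forall I f (A : set R), measurable A -> dep I f ->
  dep I (fun w => \1_A (f w)).

Lemma prob_joint_indep m (U : 'I_m -> {set V}) (f : 'I_m -> Omega -> R) (t : 'I_m -> R) :
  (forall i, dep (U i) (f i)) ->
  (forall i j, i != j -> disjoint (mem (U i)) (mem (U j))) ->
  fine (P (\bigcap_(i in setT) [set w | f i w <= t i])) =
  \prod_(i < m) fine (P [set w | f i w <= t i]).
Proof.
move=> hf dU.
have m1 (i : 'I_m) : measurable [set w | f i w <= t i].
  have [mf _] := dep_bmeas hdep (hf i).
  have := mf measurableT _ (measurable_itv `]-oo, t i]); rewrite setTI.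
  by congr measurable; apply/seteqP; split=> w /=; rewrite in_itv.
have mI : measurable (\bigcap_(i in [set: 'I_m]) [set w | f i w <= t i]).
  by apply: fin_bigcap_measurable => [|i _]; [exact: finite_finset|exact: m1].
rewrite -Ex_indic//.
have := @Ex_prod_indep 'I_m (enum 'I_m) U (fun i w => \1_[set` `]-oo, t i]] (f i w))
  (enum_uniq _) _ dU.
case=> [i|_ h]; first by apply: dep_indic => //; exact: measurable_itv.
have E (i : 'I_m) w : \1_[set` `]-oo, t i]] (f i w) = \1_[set w | f i w <= t i] w :> R.
  by rewrite !indicE; congr (_%:R); apply/idP/idP; rewrite !inE /= in_itv.
rewrite big_enum /= in h.
transitivity (\prod_(i < m) Ex P (fun w => \1_[set` `]-oo, t i]] (f i w))); last first.
  by apply: eq_bigr => i _; rewrite -Ex_indic//; congr Ex; apply/funext => w; exact: E.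
rewrite -h; congr Ex; apply/funext => w; rewrite big_enum /=.
under eq_bigr do rewrite E.
have [win|nwin] := pselect ((\bigcap_(i in [set: 'I_m]) [set w | f i w <= t i]) w).
  rewrite indicE mem_set// big1// => i _; rewrite indicE mem_set//.
  exact: (win i Logic.I).
rewrite indicE memNset//; apply/esym/eqP; rewrite prodf_seq_eq0.
have [i ni] : exists i, ~ f i w <= t i.
  by apply: contrapT => h'; apply: nwin => i _; apply: contrapT => ni; apply: h'; exists i.
apply/hasP; exists i; first by rewrite mem_index_enum.
by rewrite /= indicE memNset.
Qed.

End independent_products.

Section poisson_grid.
Context (R : realType) (d : nat) dM (M : measurableType dM) (b s : R).
Hypotheses (b_gt0 : 0 < b) (s_gt0 : 0 < s).
Local Notation space := 'rV[R]_d.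
Local Notation point := (space * M)%type.
Local Notation config := {fset (space * M)}.
Local Notation idx := {ffun 'I_d -> 'I_(grid_size b s)}.
Context dO (Omega : measurableType dO) (P : probability Omega R).
Context (mu : {finite_measure set point -> \bar R}) (X : {RV P >-> config}).
Hypothesis hX : poisson_process mu X.
Implicit Types (J : {set idx}).

Definition region J : set point := [set z | exists2 c, c \in J & cell c z.1].

Lemma measurable_region J : measurable (region J).
Proof.
rewrite (_ : region J = \bigcup_(c in [set c | c \in J]) (@fst space M @^-1` cell c)).
  apply: fin_bigcup_measurable => [|c _]; first exact: finite_finset.
  rewrite -[_ @^-1` _]setTI.
  by apply: measurable_fst => //; exact: measurable_cell.
by apply/seteqP; split=> z /= [c cJ cz]; exists c.
Qed.

(** Dependence on the points in a region is expressed by a factorization through the restricted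
    configuration, to which independence of restrictions applies directly. *)
Definition dep J (f : Omega -> R) : Prop :=
  exists2 phi : config -> R, bmeas phi & forall w, f w = phi (restr (region J) (X w)).

Let mX : measurable_fun setT X. Proof. exact: measurable_funPT. Qed.

Lemma region_sub J J' : J \subset J' -> region J `<=` region J'.
Proof. by move=> /fintype.subsetP h z [c /h cJ cz]; exists c. Qed.

Lemma restr_restr (B B' : set point) (Y : config) : B `<=` B' ->
  restr B (restr B' Y) = restr B Y.
Proof.
move=> BB; apply/fsetP => z; rewrite !inE; case: (z \in Y) => //=.
case: (boolP (z \in B)) => [zB|_]; last by rewrite andbF.
by rewrite (mem_set (BB _ (set_mem zB))).
Qed.

Lemma bmeas_restr (B : set point) (phi : config -> R) : measurable B ->
  bmeas phi -> bmeas (fun Y => phi (restr B Y)).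
Proof.
move=> mB [mp [K hK]]; split; last by exists K.
exact: (measurableT_comp mp (measurable_restr R mB)).
Qed.

(** Half-open cells are disjoint, so the region of one index set lies in the complement of the
    region of a disjoint one, and independence reduces to that of a set and its complement. *)
Lemma poisson_system : independent_system P dep.
Proof.
split.
- move=> I f [phi [mp [K hK]] fE]; split; last by exists K => w; rewrite fE.
  rewrite (_ : f = fun w => phi (restr (region I) (X w))); last exact/funext.
  apply: (measurableT_comp mp).
  exact: (measurableT_comp (measurable_restr R (measurable_region I)) mX).
- move=> I J f IJ [phi bp fE].
  exists (fun Y => phi (restr (region I) Y)).
    by apply: bmeas_restr => //; exact: measurable_region.
  by move=> w; rewrite fE restr_restr//; exact: region_sub.
- by move=> I c; exists (fun=> c) => //; exact: bmeas_cst.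
- move=> I f g [p bp fE] [q bq gE]; exists (fun Y => p Y + q Y).
    exact: bmeasD.
  by move=> w; rewrite fE gE.
- move=> I f g [p bp fE] [q bq gE]; exists (fun Y => p Y * q Y).
    exact: bmeasM.
  by move=> w; rewrite fE gE.
- move=> I f u cu [p bp fE]; exists (fun Y => u (p Y)).
    exact: bmeas_comp.
  by move=> w; rewrite fE.
- move=> I J f g IJ [p bp fE] [q bq gE].
  have sub : region J `<=` ~` region I.
    move=> z [c cJ cz] [c' cI cz']; have cc := cell_inj s_gt0 cz cz'.
    by have /pred0P/(_ c) := IJ; rewrite /= cJ cc cI.
  rewrite (_ : f = fun w => p (restr (region I) (X w))); last exact/funext.
  rewrite (_ : g = fun w => (fun Y => q (restr (region J) Y)) (restr (~` region I) (X w))); last first.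
    by apply/funext => w; rewrite gE restr_restr.
  have bq' : bmeas (fun Y => q (restr (region J) Y)).
    by apply: bmeas_restr => //; exact: measurable_region.
  exact: (poisson_indep_Ex hX (measurable_region I) bp bq').
Qed.

Lemma dep_indic J f (A : set R) : measurable A -> dep J f ->
  dep J (fun w => \1_A (f w)).
Proof.
move=> mA [p bp fE]; exists (fun Y => \1_A (p Y)); first exact: bmeas_indic_comp.
by move=> w; rewrite fE.
Qed.

Local Notation S := (@cells_within R d b s 1).

Lemma interacting_within k c (N : idx -> {set idx}) :
  (forall c, N c \subset cells_within k c) ->
  interacting N c \subset cells_within (k + k) c.
Proof.
move=> hN; apply/fintype.subsetP => j; rewrite inE => /pred0Pn[v /=/andP[vj vc]].
apply: (cells_within_trans (c2 := v)).
  exact: (fintype.subsetP (hN c)).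
rewrite cells_within_sym; exact: (fintype.subsetP (hN j)).
Qed.

Lemma second_nbhd_within c : second_nbhd S c \subset cells_within 3 c.
Proof.
rewrite /second_nbhd; apply/fintype.subsetP => j; rewrite finset.in_setU => /orP[h|].
  have := cells_within_trans h (cells_within_refl 2 j); exact.
move=> /finset.bigcupP[v vc jv].
have := fintype.subsetP (@interacting_within 1 c S (fun c => fintype.subxx _)) v vc.
by move=> h; exact: (cells_within_trans h jv).
Qed.

(** Second neighbourhoods reach three cells away, so interacting indices differ by at most 6 in each
    coordinate: 13 = 2 * 6 + 1 values. *)
Lemma interacting_second_card c :
  #|interacting (second_nbhd S) c|%:R <= 13%:R ^+ d :> R.
Proof.
rewrite -natrX ler_nat; apply: leq_trans (card_cells_within 6 c).
by apply: subset_leq_card; exact: (@interacting_within 3 c (second_nbhd S) second_nbhd_within).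
Qed.

Lemma interacting_card c : #|interacting S c|%:R <= 13%:R ^+ d :> R.
Proof.
apply: le_trans (interacting_second_card c); rewrite ler_nat subset_leq_card//.
apply/fintype.subsetP => j; rewrite !inE; apply: contra.
by apply: disjointW; exact: finset.subsetUl.
Qed.

End poisson_grid.

(** * Variance and joint distribution under perturbation *)

Lemma expr4D_le (R : realFieldType) (x y : R) : (x + y) ^+ 4 <= 8 * (x ^+ 4 + y ^+ 4).
Proof.
rewrite -subr_ge0.
have -> : 8 * (x ^+ 4 + y ^+ 4) - (x + y) ^+ 4 =
  (x - y) ^+ 2 * (5 * (x + y) ^+ 2 + 2 * x ^+ 2 + 2 * y ^+ 2) by ring.
have := sqr_ge0 (x + y); have := sqr_ge0 x; have := sqr_ge0 y.
by move=> *; apply: mulr_ge0; [exact: sqr_ge0|lra].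
Qed.

Section fourth_moments.
Context d (Omega : measurableType d) (R : realType) (P : probability Omega R).
Implicit Types (f g : Omega -> R).
Local Notation Ex := (Ex P).

(** The integrals T_i are not bounded, hence outside [bmeas]. A finite fourth moment makes products
    integrable and controls the second moment on an event of small probability. *)
Definition fourth_moment f :=
  measurable_fun setT f /\ (\int[P]_w (f w ^+ 4)%:E < +oo)%E.

Let integrable_expr4 f : fourth_moment f -> P.-integrable setT (EFin \o (fun w => f w ^+ 4)).
Proof.
move=> [mf f4]; apply/integrableP; split.
  by apply/measurable_EFinP; exact: measurable_funX.
rewrite (eq_integral (fun w => (f w ^+ 4)%:E))// => w _.
by rewrite /= ger0_norm// exprn_even_ge0.
Qed.

Lemma integrable_mul_fourth f g : fourth_moment f -> fourth_moment g ->
  P.-integrable setT (EFin \o (fun w => f w * g w)).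
Proof.
move=> hf hg; have [mf _] := hf; have [mg _] := hg.
pose h w : \bar R := ((f w ^+ 4)%:E + ((g w ^+ 4)%:E + 1))%E.
have ih : P.-integrable setT h.
  apply: integrableD => //; first exact: integrable_expr4.
  apply: integrableD => //; first exact: integrable_expr4.
  exact: (integrable_bmeas P (bmeas_cst Omega 1)).
apply: (le_integrable measurableT _ _ ih) => [|w _].
  by apply/measurable_EFinP; exact: measurable_funM.
change ((`|f w * g w|)%:E <= (`|f w ^+ 4 + (g w ^+ 4 + 1)|)%:E)%E.
rewrite lee_fin normrM [leRHS]ger0_norm; last first.
  by rewrite !addr_ge0// exprn_even_ge0.
have f2 : 0 <= (f w ^+ 2 - 1 / 2) ^+ 2 by exact: sqr_ge0.
have g2 : 0 <= (g w ^+ 2 - 1 / 2) ^+ 2 by exact: sqr_ge0.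
have : 0 <= (`|f w| - `|g w|) ^+ 2 by exact: sqr_ge0.
have -> : (`|f w| - `|g w|) ^+ 2 = f w ^+ 2 + g w ^+ 2 - 2 * (`|f w| * `|g w|).
  by rewrite -[f w ^+ 2]real_normK ?num_real// -[g w ^+ 2]real_normK ?num_real//; ring.
have -> : f w ^+ 4 = (f w ^+ 2 - 1 / 2) ^+ 2 + f w ^+ 2 - 1 / 4 by field.
have -> : g w ^+ 4 = (g w ^+ 2 - 1 / 2) ^+ 2 + g w ^+ 2 - 1 / 4 by field.
have : 0 <= f w ^+ 2 by exact: sqr_ge0.
have : 0 <= g w ^+ 2 by exact: sqr_ge0.
by lra.
Qed.

Lemma fourth_moment_bmeas f : bmeas f -> fourth_moment f.
Proof.
move=> bf; have b4 : bmeas (fun w => f w ^+ 4) by exact: bmeasX.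
split; first by case: bf.
have /integrableP[_] := integrable_bmeas P b4; apply: le_lt_trans.
apply: ge0_le_integral_any => w; rewrite ?lee_fin ?exprn_even_ge0//=.
by rewrite ger0_norm// exprn_even_ge0.
Qed.

Lemma integrable_fourth f : fourth_moment f -> P.-integrable setT (EFin \o f).
Proof.
move=> hf; have := integrable_mul_fourth hf (fourth_moment_bmeas (bmeas_cst Omega 1)).
by congr (P.-integrable _ (EFin \o _)); apply/funext => w; rewrite mulr1.
Qed.

Lemma fourth_momentD f g : fourth_moment f -> fourth_moment g ->
  fourth_moment (fun w => f w + g w).
Proof.
move=> [mf hf] [mg hg]; split; first exact: measurable_funD.
apply: (@le_lt_trans _ _ (\int[P]_w (8%:E * ((f w ^+ 4)%:E + (g w ^+ 4)%:E)))%E).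
  apply: ge0_le_integral_any => w; first by rewrite lee_fin exprn_even_ge0.
  by rewrite -EFinD -EFinM lee_fin expr4D_le.
rewrite ge0_integralZl//; first last.
- by move=> w _; rewrite adde_ge0// lee_fin exprn_even_ge0.
- by apply: emeasurable_funD; apply/measurable_EFinP; exact: measurable_funX.
rewrite ge0_integralD//; first last.
- by apply/measurable_EFinP; exact: measurable_funX.
- by move=> w _; rewrite lee_fin exprn_even_ge0.
- by apply/measurable_EFinP; exact: measurable_funX.
- by move=> w _; rewrite lee_fin exprn_even_ge0.
by rewrite lte_mul_pinfty// lte_add_pinfty.
Qed.

Lemma fourth_momentN f : fourth_moment f -> fourth_moment (fun w => - f w).
Proof.
move=> [mf hf]; split; first exact: measurableT_comp.
by rewrite (eq_integral (fun w => (f w ^+ 4)%:E))// => w _; congr EFin; ring.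
Qed.

Lemma Ex_addI f g : P.-integrable setT (EFin \o f) -> P.-integrable setT (EFin \o g) ->
  Ex (fun w => f w + g w) = Ex f + Ex g.
Proof. by move=> hf hg; rewrite !ExE RintegralD. Qed.

Lemma Ex_scaleI (c : R) f : P.-integrable setT (EFin \o f) ->
  Ex (fun w => c * f w) = c * Ex f.
Proof. by move=> hf; rewrite !ExE RintegralZl. Qed.

Lemma Ex_leI f g : P.-integrable setT (EFin \o f) -> P.-integrable setT (EFin \o g) ->
  (forall w, f w <= g w) -> Ex f <= Ex g.
Proof. by move=> hf hg fg; rewrite !ExE le_Rintegral. Qed.

Lemma fine_expectation f : fine 'E_P[f] = Ex f.
Proof. by rewrite unlock ExE /Rintegral. Qed.

Lemma fine_variance f : fine 'V_P[f] = Ex (fun w => (f w - Ex f) ^+ 2).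
Proof.
rewrite -[in RHS](fine_expectation f) -fine_expectation /variance [in LHS]unlock.
by congr (fine 'E_P[_]); apply/funext => w; rewrite expr2.
Qed.

Lemma variance_fin_num f : fourth_moment f -> 'V_P[f] \is a fin_num.
Proof.
move=> hf; pose g w := f w - Ex f.
have hg : fourth_moment g.
  by apply: fourth_momentD => //; apply: fourth_moment_bmeas; exact: bmeas_cst.
have := integrable_fin_num measurableT (integrable_mul_fourth hg hg).
congr (_ \is a fin_num); rewrite /variance [in RHS]unlock [in RHS]unlock.
by apply: eq_integral.
Qed.

End fourth_moments.

Section variance_comparison.
Context d (Omega : measurableType d) (R : realType) (P : probability Omega R).
Local Notation Ex := (Ex P).
Context (T S E : Omega -> R) (a q Q h : R) (B : set Omega).
Hypothesis hT : fourth_moment P T.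
Hypotheses (bS : bmeas S) (bE : bmeas E) (ES : Ex S = 0) (EE : Ex E = 0).
Hypothesis mB : measurable B.
Hypothesis TB : forall w, ~ B w -> T w = a + S w + E w.
Hypothesis PB : fine (P B) <= q.
Let D w := T w - (a + S w + E w).
Hypothesis D4 : (\int[P]_w ((T w - (a + S w + E w)) ^+ 4)%:E <= Q%:E)%E.
Hypothesis h_gt0 : 0 < h.

Let fS := fourth_moment_bmeas P bS.
Let fE := fourth_moment_bmeas P bE.
Let bW : bmeas (fun w => a + S w + E w).
Proof. by apply: bmeasD => //; apply: bmeasD => //; exact: bmeas_cst. Qed.
Let fW := fourth_moment_bmeas P bW.
Let fD : fourth_moment P D.
Proof. by apply: fourth_momentD => //; exact: fourth_momentN. Qed.
Let fc (c : R) : fourth_moment P (fun=> c).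
Proof. exact: fourth_moment_bmeas (bmeas_cst _ c). Qed.

Let iM f g := @integrable_mul_fourth _ _ _ P f g.
Let iF f := @integrable_fourth _ _ _ P f.

Let i2 f : fourth_moment P f -> P.-integrable setT (EFin \o (fun w => f w ^+ 2)).
Proof. by move=> hf; exact: (iM hf hf). Qed.

Let iZ (c : R) f : P.-integrable setT (EFin \o f) ->
  P.-integrable setT (EFin \o (fun w => c * f w)).
Proof. by move=> hf; exact: (integrableZl measurableT c hf). Qed.

Let iD f g : P.-integrable setT (EFin \o f) -> P.-integrable setT (EFin \o g) ->
  P.-integrable setT (EFin \o (fun w => f w + g w)).
Proof. by move=> hf hg; exact: (integrableD measurableT hf hg). Qed.

(** The error [D] vanishes off [B], and on [B] it satisfies [D ^+ 2 <= h * D ^+ 4 + h^-1]. The free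
    parameter [h] replaces the Cauchy-Schwarz inequality. *)
Lemma error_sqr_le : Ex (fun w => D w ^+ 2) <= h * Q + q / h.
Proof.
have i4 : P.-integrable setT (EFin \o (fun w => D w ^+ 4)).
  apply/integrableP; split.
    by apply/measurable_EFinP; apply: measurable_funX; case: fD.
  rewrite (eq_integral (fun w => (D w ^+ 4)%:E)); first by case: fD.
  by move=> w _; rewrite /= ger0_norm// exprn_even_ge0.
have bB : bmeas (\1_B : Omega -> R).
  split; first exact: measurable_indic.
  by exists 1 => w; rewrite indicE; case: (_ \in _); rewrite ?normr0 ?normr1.
have iB := integrable_bmeas P bB.
apply: (@le_trans _ _ (Ex (fun w => h * D w ^+ 4 + h^-1 * \1_B w))).
  apply: Ex_leI; [exact: i2|by apply: iD; exact: iZ|move=> w].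
  rewrite indicE; case: (boolP (w \in B)) => [_|wB].
    have hh : h * h^-1 = 1 by rewrite mulfV// gt_eqF.
    have : 0 <= h * (D w ^+ 2 - h^-1 / 2) ^+ 2 by rewrite mulr_ge0 ?sqr_ge0// ltW.
    have -> : h * (D w ^+ 2 - h^-1 / 2) ^+ 2 =
      h * D w ^+ 4 - (h * h^-1) * D w ^+ 2 + (h * h^-1) * h^-1 / 4 by field; rewrite gt_eqF.
    rewrite hh !mul1r /= mulr1; have : 0 < h^-1 by rewrite invr_gt0.
    lra.
  rewrite /D TB; last by move=> Bw; move: wB; rewrite mem_set.
  by rewrite subrr expr0n mulr0 expr0n !mulr0 addr0.
rewrite Ex_addI; [|exact: iZ|exact: iZ].
rewrite !Ex_scaleI// Ex_indic// [h^-1 * _]mulrC.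
apply: lerD; last by rewrite ler_pM2r// invr_gt0.
rewrite ler_pM2l// ExE /Rintegral -lee_fin fineK//.
exact: (integrable_fin_num measurableT i4).
Qed.

Lemma mean_error : Ex T = a + Ex D.
Proof.
have -> : T = fun w => (a + S w + E w) + D w by apply/funext => w; rewrite /D; ring.
rewrite Ex_addI; [|exact: iF|exact: iF]; congr (_ + _).
rewrite ExD// ?ExD// ?Ex_cst ?ES ?EE ?addr0//; try exact: bmeas_cst.
by apply: bmeasD => //; exact: bmeas_cst.
Qed.

Lemma mean_error_sqr_le : (Ex T - a) ^+ 2 <= h * Q + q / h.
Proof.
apply: le_trans error_sqr_le; rewrite mean_error [a + _]addrC addrK.
set m := Ex D.
have : 0 <= Ex (fun w => (D w - m) ^+ 2) by apply: Ex_ge0 => w; exact: sqr_ge0.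
have -> : (fun w => (D w - m) ^+ 2) = fun w => D w ^+ 2 + ((- (2 * m)) * D w + m ^+ 2).
  by apply/funext => w; ring.
rewrite Ex_addI; [|exact: i2|by apply: iD; [apply: iZ; exact: iF|exact: iF]].
rewrite Ex_addI; [|by apply: iZ; exact: iF|exact: iF].
rewrite Ex_scaleI; last exact: iF.
by rewrite Ex_cst -/m; lra.
Qed.

(** With H the centred [T] and G = H - S, the difference of H^2 and S^2 is at most e H^2 + (1 + 1/e)
    G^2 in absolute value. The term e H^2 leaves a relative error, so no upper bound on the variance
    is required. G consists of [E], of [D] and of the shift of the mean: three squares give the
    factor 3, and the last two have the same bound, whence 6. *)
Lemma variance_comparison (e : R) : 0 < e ->
  `|fine 'V_P[T] - Ex (fun w => S w ^+ 2)| <=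
  e * fine 'V_P[T] + (1 + e^-1) * (3 * Ex (fun w => E w ^+ 2) + 6 * (h * Q + q / h)).
Proof.
move=> e0; rewrite fine_variance.
set m := Ex T; have hm : (m - a) ^+ 2 <= h * Q + q / h := mean_error_sqr_le.
pose H w := T w - m.
have fH : fourth_moment P H by apply: fourth_momentD => //; exact: fc.
rewrite -/(H _); set c := 1 + e^-1.
have c0 : 0 < c by rewrite addr_gt0 ?invr_gt0.
have key w : `|H w ^+ 2 - S w ^+ 2| <= e * H w ^+ 2 +
   c * (3 * (E w ^+ 2 + (D w ^+ 2 + (m - a) ^+ 2))).
  pose G := E w + D w - (m - a).
  have SE : S w = H w - G by rewrite /G /H /D; ring.
  have G2 : G ^+ 2 <= 3 * (E w ^+ 2 + (D w ^+ 2 + (m - a) ^+ 2)).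
    rewrite -subr_ge0 /G; set x := E w; set y := D w; set z := m - a.
    have -> : 3 * (x ^+ 2 + (y ^+ 2 + z ^+ 2)) - (x + y - z) ^+ 2 =
      (x - y) ^+ 2 + (x + z) ^+ 2 + (y + z) ^+ 2 by ring.
    by rewrite !addr_ge0// sqr_ge0.
  apply: (@le_trans _ _ (e * H w ^+ 2 + c * G ^+ 2)); last by rewrite lerD2l ler_pM2l.
  rewrite SE /c.
  have ee : e * e^-1 = 1 by rewrite mulfV// gt_eqF.
  have h1 : 0 <= e * (H w - e^-1 * G) ^+ 2 by rewrite mulr_ge0 ?sqr_ge0// ltW.
  have h2 : 0 <= e * (H w + e^-1 * G) ^+ 2 by rewrite mulr_ge0 ?sqr_ge0// ltW.
  have E1 : e * (H w - e^-1 * G) ^+ 2 = e * H w ^+ 2 - 2 * (e * e^-1) * (H w * G) + (e * e^-1) * (e^-1 * G ^+ 2).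
    by field; rewrite gt_eqF.
  have E2 : e * (H w + e^-1 * G) ^+ 2 = e * H w ^+ 2 + 2 * (e * e^-1) * (H w * G) + (e * e^-1) * (e^-1 * G ^+ 2).
    by field; rewrite gt_eqF.
  move: h1 h2; rewrite E1 E2 ee.
  have -> : H w ^+ 2 - (H w - G) ^+ 2 = 2 * (H w * G) - G ^+ 2 by ring.
  have := sqr_ge0 G; rewrite mulrDl mul1r ler_norml => *; apply/andP; split; lra.
have iH := i2 fH; have iS := i2 fS.
have iR : P.-integrable setT (EFin \o (fun w => c * (3 * (E w ^+ 2 + (D w ^+ 2 + (m - a) ^+ 2))))).
  by apply: iZ; apply: iZ; apply: iD; [exact: i2|apply: iD; [exact: i2|exact: iF]].
have ER : Ex (fun w => c * (3 * (E w ^+ 2 + (D w ^+ 2 + (m - a) ^+ 2)))) <=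
    c * (3 * Ex (fun w => E w ^+ 2) + 6 * (h * Q + q / h)).
  rewrite Ex_scaleI; last by apply: iZ; apply: iD; [exact: i2|apply: iD; [exact: i2|exact: iF]].
  rewrite ler_pM2l// Ex_scaleI; last by apply: iD; [exact: i2|apply: iD; [exact: i2|exact: iF]].
  rewrite Ex_addI; [|exact: i2|by apply: iD; [exact: i2|exact: iF]].
  rewrite Ex_addI; [|exact: i2|exact: iF].
  rewrite Ex_cst; have := error_sqr_le; lra.
have up : Ex (fun w => H w ^+ 2) <= Ex (fun w => S w ^+ 2) + (e * Ex (fun w => H w ^+ 2) +
   Ex (fun w => c * (3 * (E w ^+ 2 + (D w ^+ 2 + (m - a) ^+ 2))))).
  rewrite -(Ex_scaleI _ iH) -!Ex_addI//; [|by apply: iD => //; exact: iZ|exact: iZ].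
  apply: Ex_leI => //; first by apply: iD => //; apply: iD => //; exact: iZ.
  by move=> w; have := key w; rewrite ler_norml => /andP[_ ]; lra.
have dn : Ex (fun w => S w ^+ 2) <= Ex (fun w => H w ^+ 2) + (e * Ex (fun w => H w ^+ 2) +
   Ex (fun w => c * (3 * (E w ^+ 2 + (D w ^+ 2 + (m - a) ^+ 2))))).
  rewrite -(Ex_scaleI _ iH) -!Ex_addI//; [|by apply: iD => //; exact: iZ|exact: iZ].
  apply: Ex_leI => //; first by apply: iD => //; apply: iD => //; exact: iZ.
  by move=> w; have := key w; rewrite ler_norml => /andP[+ _ ]; lra.
by rewrite ler_norml; apply/andP; split; lra.
Qed.

End variance_comparison.

(** * From independent approximations to the joint distribution *)

Section joint_approximation.
Context d (Omega : measurableType d) (R : realType) (P : probability Omega R).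
Local Notation Ex := (Ex P).
Local Notation Phi := (@std_normal_cdf R).

Lemma norm_prod_sub_le (I : Type) (r : seq I) (x y : I -> R) :
  (forall i, 0 <= x i <= 1) -> (forall i, 0 <= y i <= 1) ->
  `|\prod_(i <- r) x i - \prod_(i <- r) y i| <= \sum_(i <- r) `|x i - y i|.
Proof.
move=> hx hy; elim: r => [|i r IH]; first by rewrite !big_nil subrr normr0.
rewrite !big_cons.
have p1 : 0 <= \prod_(j <- r) x j <= 1.
  apply/andP; split; first by apply: prodr_ge0 => j _; case/andP: (hx j).
  elim: {IH} (r) => [|j r' IH]; first by rewrite big_nil.
  have /andP[xj0 xj1] := hx j; rewrite big_cons mulr_ile1//.
  by apply: prodr_ge0 => k _; case/andP: (hx k).
have -> : x i * (\prod_(j <- r) x j) - y i * (\prod_(j <- r) y j) =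
  (x i - y i) * (\prod_(j <- r) x j) + y i * (\prod_(j <- r) x j - \prod_(j <- r) y j) by ring.
apply: le_trans (ler_normD _ _) _; rewrite !normrM; apply: lerD.
  by case/andP: p1 => p0 p1; rewrite ler_piMr// ger0_norm.
by apply: le_trans IH; case/andP: (hy i) => y0 y1; rewrite ler_piMl// ger0_norm.
Qed.

Context (m : nat) (T S : 'I_m -> Omega -> R) (mu sigma : 'I_m -> R).
Context (B : 'I_m -> set Omega) (q delta u : R).
Hypothesis mT : forall i, measurable_fun setT (T i).
Hypothesis mS : forall i, measurable_fun setT (S i).
Hypothesis sigma_gt0 : forall i, 0 < sigma i.
Hypothesis mB : forall i, measurable (B i).
Hypothesis PB : forall i, fine (P (B i)) <= q.
Hypothesis u_ge0 : 0 <= u.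
Hypothesis TS : forall i w, ~ B i w -> `|T i w - mu i - S i w| <= u * sigma i.
Hypothesis S_indep : forall t : 'I_m -> R,
  fine (P (\bigcap_(i in setT) [set w | S i w <= t i])) =
  \prod_(i < m) fine (P [set w | S i w <= t i]).
Hypothesis S_clt : forall i (t : R),
  `|fine (P [set w | S i w <= t * sigma i]) - Phi t| <= delta.

Let mle (f : 'I_m -> Omega -> R) (t : 'I_m -> R) : (forall i, measurable_fun setT (f i)) ->
  measurable (\bigcap_(i in setT) [set w | f i w <= t i]).
Proof.
move=> mf; apply: fin_bigcap_measurable => [|i _]; first exact: finite_finset.
have := mf i measurableT _ (measurable_itv `]-oo, t i]); rewrite setTI.
by congr measurable; apply/seteqP; split=> w /=; rewrite in_itv.
Qed.

Let bI (A : set Omega) : measurable A -> bmeas (\1_A : Omega -> R).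
Proof.
move=> mA; split; first exact: measurable_indic.
by exists 1 => w; rewrite indicE; case: (_ \in _); rewrite ?normr0 ?normr1.
Qed.

Let union_bound (A A' : set Omega) : measurable A -> measurable A' ->
  (forall w, (forall i, ~ B i w) -> A w -> A' w) ->
  fine (P A) <= fine (P A') + m%:R * q.
Proof.
move=> mA mA' AA'; rewrite -!Ex_indic//.
apply: (@le_trans _ _ (Ex (fun w => \1_A' w + \sum_(i < m) \1_(B i) w))).
  apply: Ex_le; [exact: bI| |move=> w].
    by apply: bmeasD; [exact: bI|apply: bmeas_sum => i _; exact: bI].
  have s0 : 0 <= \sum_(i < m) (\1_(B i) w : R) by apply: sumr_ge0.
  have [[i Bi]|nB] := pselect (exists i, B i w).
    rewrite -[leLHS]add0r lerD// (bigD1 i)//= -[leLHS]addr0 lerD// ?sumr_ge0//.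
    by rewrite [X in _ <= X]indicE mem_set// indicE; case: (_ \in _).
  rewrite -[leLHS]addr0 lerD// !indicE ler_nat.
  case: (boolP (w \in A)) => //; rewrite inE => Aw; rewrite mem_set//.
  by apply: AA' => // i Bi; apply: nB; exists i.
rewrite ExD; [|exact: bI|by apply: bmeas_sum => i _; exact: bI].
rewrite lerD2l Ex_sum; last by move=> i _; exact: bI.
apply: (@le_trans _ _ (\sum_(i < m) q)); last by rewrite sumr_const card_ord mulr_natl.
by apply: ler_sum => i _; rewrite Ex_indic.
Qed.

Let prob01 (A : set Omega) : measurable A -> 0 <= fine (P A) <= 1.
Proof.
move=> mA; rewrite fine_ge0//=.
by rewrite -lee_fin fineK ?probability_le1// fin_num_measure.
Qed.

Let prod_clt (t t' : 'I_m -> R) : (forall i, `|t i - t' i| <= u) ->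
  `|\prod_(i < m) fine (P [set w | S i w <= t i * sigma i]) - \prod_(i < m) Phi (t' i)| <=
   m%:R * (delta + u).
Proof.
move=> tt; apply: le_trans (norm_prod_sub_le _ _ _) _ => [i|i|].
- apply: prob01; have := mS i measurableT (measurable_itv `]-oo, t i * sigma i]); rewrite setTI.
  by congr measurable; apply/seteqP; split=> w /=; rewrite in_itv.
- by rewrite std_normal_cdf_ge0 std_normal_cdf_le1.
apply: (@le_trans _ _ (\sum_(i < m) (delta + u))); last by rewrite sumr_const card_ord mulr_natl.
apply: ler_sum => i _; apply: le_trans (ler_distD (Phi (t i)) _ _) _.
apply: lerD; first exact: S_clt.
apply: le_trans (tt i); have [h|h] := leP (t i) (t' i).
  have /andP[h1 h2] := std_normal_cdf_lip h.
  rewrite distrC ger0_norm ?subr_ge0// distrC ger0_norm ?subr_ge0//; lra.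
have /andP[h1 h2] := std_normal_cdf_lip (ltW h).
rewrite ger0_norm ?subr_ge0// ger0_norm ?subr_ge0//; [lra|exact: ltW].
Qed.

(** Off the exceptional events, the event for the [T i] lies between those for the [S i] with
    thresholds moved by [u] down and up. These have product probabilities, and moving the thresholds
    back costs [u] for each factor since [Phi] is 1-Lipschitz. *)
Lemma joint_approximation (t : 'I_m -> R) :
  `|fine (P (\bigcap_(i in setT) [set w | (T i w - mu i) / sigma i <= t i])) -
    \prod_(i < m) Phi (t i)| <= m%:R * (q + delta + u).
Proof.
have mTt : measurable (\bigcap_(i in setT) [set w | (T i w - mu i) / sigma i <= t i]).
  apply: mle => i; apply: measurable_funM => //.
  by apply: measurable_funB.
have up : fine (P (\bigcap_(i in setT) [set w | (T i w - mu i) / sigma i <= t i])) <=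
    fine (P (\bigcap_(i in setT) [set w | S i w <= (t i + u) * sigma i])) + m%:R * q.
  apply: union_bound => //; first exact: mle.
  move=> w nB h i _ /=; have := h i Logic.I; rewrite /= ler_pdivrMr// mulrDl => h1.
  by have := TS (nB i); rewrite ler_norml => /andP[]; lra.
have dn : fine (P (\bigcap_(i in setT) [set w | S i w <= (t i - u) * sigma i])) <=
    fine (P (\bigcap_(i in setT) [set w | (T i w - mu i) / sigma i <= t i])) + m%:R * q.
  apply: union_bound => //; first exact: mle.
  move=> w nB h i _ /=; have := h i Logic.I; rewrite /= ler_pdivrMr// mulrBl => h1.
  by have := TS (nB i); rewrite ler_norml => /andP[]; lra.
have h1 := @prod_clt (fun i => t i + u) t; have h2 := @prod_clt (fun i => t i - u) t.
move: up dn; rewrite !S_indep => up dn.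
have {}h1 : `|_| <= _ := h1 _; have {}h2 : `|_| <= _ := h2 _.
have := h1 (fun i => _); rewrite ler_norml => /(_ _)/andP[|_ h1'].
  by move=> i; rewrite addrC addKr ger0_norm.
have := h2 (fun i => _); rewrite ler_norml => /(_ _)/andP[|h2' _].
  by move=> i; rewrite addrC addKr normrN ger0_norm.
rewrite ler_norml; apply/andP; split; lra.
Qed.

End joint_approximation.

(** * Truncated cell sums *)

Section xi_integral.
Context (R : realType) (d : nat) dM (M : measurableType dM).
Local Notation space := 'rV[R]_d.
Local Notation config := {fset (space * M)}.
Context (xi : space -> M -> config -> {nonneg R}) (A : set space) (l : R) (X : config).

Lemma ge0_integral_xi_measure (G : set space) (h : space -> \bar R) :
  measurable G -> G `<=` A -> measurable_fun G h -> (forall x, G x -> (0 <= h x)%E) ->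
  (\int[xi_measure xi A l X]_(x in G) h x =
   \sum_(z <- X | z.1 \in G) (xi_scaled xi l z.1 z.2 X)%:num%:E * h z.1)%E.
Proof.
move=> mG GA mh h0.
pose m (k : nat) : {measure set space -> \bar R} :=
  let z := nth point X k in
  if z.1 \in A then
    (mscale (xi_scaled xi l z.1 z.2 X) \d_(z.1) : {measure set space -> \bar R})
  else (mzero : {measure set space -> \bar R}).
rewrite (eq_measure_integral (msum m (size X))); last first.
  move=> B mB _; rewrite /= /xi_measure (big_nth point) big_mkcond /= big_mkord.
  by apply: eq_bigr => k _; rewrite /m; case: ifPn.
rewrite ge0_integral_measure_sum// (big_nth point) [RHS]big_mkcond /= big_mkord.
apply: eq_bigr => k _; rewrite /m; set z := nth _ _ _.
case: ifPn => zA.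
  rewrite ge0_integral_mscale// integral_dirac// diracE.
  by case: ifPn => _; rewrite ?mul1e// mul0e mule0.
rewrite integral_measure_zero ifN//; apply: contra zA.
by rewrite !inE; exact: GA.
Qed.

Lemma Rintegral_xi_measure (G : set space) (f : space -> R) :
  measurable G -> G `<=` A -> measurable_fun G f ->
  \int[xi_measure xi A l X]_(x in G) f x =
  \sum_(z <- X | z.1 \in G) f z.1 * (xi_scaled xi l z.1 z.2 X)%:num.
Proof.
move=> mG GA mf; rewrite /Rintegral integralE.
have mEf : measurable_fun G (EFin \o f) by exact/measurable_EFinP.
rewrite !ge0_integral_xi_measure//; [|exact: measurable_funeneg|exact: measurable_funepos].
have pE x : ((EFin \o f)^\+ x = (Num.max (f x) 0)%:E)%E by rewrite funeposE /= EFin_max.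
have nE x : ((EFin \o f)^\- x = (Num.max (- f x) 0)%:E)%E by rewrite funenegE /= EFin_max.
under eq_bigr do rewrite pE -EFinM.
under [X in (_ - X)%E]eq_bigr do rewrite nE -EFinM.
rewrite !sumEFin -EFinB /= -sumrB; apply: eq_bigr => z _.
rewrite -mulrBr mulrC; congr (_ * _).
rewrite /Num.max; case: ltP => h1; case: ltP => h2; lra.
Qed.

End xi_integral.

Section clamp.
Context (R : realType).

Definition clamp (K x : R) : R := Num.max (- K) (Num.min x K).

Lemma clamp_le K x : 0 <= K -> `|clamp K x| <= K.
Proof.
by move=> K0; rewrite /clamp ler_norml le_max lexx /= ge_max ge_min lexx orbT andbT ge0_cp.
Qed.

Lemma clamp_id K x : `|x| <= K -> clamp K x = x.
Proof.
rewrite ler_norml => /andP[h1 h2]; rewrite /clamp.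
by rewrite (min_idPl h2); apply/max_idPr.
Qed.

Lemma measurable_clamp d (T : measurableType d) K (f : T -> R) :
  measurable_fun setT f -> measurable_fun setT (fun t => clamp K (f t)).
Proof.
move=> mf; apply: measurable_maxr; first exact: measurable_cst.
by apply: measurable_minr => //; exact: measurable_cst.
Qed.

End clamp.

Section cell_sums.
Context (R : realType) (d : nat) dM (M : measurableType dM) (b s : R).
Hypotheses (b_gt0 : 0 < b) (s_gt0 : 0 < s).
Local Notation space := 'rV[R]_d.
Local Notation point := (space * M)%type.
Local Notation config := {fset (space * M)}.
Local Notation idx := {ffun 'I_d -> 'I_(grid_size b s)}.
Local Notation S := (@cells_within R d b s 1).
Context (xs : point * config -> R) (mxs : measurable_fun setT xs) (xs0 : forall u, 0 <= xs u).
Context (G : set space) (mG : measurable G) (f : space -> R) (mf : measurable_fun G f).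
Context (F L K : R).
Hypotheses (F_ge0 : 0 <= F) (L_ge0 : 0 <= L) (K_ge0 : 0 <= K).
Hypothesis f_le : forall x, G x -> `|f x| <= F.

(** The score is computed inside the ball of radius [s] and replaced by 0 when above [L]. It is thus
    bounded and local for every configuration, and for a pair that is not bad it is the true score
    times [f] on [G]. *)
Definition zeta (u : point * config) : R :=
  let y := xs (u.1, cut s u.1 u.2) in
  (f \_ G) u.1.1 * (\1_[set y : R | y <= L] y * y).

Lemma measurable_zeta : measurable_fun setT zeta.
Proof.
have m11 : measurable_fun setT (fun u : point * config => u.1.1).
  by apply: measurableT_comp measurable_fst; exact: measurable_fst.
have mfG : measurable_fun setT (f \_ G) by exact/(measurable_restrictT f mG).
have mc : measurable_fun setT (fun u => xs (u.1, cut s u.1 u.2)) by exact: measurable_xs_cut.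
have mi : measurable_fun [set: R] (\1_[set y : R | y <= L] : R -> R).
  apply: measurable_indic; rewrite (_ : [set y | _] = [set` `]-oo, L]]); first exact: measurable_itv.
  by apply/seteqP; split=> x /=; rewrite in_itv.
apply: measurable_funM; first exact: (measurableT_comp mfG m11).
by apply: measurable_funM => //; exact: (measurableT_comp mi mc).
Qed.

Lemma zeta_le u : `|zeta u| <= F * L.
Proof.
rewrite /zeta normrM; apply: ler_pM => //.
  by rewrite /patch; case: ifPn; rewrite ?normr0// inE => /f_le.
rewrite indicE; case: (boolP (_ \in _)); rewrite ?mul0r ?normr0// inE /= mul1r.
by rewrite ger0_norm.
Qed.

Definition cell_sum (c : idx) (Y : config) : R :=
  \sum_(z <- Y) \1_(cell c) z.1 * zeta (z, Y).

Lemma measurable_cell_sum c : measurable_fun setT (cell_sum c).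
Proof.
pose g (v : point * config) : R := \1_(cell c) v.1.1 * zeta v.
have mg : measurable_fun setT g.
  apply: measurable_funM; last exact: measurable_zeta.
  have mi : measurable_fun [set: space] (\1_(cell c) : space -> R).
    by apply: measurable_indic; exact: measurable_cell.
  apply: (measurableT_comp mi).
  by apply: measurableT_comp measurable_fst; exact: measurable_fst.
exact: (@measurable_sum_real _ point R _ config id g (@measurable_id _ _ _) mg).
Qed.

(** The restriction to the neighbouring cells yields exact locality, and the clamp a bound that does
    not involve the number of points. *)
Definition cell_stat c (Y : config) : R :=
  clamp K (cell_sum c (restr (region (S c)) Y)).

Lemma bmeas_cell_stat c : bmeas (cell_stat c).
Proof.
split; last by exists K => Y; exact: clamp_le.
apply: measurable_clamp.
exact: (measurableT_comp (measurable_cell_sum c) (measurable_restr R (@measurable_region R d _ M b s (S c)))).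
Qed.

Lemma cell_stat_le c Y : `|cell_stat c Y| <= K. Proof. exact: clamp_le. Qed.

Lemma cell_stat0 c Y : cell c `&` G = set0 -> cell_stat c Y = 0.
Proof.
move=> cG; rewrite /cell_stat /cell_sum big1 ?clamp_id ?normr0// => z _.
rewrite indicE; case: (boolP (_ \in _)); rewrite ?mul0r// inE mul1r => cz.
rewrite /zeta /patch memNset ?mul0r//= => Gz.
by have : (cell c `&` G) z.1 by []; rewrite cG.
Qed.

(** On a good configuration no truncation is active: balls of radius [s] stay within neighbouring
    cells, scores are at most [L] and are determined in the ball, and a cell with at most [N] points
    has a sum of at most [F * L * N <= K]. *)
Lemma sum_cell_stat (A : set space) (N : R) (X : config) :
  (forall x, A x -> forall i, `|x ord0 i| < b) ->
  (forall z, z \in X -> A z.1) ->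
  (forall z, z \in X -> ~ bad xs s L (z, X)) ->
  (forall c : idx, (npoints X (@fst space M @^-1` cell c))%:R <= N) ->
  F * L * N <= K -> G `<=` A ->
  \sum_(z <- X | z.1 \in G) f z.1 * xs (z, X) = \sum_(c : idx) cell_stat c X.
Proof.
move=> Ab XA Xb XN FLN GA.
have cov z : z \in X -> exists c : idx, cell c z.1.
  by move=> zX; apply: cell_cover => //; apply: Ab; exact: XA.
have cutE c z : z \in X -> cell c z.1 -> cut s z (restr (region (S c)) X) = cut s z X.
  move=> zX cz; apply/fsetP => y; rewrite !inE /=.
  case: (boolP (y \in X)) => //= yX.
  case: (boolP (y.1 \in eball z.1 s%:E)); rewrite ?andbF// inE => zy.
  rewrite andbT; apply/asboolP; have [c' c'y] := cov _ yX.
  by exists c' => //; exact: (ball_cells_within s_gt0 cz c'y zy).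
have zetaE z : z \in X -> zeta (z, X) = (f \_ G) z.1 * xs (z, X).
  move=> zX; have /not_orP[/contrapT h1 /negP] := Xb _ zX; rewrite -leNgt => h2.
  by rewrite /zeta /= -h1 indicE mem_set//= mul1r.
have stat c : cell_stat c X = \sum_(z <- X) \1_(cell c) z.1 * ((f \_ G) z.1 * xs (z, X)).
  have E : cell_sum c (restr (region (S c)) X) =
      \sum_(z <- X) \1_(cell c) z.1 * ((f \_ G) z.1 * xs (z, X)).
    rewrite /cell_sum {1}/restr -big_fset_condE/= big_seq_cond [RHS]big_seq [LHS]big_mkcond [RHS]big_mkcond /=.
    apply: eq_bigr => z _; case: (boolP (z \in X)) => //= zX.
    rewrite indicE; case: (boolP (z.1 \in cell c)); rewrite ?mul0r ?if_same// inE => cz.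
    rewrite mem_set/=; last by exists c => //; exact: cells_within_refl.
    by rewrite -zetaE// /zeta /= cutE.
  rewrite /cell_stat E clamp_id//.
  apply: le_trans FLN; apply: le_trans (ler_norm_sum _ _ _) _.
  apply: (@le_trans _ _ (\sum_(z <- X) \1_(@fst space M @^-1` cell c) z * (F * L))).
    rewrite big_seq [leRHS]big_seq; apply: ler_sum => z zX.
    rewrite normrM -zetaE//; apply: ler_pM => //; last exact: zeta_le.
    by rewrite !indicE ger0_norm.
  by rewrite -mulr_suml -npoints_sum mulrC ler_wpM2l// mulr_ge0.
rewrite [RHS](eq_bigr _ (fun c _ => stat c)) [RHS]exchange_big /= big_mkcond /= big_seq [RHS]big_seq; apply: eq_bigr => z zX.
have [c cz] := cov _ zX.
rewrite (bigD1 c)//= big1 ?addr0.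
  rewrite indicE (mem_set cz) mul1r /patch.
  by case: ifP => _; rewrite ?mul0r.
move=> c' c'c; rewrite indicE memNset ?mul0r// => c'z.
by move/eqP: c'c; apply; exact: cell_inj c'z cz.
Qed.

End cell_sums.

(** * The central limit theorem for one set *)

Section single_clt.
Context d (Omega : measurableType d) (R : realType) (P : probability Omega R).
Local Notation Ex := (Ex P).
Local Notation Phi := (@std_normal_cdf R).
Context (V : finType) (dep : {set V} -> (Omega -> R) -> Prop).
Hypothesis hdep : independent_system P dep.
Context (S : V -> {set V}) (Y : V -> Omega -> R) (B D : R) (JI JB : {set V}).
Hypothesis depY : forall c, dep (S c) (Y c).
Hypothesis Y_le : forall c w, `|Y c w| <= B.
Hypothesis EY0 : forall c, Ex (Y c) = 0.
Hypothesis D_ge1 : 1 <= D.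
Hypothesis D1 : forall c, #|interacting S c|%:R <= D.
Hypothesis D2 : forall c, #|interacting (second_nbhd S) c|%:R <= D.
Hypothesis B_gt0 : 0 < B.
Context (T : Omega -> R) (a q Q h : R) (Bad : set Omega).
Hypothesis hT : fourth_moment P T.
Hypothesis mBad : measurable Bad.
Local Notation SI := (locsum Y JI).
Local Notation SB := (locsum Y JB).
Hypothesis TB : forall w, ~ Bad w -> T w = a + SI w + SB w.
Hypothesis PBad : fine (P Bad) <= q.
Hypothesis D4 : (\int[P]_w ((T w - (a + SI w + SB w)) ^+ 4)%:E <= Q%:E)%E.
Hypothesis h_gt0 : 0 < h.
(* The scale parameters are [l], [z = l ^ (1 / 2d)] and a small power [y] of [l]. *)
Context (l y z p : R) (n : nat).
Hypotheses (y_ge1 : 1 <= y) (z_ge1 : 1 <= z) (zl : z ^+ 2 <= l) (p_ge1 : 1 <= p).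
Hypothesis ly : l <= y ^+ n.*2.
Context (c C1 C2 C3 C4 C5 : R).
Hypotheses (c_gt0 : 0 < c) (C1_ge0 : 0 <= C1) (C2_ge0 : 0 <= C2) (C3_ge0 : 0 <= C3)
  (C4_ge0 : 0 <= C4) (C5_ge0 : 0 <= C5).
Local Notation v := (fine 'V_P[T]).
Hypothesis v_ge : c * l <= v.
Hypothesis JI_le : #|JI|%:R * B ^+ 2 <= C1 * p ^+ 2 * l.
Hypothesis JB_le : #|JB|%:R * (D * B) ^+ 2 <= C2 * p ^+ 2 * (l / z ^+ 2).
Hypothesis DB_le : (D * B) ^+ 2 <= C2 * p ^+ 2 * (l / z ^+ 2).
Hypothesis B_le : B <= C3 * p.
Hypothesis hQ_le : h * Q + q / h <= C4 / l.
Hypothesis q_le : q <= C5 / z.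

(** Constants, in this order, for: the relative error of the variance, the size of a normalized
    summand, their number times the squared bound, the tail of the boundary sum, and the shift of
    the mean. The three groups in [clt_cst] bound the normal approximation, the exceptional
    probability and the perturbation in units of [sigma]. *)
Definition rho_cst : R := 1 + 12 * (C2 + C4) / c.
Definition step_cst : R := C3 * (1 + c^-1).
Definition sum_cst : R := 1 + C1 / c.
Definition tail_cst : R := moment_cst R n * (C2 / c) ^+ n.
Definition shift_cst : R := 1 + C4 / c.
Definition clt_cst : R :=
  (4 * rho_cst + 52 * sum_cst * D ^+ 4 * step_cst) + (C5 + tail_cst) + (1 + shift_cst).
Local Notation sigma := (Num.sqrt v).
Local Notation mE := (C2 * p ^+ 2 * (l / z ^+ 2)).

Let z_gt0 : 0 < z. Proof. exact: lt_le_trans z_ge1. Qed.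
Let y_gt0 : 0 < y. Proof. exact: lt_le_trans y_ge1. Qed.
Let p_gt0 : 0 < p. Proof. exact: lt_le_trans p_ge1. Qed.
Let D_gt0 : 0 < D. Proof. exact: lt_le_trans D_ge1. Qed.
Let l_gt0 : 0 < l. Proof. by apply: lt_le_trans zl; rewrite exprn_gt0. Qed.
Let l_ge1 : 1 <= l. Proof. by apply: le_trans zl; rewrite exprn_ege1. Qed.
Let v_gt0 : 0 < v. Proof. by apply: lt_le_trans v_ge; rewrite mulr_gt0. Qed.
Let sigma_gt0 : 0 < sigma. Proof. by rewrite sqrtr_gt0. Qed.
Let sigma2 : sigma ^+ 2 = v. Proof. by rewrite sqr_sqrtr// ltW. Qed.
Let bSI : bmeas SI. Proof. exact: (bmeas_locsum hdep JI depY). Qed.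
Let bSB : bmeas SB. Proof. exact: (bmeas_locsum hdep JB depY). Qed.
Let mE0 : 0 <= mE. Proof. by apply: le_trans DB_le; exact: sqr_ge0. Qed.

Let E0 (J : {set V}) : Ex (locsum Y J) = 0.
Proof.
rewrite /locsum Ex_sum ?big1// => i _; exact: (bmeas_locX hdep depY).
Qed.

Let SB_moment k : Ex (fun w => SB w ^+ k.*2) <= moment_cst R k * mE ^+ k.
Proof.
apply: (locsum_moment hdep depY Y_le EY0 D1) => //.
apply: le_trans JB_le; rewrite -mulrA; apply: ler_wpM2l => //.
rewrite (_ : B * (D * B) = D * B ^+ 2); last by ring.
rewrite exprMn ler_pM2r ?exprn_gt0//.
by rewrite expr2 ler_peMl// ltW.
Qed.

(** From [z ^+ 2 <= l] and [c * l <= v]; the factor [1 + c^-1] is a root-free majorant of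
    c^(-1/2). *)
Let sigma_z : 1 <= (1 + c^-1) * sigma / z.
Proof.
rewrite ler_pdivlMr// mul1r.
have h1 : 0 <= (1 + c^-1) * sigma.
  by rewrite mulr_ge0 ?(ltW sigma_gt0)// addr_ge0// invr_ge0 ltW.
rewrite -(@ler_pXn2r _ 2)// ?nnegrE ?(ltW z_gt0)//.
rewrite exprMn sigma2; apply: le_trans zl _.
have : c * l * (1 + c^-1) ^+ 2 <= v * (1 + c^-1) ^+ 2 by rewrite ler_wpM2r ?sqr_ge0.
rewrite mulrC [leLHS]mulrC mulrC => h2; rewrite mulrC; apply: le_trans h2.
have -> : (1 + c^-1) ^+ 2 * (c * l) = l * (2 * (c * c^-1) + c + c^-1 * (c * c^-1)) by ring.
rewrite mulfV ?gt_eqF// ler_peMr ?(ltW l_gt0)//.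
have : 0 < c^-1 by rewrite invr_gt0.
by move: c_gt0; lra.
Qed.

Lemma rho_le : `|1 - Ex (fun w => SI w ^+ 2) / v| <= rho_cst * p ^+ 2 / z.
Proof.
(* The boundary sum has relative variance of order z^(-2) up to powers of [p], so [e = z^-1] in
   [variance_comparison] balances e against e^(-1) z^(-2). *)
have z1 : 0 < z^-1 by rewrite invr_gt0.
have := variance_comparison hT bSI bSB (E0 JI) (E0 JB) mBad TB PBad D4 h_gt0 z1.
rewrite invrK => hv.
have M1 : Ex (fun w => SB w ^+ 2) <= 2 * mE.
  by have := SB_moment 1; rewrite /= expr1 expr0 mulr1 mul1r.
set E2 := Ex (fun w => SB w ^+ 2) in hv M1.
have p2 : 1 <= p ^+ 2 by rewrite exprn_ege1.
have -> : 1 - Ex (fun w => SI w ^+ 2) / v = (v - Ex (fun w => SI w ^+ 2)) / v.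
  by rewrite mulrBl divff// gt_eqF.
rewrite normrM normfV (gtr0_norm v_gt0) ler_pdivrMr//.
apply: le_trans hv _.
have h1 : (1 + z) * (3 * E2 + 6 * (h * Q + q / h)) <= 2 * z * (6 * mE + 6 * (C4 / l)).
  apply: (@le_trans _ _ ((1 + z) * (6 * mE + 6 * (C4 / l)))).
    apply: ler_wpM2l; first by rewrite addr_ge0// ltW.
    by move: hQ_le M1; lra.
  apply: ler_wpM2r; last by move: z_ge1; lra.
  by rewrite addr_ge0// mulr_ge0// divr_ge0// ltW.
have h2 : 2 * z * (6 * mE + 6 * (C4 / l)) <= 12 * (C2 + C4) * p ^+ 2 / z * l.
  have -> : 2 * z * (6 * mE + 6 * (C4 / l)) = 12 * (C2 * p ^+ 2 * l / z) + 12 * (C4 * (z / l)).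
    by field; rewrite !gt_eqF.
  have -> : 12 * (C2 + C4) * p ^+ 2 / z * l = 12 * (C2 * p ^+ 2 * l / z) + 12 * (C4 * (p ^+ 2 * l / z)).
    by field; rewrite gt_eqF.
  rewrite lerD2l ler_pM2l//; apply: ler_wpM2l => //.
  rewrite ler_pdivlMr// mulrAC ler_pdivrMr//.
  rewrite -expr2; apply: le_trans zl _; rewrite -[leLHS]mulr1.
  by apply: ler_pM => //; rewrite ?(ltW l_gt0)// ler_peMl// ltW.
have h3 : 12 * (C2 + C4) * p ^+ 2 / z * l <= 12 * (C2 + C4) / c * p ^+ 2 / z * v.
  have -> : 12 * (C2 + C4) * p ^+ 2 / z * l = 12 * (C2 + C4) / c * p ^+ 2 / z * (c * l).
    by field; rewrite !gt_eqF.
  apply: ler_wpM2l => //; rewrite divr_ge0 ?(ltW z_gt0)// mulr_ge0 ?sqr_ge0//.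
  by rewrite divr_ge0 ?(ltW c_gt0)// mulr_ge0// addr_ge0.
have h4 : z^-1 * v <= p ^+ 2 / z * v.
  by rewrite ler_pM2r// ler_peMl// ltW.
have -> : rho_cst * p ^+ 2 / z * v = p ^+ 2 / z * v + 12 * (C2 + C4) / c * p ^+ 2 / z * v.
  by rewrite /rho_cst; ring.
by move: h1 h2 h3 h4; lra.
Qed.

Lemma step_le : B / sigma <= step_cst * p / z.
Proof.
rewrite ler_pdivrMr//; apply: le_trans B_le _.
have -> : step_cst * p / z * sigma = C3 * p * ((1 + c^-1) * sigma / z) by rewrite /step_cst; ring.
by rewrite ler_peMr// mulr_ge0// ltW.
Qed.

Lemma sum_le : #|JI|%:R * (B / sigma) ^+ 2 <= sum_cst * p ^+ 2.
Proof.
rewrite exprMn exprVn sigma2 mulrA ler_pdivrMr//.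
apply: le_trans JI_le _; rewrite /sum_cst mulrDl mul1r mulrDl.
have : C1 * p ^+ 2 * l <= C1 / c * p ^+ 2 * v.
  have -> : C1 * p ^+ 2 * l = C1 / c * p ^+ 2 * (c * l) by field; rewrite gt_eqF.
  by apply: ler_wpM2l => //; rewrite mulr_ge0 ?sqr_ge0// divr_ge0// ltW.
have : 0 <= p ^+ 2 * v by rewrite mulr_ge0 ?sqr_ge0// ltW.
lra.
Qed.

Lemma interior_clt (t : R) : rho_cst * p ^+ 2 / z <= 1 -> step_cst * p / z <= 1 ->
  `|fine (P [set w | SI w <= t * sigma]) - Phi t| <=
   (4 * rho_cst + 52 * sum_cst * D ^+ 4 * step_cst) * (p ^+ 3 / z).
Proof.
move=> r1 s1.
pose Y' c w := sigma^-1 * Y c w.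
have depY' k : dep (S k) (Y' k) by apply: (depM hdep) => //; exact: (dep_cst hdep).
have b' : 0 < B / sigma by rewrite divr_gt0.
have Y'_le k w : `|Y' k w| <= B / sigma.
  by rewrite normrM gtr0_norm ?invr_gt0// mulrC ler_pM2r ?invr_gt0.
have EY' k : Ex (Y' k) = 0.
  by rewrite /Y' ExZ ?EY0 ?mulr0//; exact: (bmeas_locX hdep depY).
have C1c : 0 <= C1 / c by rewrite divr_ge0// ltW.
have K1 : 1 <= sum_cst * p ^+ 2.
  rewrite /sum_cst mulrDl mul1r; have : 1 <= p ^+ 2 by rewrite exprn_ege1.
  by have : 0 <= C1 / c * p ^+ 2 by [rewrite mulr_ge0 ?sqr_ge0//]; lra.
have b1 : B / sigma <= 1 by apply: le_trans step_le s1.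
have SE w : locsum Y' JI w = sigma^-1 * SI w by rewrite /locsum mulr_sumr.
have vE : Ex (fun w => locsum Y' JI w ^+ 2) = Ex (fun w => SI w ^+ 2) / v.
  under eq_fun do rewrite SE exprMn exprVn sigma2.
  have b2 : bmeas (fun w => SI w ^+ 2) by exact: bmeasX.
  by rewrite (ExZ P _ b2) mulrC.
have := @local_berry_esseen _ _ _ P _ _ hdep S Y' (B / sigma) D (sum_cst * p ^+ 2) JI
  depY' Y'_le EY' D2 b' b1 D_ge1 K1 sum_le t.
rewrite vE (_ : [set w | _] = [set w | SI w <= t * sigma]); last first.
  by apply/seteqP; split=> w /=; rewrite SE [sigma^-1 * _]mulrC ler_pdivrMr.
have rho := rho_le.
move=> /(_ _)/le_trans; apply.
  have := le_trans rho r1; rewrite ler_norml => /andP[]; lra.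
rewrite [leRHS]mulrDl; apply: lerD.
  have : rho_cst * p ^+ 2 / z <= rho_cst * (p ^+ 3 / z).
    rewrite -mulrA; apply: ler_wpM2l; last by rewrite ler_pM2r ?invr_gt0// ler_weXn2l.
    by rewrite /rho_cst addr_ge0// divr_ge0 ?(ltW c_gt0)// mulr_ge0// addr_ge0.
  by move: rho; lra.
rewrite [leRHS](_ : _ = 52 * (sum_cst * p ^+ 2) * D ^+ 4 * (step_cst * p / z)); last by ring.
apply: ler_wpM2l; last exact: step_le.
by rewrite mulr_ge0 ?exprn_ge0 ?(ltW D_gt0)// mulr_ge0// (le_trans _ K1).
Qed.

(** Markov's inequality of order 2n: the moment bound and the threshold cancel except for the factor
    y^(-2n), and [y ^+ n.*2] is at least [l], hence at least [z]. This is the purpose of the extra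
    factor [y] in the threshold. *)
Lemma boundary_tail :
  fine (P [set w | y * p / z * sigma < `|SB w|]) <= tail_cst / z.
Proof.
have u0 : 0 < y * p / z * sigma by rewrite !mulr_gt0// invr_gt0.
apply: le_trans (markov_even P n bSB u0) _; rewrite ler_pdivrMr ?exprn_gt0//.
apply: le_trans (SB_moment n) _; set U := _ ^+ n.*2.
have -> : tail_cst / z * U = moment_cst R n * ((C2 / c) ^+ n * (z^-1 * U)).
  by rewrite /tail_cst; ring.
apply: ler_wpM2l; first exact: moment_cst_ge0.
have -> : U = y ^+ n.*2 * ((p / z) ^+ 2 * v) ^+ n.
  rewrite /U -!mulrA exprMn; congr (_ * _); rewrite -mul2n exprM; congr (_ ^+ n).
  by rewrite !exprMn sigma2; ring.
apply: (@le_trans _ _ ((C2 / c) ^+ n * ((p / z) ^+ 2 * v) ^+ n)).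
  rewrite -exprMn; apply: lerXn2r; rewrite ?nnegrE//.
    by rewrite mulr_ge0// ?divr_ge0// ?(ltW c_gt0)// mulr_ge0 ?sqr_ge0// ltW.
  have -> : mE = C2 / c * ((p / z) ^+ 2 * (c * l)).
    by field; rewrite !gt_eqF.
  apply: ler_wpM2l; first by rewrite divr_ge0// ltW.
  by apply: ler_wpM2l; rewrite ?sqr_ge0.
apply: ler_wpM2l; first by rewrite exprn_ge0// divr_ge0// ltW.
rewrite mulrA; apply: ler_peMl; first by rewrite exprn_ge0// mulr_ge0 ?sqr_ge0// ltW.
rewrite mulrC ler_pdivlMr// mul1r; apply: le_trans ly; apply: le_trans zl.
by rewrite expr2 ler_peMl// ltW.
Qed.

Lemma single_clt : clt_cst * ((y * p) ^+ 3 / z) <= 1 ->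
  exists Bad' : set Omega, [/\ measurable Bad',
    fine (P Bad') <= clt_cst * ((y * p) ^+ 3 / z),
    (forall w, ~ Bad' w -> `|T w - fine 'E_P[T] - SI w| <=
        clt_cst * ((y * p) ^+ 3 / z) * sigma) &
    forall t : R, `|fine (P [set w | SI w <= t * sigma]) - Phi t| <=
        clt_cst * ((y * p) ^+ 3 / z)].
Proof.
have hC5 := C5_ge0; set r := _ / z => Cr.
have yp1 : 1 <= y * p by rewrite -[leLHS]mulr1; apply: ler_pM.
have r0 : 0 < r by rewrite divr_gt0// exprn_gt0// mulr_gt0.
have zr : z^-1 <= r by rewrite /r ler_peMl ?invr_ge0 ?(ltW z_gt0)// exprn_ege1.
have pyp : p <= y * p by rewrite ler_peMl// ltW.
have p3r : p ^+ 3 / z <= r.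
  by rewrite /r ler_pM2r ?invr_gt0//; apply: lerXn2r; rewrite ?nnegrE// ltW// mulr_gt0.
have p2r : p ^+ 2 / z <= r.
  by apply: le_trans p3r; rewrite ler_pM2r ?invr_gt0// ler_weXn2l.
have p1r : p / z <= r.
  by apply: le_trans p3r; rewrite ler_pM2r ?invr_gt0// -[leLHS]expr1 ler_weXn2l.
have ypr : y * p / z <= r.
  by rewrite /r ler_pM2r ?invr_gt0// -[leLHS]expr1 ler_weXn2l.
have rho0 : 1 <= rho_cst.
  by rewrite /rho_cst lerDl divr_ge0 ?(ltW c_gt0)// mulr_ge0// addr_ge0.
have sum1 : 1 <= sum_cst by rewrite /sum_cst lerDl divr_ge0// ltW.
have step0 : 0 <= step_cst by rewrite /step_cst mulr_ge0// addr_ge0// invr_ge0 ltW.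
have tail0 : 0 <= tail_cst.
  by rewrite /tail_cst mulr_ge0 ?moment_cst_ge0// exprn_ge0// divr_ge0// ltW.
have shift1 : 1 <= shift_cst by rewrite /shift_cst lerDl divr_ge0// ltW.
have D4' : 1 <= D ^+ 4 by rewrite exprn_ege1.
have be0 : step_cst <= 52 * sum_cst * D ^+ 4 * step_cst.
  rewrite ler_peMl// -[leLHS]mulr1; apply: ler_pM => //.
  by move: sum1; lra.
have leC x : x <= clt_cst -> x * r <= clt_cst * r by rewrite ler_pM2r.
have c1 : rho_cst * p ^+ 2 / z <= 1.
  apply: le_trans Cr; rewrite -mulrA; apply: (@le_trans _ _ (rho_cst * r)).
    by rewrite ler_pM2l// (lt_le_trans _ rho0).
  by apply: leC; rewrite /clt_cst; lra.
have c2 : step_cst * p / z <= 1.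
  apply: le_trans Cr; rewrite -mulrA; apply: (@le_trans _ _ (step_cst * r)).
    by rewrite ler_wpM2l.
  by apply: leC; rewrite /clt_cst; lra.
pose Bt := [set w | y * p / z * sigma < `|SB w|].
have mBt : measurable Bt.
  have [mSB _] := bSB; have mn : measurable_fun setT (fun w => `|SB w|) by exact: measurableT_comp.
  have := mn measurableT _ (measurable_itv `]y * p / z * sigma, +oo[); rewrite setTI.
  by congr measurable; apply/seteqP; split=> w /=; rewrite in_itv/= andbT.
exists (Bad `|` Bt); split.
- exact: measurableU.
- have : (P (Bad `|` Bt) <= P Bad + P Bt)%E by exact: measureU2.
  rewrite -[P Bad]fineK ?fin_num_measure// -[P Bt]fineK ?fin_num_measure// -EFinD.
  rewrite -[P (_ `|` _)]fineK ?fin_num_measure ?lee_fin//; last exact: measurableU.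
  move=> /le_trans; apply.
  apply: (@le_trans _ _ ((C5 + tail_cst) * r)); last by apply: leC; rewrite /clt_cst; lra.
  rewrite mulrDl; apply: lerD.
    by apply: le_trans PBad _; apply: le_trans q_le _; rewrite ler_wpM2l.
  by apply: le_trans boundary_tail _; rewrite ler_wpM2l.
- move=> w /not_orP[nB /negP]; rewrite -leNgt => sb.
  rewrite TB// fine_expectation.
  have m2 := mean_error_sqr_le hT bSI bSB (E0 JI) (E0 JB) mBad TB PBad D4 h_gt0.
  have mu : `|Ex T - a| <= shift_cst / z * sigma.
    rewrite -(@ler_pXn2r _ 2)// ?nnegrE ?real_normK ?num_real//; last first.
      by rewrite mulr_ge0 ?divr_ge0// ?(ltW sigma_gt0)// ?(ltW z_gt0)// (le_trans _ shift1).
    apply: le_trans m2 _; apply: le_trans hQ_le _.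
    rewrite exprMn sigma2; apply: (@le_trans _ _ C4).
      by rewrite ler_pdivrMr// ler_peMr.
    apply: (@le_trans _ _ ((shift_cst / z) ^+ 2 * (c * l))); last by rewrite ler_wpM2l// sqr_ge0.
    rewrite exprMn exprVn.
    have -> : shift_cst ^+ 2 * (z ^+ 2)^-1 * (c * l) = shift_cst ^+ 2 * c * (l / z ^+ 2) by ring.
    apply: (@le_trans _ _ (shift_cst ^+ 2 * c)); last first.
      have lz : 1 <= l / z ^+ 2 by rewrite ler_pdivlMr ?exprn_gt0// mul1r.
      by rewrite ler_peMr// mulr_ge0 ?sqr_ge0// ltW.
    have -> : shift_cst ^+ 2 * c = c + 2 * C4 + C4 * (C4 / c).
      by rewrite /shift_cst; field; rewrite gt_eqF.
    have : 0 <= C4 * (C4 / c) by rewrite mulr_ge0// divr_ge0// ltW.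
    by move: c_gt0 C4_ge0; lra.
  have -> : a + SI w + SB w - Ex T - SI w = SB w - (Ex T - a) by ring.
  apply: le_trans (ler_normB _ _) _.
  apply: (@le_trans _ _ ((1 + shift_cst) * r * sigma)); last first.
    by rewrite ler_pM2r//; apply: leC; rewrite /clt_cst; move: be0 rho0 step0 tail0 C5_ge0; lra.
  have : y * p / z * sigma <= r * sigma by rewrite ler_pM2r.
  have : shift_cst / z * sigma <= shift_cst * r * sigma.
    by rewrite ler_pM2r// ler_wpM2l// (le_trans _ shift1).
  by move: mu sb; rewrite mulrDl mul1r mulrDl; lra.
- move=> t; apply: le_trans (interior_clt t c1 c2) _.
  apply: (@le_trans _ _ ((4 * rho_cst + 52 * sum_cst * D ^+ 4 * step_cst) * r)).
    by apply: ler_wpM2l => //; move: be0 rho0 step0; lra.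
  by apply: leC; rewrite /clt_cst; lra.
Qed.

End single_clt.

(** * Uniform estimates for the model *)

Lemma fin_union_bound d (Omega : measurableType d) (R : realType) (P : probability Omega R)
    (I : finType) (E : I -> set Omega) (q : R) : (forall i, measurable (E i)) ->
  (forall i, fine (P (E i)) <= q) ->
  measurable [set w | exists i, E i w] /\ fine (P [set w | exists i, E i w]) <= #|I|%:R * q.
Proof.
move=> mE hq; have mU : measurable [set w | exists i, E i w].
  rewrite (_ : [set w | _] = \bigcup_(i in [set: I]) E i); last first.
    by apply/seteqP; split=> w /= [i]; [exists i|exists i].
  by apply: fin_bigcup_measurable => [|i _]; [exact: finite_finset|exact: mE].
have bI (A : set Omega) : measurable A -> bmeas (\1_A : Omega -> R).
  move=> mA; split; first exact: measurable_indic.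
  by exists 1 => w; rewrite indicE; case: (_ \in _); rewrite ?normr0 ?normr1.
split => //; rewrite -Ex_indic//.
apply: (@le_trans _ _ (Ex P (fun w => \sum_(i : I) \1_(E i) w))).
  apply: Ex_le; [exact: bI|by apply: bmeas_sum => i _; exact: bI|move=> w].
  rewrite [leLHS]indicE; case: (boolP (_ \in _)) => [|_]; last by rewrite sumr_ge0.
  rewrite inE => -[i Ei]; rewrite (bigD1 i)//= indicE mem_set// lerDl sumr_ge0//.
rewrite Ex_sum; last by move=> i _; exact: bI.
apply: (@le_trans _ _ (\sum_(i : I) q)); last by rewrite sumr_const mulr_natl.
by apply: ler_sum => i _; rewrite Ex_indic.
Qed.

Section model.
Context (R : realType) (d : nat) (d_gt0 : (0 < d)%N).
Context (dM : measure_display) (M : measurableType dM) (PM : probability M R).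
Context (xi : 'rV[R]_d -> M -> {fset ('rV[R]_d * M)} -> {nonneg R}).
Hypothesis xi_meas : measurable_functional xi.
Context (kappa : 'rV[R]_d -> R) (A : set 'rV[R]_d).
Hypothesis kappa_meas : measurable_fun setT kappa.
Hypothesis kappa_ge0 : forall x, 0 <= kappa x.
Hypothesis kappa_int1 : (\int[lebesgue_rV R d]_x (kappa x)%:E = 1)%E.
Context (Kk : R).
Hypothesis kappa_le : forall x, kappa x <= Kk.
Hypothesis A_support : A = closure [set x | kappa x != 0].
Hypothesis A_compact : compact A.
Context (dO : measure_display) (Omega : measurableType dO) (P : probability Omega R).
Context (PP : R -> {RV P >-> {fset ('rV[R]_d * M)}}).
Hypothesis PP_poisson : forall l, 0 < l -> poisson_process (intensity PM kappa l) (PP l).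
Context (U : {RV P >-> M}).
Hypothesis U_law : forall B, measurable B -> distribution P U B = PM B.
Hypothesis U_indep : forall l, 0 < l -> independent_RV U (PP l).
Hypothesis xi_stab : exponentially_stabilizing xi PP U A.
Hypothesis xi_moments : forall p : R, 1 <= p -> has_moment xi PP U A p.
Local Notation Ex := (Ex P).
Local Notation point := ('rV[R]_d * M)%type.
Local Notation config := {fset ('rV[R]_d * M)}.

Lemma measurable_support : measurable A.
Proof.
rewrite -[A]setCK; apply: measurableC; apply: open_measurable_rV.
by apply: closed_openC; rewrite A_support; exact: closed_closure.
Qed.

Lemma support_bounded : exists2 b : R, 0 < b & forall x, A x -> forall i, `|x ord0 i| < b.
Proof.
have [b0 [_ hb]] := compact_bounded A_compact.
exists (`|b0| + 2); first by rewrite ltr_wpDl.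
move=> x Ax i; apply: le_lt_trans (coord_le_norm x i) _.
have h : b0 < `|b0| + 1 by rewrite (le_lt_trans (ler_norm _))// ltrDl.
by apply: le_lt_trans (hb _ h x Ax) _; rewrite ltrD2l ltr1n.
Qed.

Lemma kappa_bound_gt0 : 0 <= Kk.
Proof. exact: le_trans (kappa_ge0 0) (kappa_le 0). Qed.

(** The intensity, a bare set function, is presented as the product of a finite measure and the mark
    law, to which the results on Poisson processes apply. Atomlessness makes insertion effective
    almost surely, and the bound by Lebesgue measure controls the mean count of a cell. *)
Lemma poisson_intensity l : 0 < l -> exists nu : {finite_measure set 'rV[R]_d -> \bar R},
  [/\ poisson_process (finite_prod nu PM) (PP l),
      (forall x, nu [set x] = 0%E), nu (~` A) = 0%E, nu setT = l%:E &
      forall B, measurable B -> (nu B <= (l * Kk)%:E * lebesgue_rV R d B)%E].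
Proof.
move=> l0.
have mk : measurable_fun setT (fun x => l * kappa x) by exact: measurable_funM.
have k0 x : 0 <= l * kappa x by rewrite mulr_ge0// ltW.
have kT : (\int[lebesgue_rV R d]_x (l * kappa x)%:E = l%:E)%E.
  under eq_integral do rewrite EFinM.
  rewrite ge0_integralZl//; [by rewrite kappa_int1 mule1|exact/measurable_EFinP| |].
  - by move=> x _; rewrite lee_fin.
  - by rewrite lee_fin ltW.
have kfin : (\int[lebesgue_rV R d]_x (l * kappa x)%:E < +oo)%E by rewrite kT ltry.
pose nu := @density_fmeasure _ _ _ (lebesgue_rV R d) _ mk k0 kfin.
have bound B : measurable B -> (nu B <= (l * Kk)%:E * lebesgue_rV R d B)%E.
  move=> mB; rewrite /nu /density_fmeasure /= /density_measure -integral_cst//.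
  apply: ge0_le_integral => //.
  - by move=> x _; rewrite lee_fin.
  - by apply/measurable_EFinP; exact: measurable_funTS.
  - by move=> x _; rewrite lee_fin ler_pM2l.
exists nu; split => //.
- exact: PP_poisson.
- move=> x; apply/eqP; rewrite eq_le measure_ge0 andbT.
  apply: le_trans (bound _ (measurable_rV_set1 x)) _.
  by rewrite lebesgue_rV_set1// mule0.
- rewrite /nu /density_fmeasure /= /density_measure integral0_eq// => x nAx.
  congr EFin; apply/eqP; rewrite mulf_eq0; apply/orP; right.
  apply: contrapT => /negP kx; apply: nAx; rewrite A_support.
  exact: subset_closure.
Qed.

Lemma uniform_moment n : (0 < n)%N -> exists2 C : R, 0 <= C & forall l x, 1 <= l -> A x ->
  (\int[P]_w ((xi_scaled xi l x (U w) (PP l w))%:num ^+ n)%:E <= C%:E)%E.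
Proof.
move=> n0; have n1 : 1 <= n%:R :> R by rewrite ler1n.
have := xi_moments n1; rewrite /has_moment; set s := ereal_sup _ => s_fin.
have le_s l x : 1 <= l -> A x ->
    (\int[P]_w ((xi_scaled xi l x (U w) (PP l w))%:num ^+ n)%:E <= s)%E.
  move=> l1 Ax; apply: ereal_sup_ubound; exists (l, x) => //=.
  rewrite unlock; apply: eq_integral => w _; congr EFin.
  by rewrite ger0_norm// powR_mulrn.
(* A supremum over no pairs would be -oo, not a finite number; this case is set apart. *)
have [e|ne] := pselect (exists p : R * 'rV[R]_d, 1 <= p.1 /\ A p.2); last first.
  by exists 0 => // l x l1 Ax; case: ne; exists (l, x).
have s0 : (0 <= s)%E.
  case: e => -[l x] [l1 Ax]; apply: le_trans (le_s l x l1 Ax).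
  by apply: integral_ge0 => w _; rewrite lee_fin exprn_ge0.
exists (fine s); first exact: fine_ge0.
by move=> l x l1 Ax; rewrite fineK ?ge0_fin_numE//; exact: le_s.
Qed.

Lemma stabilization_tail : exists c t0 : R, [/\ 0 < c, 0 < t0 &
  forall t l x, t0 < t -> 1 <= l -> A x ->
  exists2 rad, stabilization_radius xi PP U A l x rad &
     (P [set w | t%:E < rad w] <= (expR (- (c * t)))%:E)%E].
Proof.
case: xi_stab => rad [hrad /exp_tail_of_limf_esup[c [t0 [c0 t00 h]]]].
exists c, t0; split => // t l x tt0 l1 Ax; exists (rad l x); first exact: hrad.
have le_s := @ereal_sup_ubound _ [set P [set w | (t%:E < rad p.1 p.2 w)%E] |
  p in [set p : R * 'rV[R]_d | (1 <= p.1)%R /\ A p.2]] (P [set w | (t%:E < rad l x w)%E]).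
have {}le_s := le_s (ex_intro2 _ _ (l, x) (conj l1 Ax) erefl).
have le_s2 := le_s; apply: le_trans le_s2 _; apply: h => //.
by apply: le_trans le_s.
Qed.

(** The inequality exp(-u) <= 1/u at u = c y / (k + 1), raised to the power k; dividing by k + 1
    instead of k covers k = 0. *)
Lemma expR_neg_le (c : R) k : 0 < c -> exists2 C : R, 0 <= C &
  forall y : R, 0 < y -> expR (- (c * y)) <= C / y ^+ k.
Proof.
move=> c0; exists ((k.+1)%:R ^+ k / c ^+ k) => [|y y0].
  by rewrite divr_ge0// exprn_ge0// ltW.
rewrite -mulrA -invfM -exprMn -expr_div_n.
pose u := c * y / k.+1%:R.
have u0 : 0 < u by rewrite /u divr_gt0// mulr_gt0.
have -> : k.+1%:R / (c * y) = u^-1 by rewrite /u invf_div.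
have : expR (- u) <= u^-1.
  rewrite expRN lef_pV2 ?posrE ?expR_gt0//.
  by apply: le_trans (expR_ge1Dx u); rewrite lerDr.
move=> h; apply: (@le_trans _ _ (expR (- u) ^+ k)); last first.
  by apply: lerXn2r; rewrite ?nnegrE ?expR_ge0// invr_ge0 ltW.
rewrite -expRM_natl ler_expR /u mulrN lerN2.
by rewrite mulrCA -[leRHS]mulr1 ler_pM2l ?mulr_gt0// ler_pdivrMr// mul1r ler_nat.
Qed.

Lemma scaled_version : exists xs : R -> point * config -> R, forall l, 0 < l ->
  [/\ measurable_fun setT (xs l), (forall u, 0 <= xs l u) &
    forall z X, xs l (z, z |` X)%fset = (xi_scaled xi l z.1 z.2 X)%:num].
Proof.
have /choice[xs h] l : exists xs : point * config -> R, 0 < l ->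
  [/\ measurable_fun setT xs, (forall u, 0 <= xs u) &
    forall z X, xs (z, z |` X)%fset = (xi_scaled xi l z.1 z.2 X)%:num].
  have [l0|l0] := ltP 0 l; last by exists (fun=> 0).
  by have [xs h] := xi_scaled_extension l0 xi_meas; exists xs.
by exists xs.
Qed.

Context (xs : R -> point * config -> R).
Hypothesis xsP : forall l, 0 < l ->
  [/\ measurable_fun setT (xs l), (forall u, 0 <= xs l u) &
    forall z X, xs l (z, z |` X)%fset = (xi_scaled xi l z.1 z.2 X)%:num].
Context (b : R) (b_gt0 : 0 < b).
Local Notation side l y := (l `^ (- d%:R^-1) * y).

Lemma side_expr (l y : R) : 0 < l -> (side l y) ^+ d = y ^+ d / l.
Proof.
move=> l0; rewrite exprMn mulrC; congr (_ * _).
rewrite -(powR_mulrn _ (powR_ge0 _ _)) -powRrM mulNr mulVf ?pnatr_eq0 -?lt0n//.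
by rewrite powR_inv1// ltW.
Qed.

Lemma side_gt0 (l y : R) : 0 < l -> 0 < y -> 0 < side l y.
Proof. by move=> l0 y0; rewrite mulr_gt0// powR_gt0. Qed.

Lemma card_cells_le (l y : R) : 1 <= l -> 1 <= y -> side l y <= 1 ->
  #|{: {ffun 'I_d -> 'I_(grid_size b (side l y))}}|%:R <= (2 * b + 1) ^+ d * l.
Proof.
move=> l1 y1 s1; have l0 : 0 < l by exact: lt_le_trans l1.
have y0 : 0 < y by exact: lt_le_trans y1.
have := card_cells d b_gt0 (side_gt0 l0 y0) s1; rewrite side_expr//.
set N := _%:R => h.
have yd : 1 <= y ^+ d by rewrite exprn_ege1.
apply: (@le_trans _ _ (N * (y ^+ d / l) * l)).
  by rewrite mulrA divfK ?gt_eqF// ler_peMr.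
by rewrite ler_pM2r.
Qed.

(* The exponent 20 is arbitrary: it makes the contribution of the bad event to
   the mean and the variance negligible. *)
Lemma bad_event (k0 : nat) : (0 < k0)%N ->
  exists C t0 : R, [/\ 0 <= C, 0 < t0 & forall l y : R, 1 <= l -> 1 <= y -> t0 < y ->
  l <= y ^+ k0 -> side l y <= 1 ->
  exists Bad : set Omega, [/\ measurable Bad, fine (P Bad) <= C / l ^+ 20 &
    forall w, ~ Bad w -> [/\ forall z, z \in PP l w -> A z.1,
      forall z, z \in PP l w -> ~ bad (xs l) (side l y) y (z, PP l w) &
      forall c : {ffun 'I_d -> 'I_(grid_size b (side l y))},
        (npoints (PP l w) (@fst 'rV[R]_d M @^-1` cell c))%:R <= y ^+ d.+1]]].
Proof.
(* Then [l ^+ 21 <= y ^+ k]. Twenty powers are the target; one is lost to the total mass [l] of the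
   intensity, or to the number of cells, which is also of order [l]. *)
move=> k00; pose k := (21 * k0)%N.
have kp : (0 < k)%N by rewrite muln_gt0.
have [Mk Mk0 hM] := uniform_moment kp.
have [ct [t0 [ct0 t00 hs]]] := stabilization_tail.
have [Ce Ce0 he] := expR_neg_le k ct0.
pose C1 := Ce + Mk.
pose C2 := (2 * b + 1) ^+ d * (pois_moment_cst R k * (1 + Kk) ^+ k).
have Kk0 := kappa_bound_gt0; have pm0 := pois_moment_cst_ge0 R k.
have C10 : 0 <= C1 by rewrite addr_ge0.
have C20 : 0 <= C2.
  by rewrite /C2 !mulr_ge0 ?exprn_ge0 ?addr_ge0// mulr_ge0// ltW.
exists (C1 + C2), t0; split => //; first by rewrite addr_ge0.
move=> l y l1 y1 ty ly s1; set s := side l y.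
have l0 : 0 < l by exact: lt_le_trans l1.
have y0 : 0 < y by exact: lt_le_trans y1.
have s0 : 0 < s by exact: side_gt0.
have yk : l ^+ 21 <= y ^+ k.
  by rewrite /k mulnC exprM; apply: lerXn2r; rewrite ?nnegrE ?exprn_ge0// ltW.
have yk0 : 0 < y ^+ k by rewrite exprn_gt0.
have inv_yk : l / y ^+ k <= (l ^+ 20)^-1.
  have l20 : 0 < l ^+ 20 by rewrite exprn_gt0.
  rewrite ler_pdivrMr// -(@ler_pM2r _ (l ^+ 20))// mulrAC mulVf ?gt_eqF// mul1r.
  by apply: le_trans yk; rewrite [leRHS]exprS.
have [mxs xs0 xsE] := xsP l0.
have [nu [hX nu1 nuA nuT nuB]] := poisson_intensity l0.
have mA := measurable_support.
pose E0 := [set w | ~ (forall z, z \in PP l w -> A z.1)].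
pose E1 := [set w | exists2 z, z \in PP l w & A z.1 /\ bad (xs l) s y (z, PP l w)].
pose Ec (c : {ffun 'I_d -> 'I_(grid_size b s)}) :=
  [set w | y ^+ d.+1 < (npoints (PP l w) (@fst 'rV[R]_d M @^-1` cell c))%:R].
have mE0 : measurable E0 by exact: measurable_in_support.
have mE1 : measurable E1.
  by apply: measurable_exists_point => //; exact: measurable_bad.
have PE0 : fine (P E0) = 0.
  by rewrite [P E0](_ : _ = 0%E)//; exact: (poisson_in_support mA nuA hX).
have PE1 : fine (P E1) <= C1 / l ^+ 20.
  have hb : (P E1 <= nu A * (Ce / y ^+ k + Mk / y ^+ k)%:E)%E.
    apply: (bad_prob nu1 mA nuA hX U_law (U_indep l0) mxs xs0 xsE) => //.
    - exact: ltW.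
    - by rewrite divr_ge0// ltW.
    - move=> x Ax; have [rad h1 h2] := hs y l x ty l1 Ax; exists rad => //.
      by apply: le_trans h2 _; rewrite lee_fin; exact: he.
    - move=> x Ax; apply: le_trans (hM l x l1 Ax).
      exact: (inserted_moment nu1 U hX mxs xs0 xsE).
  rewrite -lee_fin fineK ?fin_num_measure//; apply: le_trans hb _.
  apply: (@le_trans _ _ (l%:E * (Ce / y ^+ k + Mk / y ^+ k)%:E)%E).
    apply: lee_wpmul2r; first by rewrite lee_fin addr_ge0// divr_ge0// ltW.
    by rewrite -nuT; apply: le_measure; rewrite ?inE.
  rewrite -EFinM lee_fin -mulrDl mulrCA; exact: ler_wpM2l.
have mcell (c : {ffun 'I_d -> 'I_(grid_size b s)}) : measurable (@fst 'rV[R]_d M @^-1` cell c : set point).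
  by rewrite -[_ @^-1` _]setTI; apply: measurable_fst => //; exact: measurable_cell.
have mN (c : {ffun 'I_d -> 'I_(grid_size b s)}) : measurable_fun setT (fun w => (npoints (PP l w) (@fst 'rV[R]_d M @^-1` cell c))%:R : R).
  by apply: measurable_npoints => //; exact: measurable_funPT.
have mEc c : measurable (Ec c).
  have := mN c measurableT _ (measurable_itv `]y ^+ d.+1, +oo[); rewrite setTI.
  by congr measurable; apply/seteqP; split=> w /=; rewrite in_itv/= andbT.
have PEc c : fine (P (Ec c)) <= pois_moment_cst R k * (1 + Kk) ^+ k / y ^+ k.
  have yd0 : 0 < y ^+ d.+1 by rewrite exprn_gt0.
  apply: le_trans (poisson_tail hX (@measurable_fresh R d dM M)
    (@fresh_notin R d dM M) (poisson_fresh nu1 hX) k (mcell c) yd0) _.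
  (* A cell has volume y^d / l, so its mean count is of order y^d. The threshold y^(d + 1) exceeds
     it by a factor [y], which the moment of order [k] turns into y^(-k). *)
  have muc : 1 + fine (finite_prod nu PM (@fst 'rV[R]_d M @^-1` cell c)) <= (1 + Kk) * y ^+ d.
    have -> : @fst 'rV[R]_d M @^-1` cell c = cell c `*` setT.
      by apply/seteqP; split=> z //= [].
    rewrite finite_prod_cyl//; last exact: measurable_cell.
    rewrite mulrDl mul1r; apply: lerD; first by rewrite exprn_ege1.
    rewrite -lee_fin fineK ?fin_num_measure//; last exact: measurable_cell.
    apply: le_trans (nuB _ (measurable_cell c)) _.
    rewrite lebesgue_cell// side_expr// -EFinM lee_fin mulrC.
    by rewrite -mulrA [X in _ <= X]mulrC ler_wpM2l ?exprn_ge0 ?(ltW y0)// mulrA mulVf ?gt_eqF// mul1r.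
  apply: (@le_trans _ _ (pois_moment_cst R k * ((1 + Kk) * y ^+ d) ^+ k / (y ^+ d.+1) ^+ k)).
    rewrite ler_pM2r ?invr_gt0 ?exprn_gt0//; apply: ler_wpM2l => //.
    apply: lerXn2r => //; rewrite ?nnegrE.
      by rewrite addr_ge0// fine_ge0.
    by rewrite mulr_ge0 ?exprn_ge0 ?addr_ge0 ?(ltW y0).
  rewrite exprMn exprS [(y * _) ^+ k]exprMn.
  rewrite (_ : _ / _ = pois_moment_cst R k * (1 + Kk) ^+ k / y ^+ k)//.
  by field; rewrite !expf_neq0 ?gt_eqF.
have [mE2 PE2] := fin_union_bound mEc PEc.
set E2 := [set w | exists i, Ec i w] in mE2 PE2.
exists (E0 `|` E1 `|` E2); split.
- by apply: measurableU => //; exact: measurableU.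
- have : (P (E0 `|` E1 `|` E2) <= P E0 + P E1 + P E2)%E.
    apply: le_trans (measureU2 _ _ _) _ => //; first exact: measurableU.
    by apply: leeD => //; exact: measureU2.
  rewrite -[P E0]fineK ?fin_num_measure// -[P E1]fineK ?fin_num_measure//.
  rewrite -[P E2]fineK ?fin_num_measure// -!EFinD.
  rewrite -[P (_ `|` _)]fineK ?fin_num_measure ?lee_fin//; last first.
    by apply: measurableU => //; exact: measurableU.
  move=> /le_trans; apply; rewrite PE0 add0r mulrDl; apply: lerD => //.
  apply: le_trans PE2 _.
  have c1 := card_cells_le l1 y1 s1.
  set pc := pois_moment_cst R k * (1 + Kk) ^+ k.
  have pc0 : 0 <= pc by rewrite mulr_ge0// exprn_ge0// addr_ge0.
  apply: (@le_trans _ _ ((2 * b + 1) ^+ d * l * (pc / y ^+ k))).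
    by apply: ler_wpM2r => //; rewrite divr_ge0// ltW.
  have -> : (2 * b + 1) ^+ d * l * (pc / y ^+ k) = C2 * (l / y ^+ k) by rewrite /C2 -/pc; ring.
  exact: ler_wpM2l.
- move=> w /not_orP[/not_orP[/contrapT h0 h1] h2]; split => //.
    by move=> z zX hb; apply: h1; exists z => //; split => //; exact: h0.
  by move=> c'; rewrite leNgt; apply/negP => h; apply: h2; exists c'.
Qed.

Hypothesis A_box : forall x, A x -> forall i, `|x ord0 i| < b.

(** * Normal approximation for the integral over one set *)

Section one_set.
Context (G : set 'rV[R]_d) (mG : measurable G) (GA : G `<=` A).
Context (f : 'rV[R]_d -> R) (mf : measurable_fun G f) (F : R) (F_ge1 : 1 <= F).
Hypothesis f_le : forall x, G x -> `|f x| <= F.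
Hypothesis G_boundary : exists K : R, \forall r \near 0^'+,
  (lebesgue_rV R d (boundary_nbhd r G) <= (K * r)%:E)%E.

Let F_ge0 : 0 <= F. Proof. exact: le_trans F_ge1. Qed.

(** The integral T_i, written with the jointly measurable version [xs] of the score; this is how its
    measurability is obtained. *)
Definition total (l : R) (w : Omega) : R :=
  \sum_(z <- PP l w | z.1 \in G) f z.1 * xs l (z, PP l w).

Lemma xi_integral_total l : 0 < l -> xi_integral xi PP A G f l = total l.
Proof.
move=> l0; have [mxs xs0 xsE] := xsP l0.
apply/funext => w; rewrite /xi_integral Rintegral_xi_measure// /total.
rewrite big_seq_cond [RHS]big_seq_cond; apply: eq_bigr => z /andP[zX _].
by rewrite (xs_mem xsE).
Qed.

Lemma measurable_total l : 0 < l -> measurable_fun setT (total l).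
Proof.
move=> l0; have [mxs xs0 xsE] := xsP l0.
pose g (v : point * config) : R := (f \_ G) v.1.1 * xs l v.
have m11 : measurable_fun setT (fun v : point * config => v.1.1).
  by apply: measurableT_comp measurable_fst; exact: measurable_fst.
have mfG : measurable_fun setT (f \_ G) by exact/(measurable_restrictT f mG).
have mg : measurable_fun setT g.
  by apply: measurable_funM => //; exact: (measurableT_comp mfG m11).
have mX : measurable_fun setT (PP l) by exact: measurable_funPT.
have := measurableT_comp (@measurable_sum_real _ point R _ config id g (@measurable_id _ _ _) mg) mX.
congr measurable_fun; apply/funext => w; rewrite /total [RHS]big_mkcond /=.
by apply: eq_bigr => z _; rewrite /g /= /patch; case: ifP => _; rewrite ?mul0r.
Qed.

(** The power 8 is crude; it only has to be beaten by the factor l^(-20) in the probability of the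
    bad event. *)
Lemma total_moment : exists2 C : R, 0 <= C & forall l, 1 <= l ->
  (\int[P]_w (total l w ^+ 4)%:E <= (C * l ^+ 8)%:E)%E.
Proof.
have [M8 M80 hM] := uniform_moment (isT : 0 < 8)%N.
have pm0 := pois_moment_cst_ge0 R 6.
pose C := 64 * (64 * pois_moment_cst R 6 + 1) + M8.
have C0 : 0 <= C by rewrite /C; move: pm0 M80; lra.
exists (F ^+ 4 * C) => [|l l1]; first by rewrite mulr_ge0// exprn_ge0.
have l0 : 0 < l by exact: lt_le_trans l1.
have [mxs xs0 xsE] := xsP l0.
have [nu [hX nu1 nuA nuT nuB]] := poisson_intensity l0.
have mA := measurable_support.
have aE : l = fine (nu setT) by rewrite nuT.
have hm x : A x -> (\int[P]_w (xs l (inserted PP U l x w) ^+ 8)%:E <= M8%:E)%E.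
  move=> Ax; apply: le_trans (hM l x l1 Ax).
  exact: (inserted_moment nu1 U hX mxs xs0 xsE).
have := total_moment4 d_gt0 nu1 mA l0 hX U_law (U_indep l0) mxs xs0 aE M80 hm.
move=> h4; apply: (@le_trans _ _ ((F ^+ 4)%:E *
   \int[P]_w ((\sum_(z <- PP l w | z.1 \in A) xs l (z, PP l w)) ^+ 4)%:E)%E).
  have mS : measurable_fun setT (fun w => \sum_(z <- PP l w | z.1 \in A) xs l (z, PP l w)).
    pose g (v : point * config) : R := \1_A v.1.1 * xs l v.
    have m11 : measurable_fun setT (fun v : point * config => v.1.1).
      by apply: measurableT_comp measurable_fst; exact: measurable_fst.
    have mA1 : measurable_fun [set: 'rV[R]_d] (\1_A : 'rV[R]_d -> R) by exact: measurable_indic.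
    have mg : measurable_fun setT g.
      by apply: measurable_funM => //; exact: (measurableT_comp mA1 m11).
    have mX : measurable_fun setT (PP l) by exact: measurable_funPT.
    have := measurableT_comp (@measurable_sum_real _ point R _ config id g (@measurable_id _ _ _) mg) mX.
    congr measurable_fun; apply/funext => w; rewrite [RHS]big_mkcond /=.
    by apply: eq_bigr => z _; rewrite /g /= indicE; case: ifP => _; rewrite ?mul0r ?mul1r.
  rewrite -ge0_integralZl//; first last.
  - by rewrite lee_fin exprn_ge0.
  - by move=> w _; rewrite lee_fin exprn_even_ge0.
  - by apply/measurable_EFinP; exact: measurable_funX.
  apply: ge0_le_integral_any => w; first by rewrite lee_fin exprn_even_ge0.
  rewrite -EFinM lee_fin -exprMn.
  rewrite -[leLHS]ger0_norm ?exprn_even_ge0// normrX.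
  apply: lerXn2r; rewrite ?nnegrE ?mulr_ge0 ?sumr_ge0//.
  rewrite /total; apply: le_trans (ler_norm_sum _ _ _) _.
  rewrite mulr_sumr big_mkcond [leRHS]big_mkcond /=; apply: ler_sum => z _.
  case: (boolP (z.1 \in G)) => [zG|_]; last by case: ifP => // _; rewrite mulr_ge0.
  rewrite mem_set; last exact/GA/set_mem.
  by rewrite normrM ler_pM// ?f_le//; [exact: set_mem|rewrite ger0_norm].
rewrite -[F ^+ 4 * C * _]mulrA [leRHS]EFinM; apply: lee_wpmul2l; first by rewrite lee_fin exprn_ge0.
apply: le_trans h4 _; rewrite lee_fin.
have l7 : 1 <= l ^+ 7 by rewrite exprn_ege1.
have h6 : (1 + l) ^+ 6 <= 64 * l ^+ 6.
  apply: (@le_trans _ _ ((2 * l) ^+ 6)).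
    by apply: lerXn2r; rewrite ?nnegrE ?addr_ge0 ?mulr_ge0 ?(ltW l0)//; lra.
  by rewrite exprMn (_ : 2 ^+ 6 = 64)//; ring.
have l6 : 1 <= l ^+ 6 by rewrite exprn_ege1.
apply: (@le_trans _ _ (l * (C * l ^+ 6))).
  rewrite ler_pM2l// /C.
  have h1 : pois_moment_cst R 6 * (1 + l) ^+ 6 <= pois_moment_cst R 6 * (64 * l ^+ 6) by rewrite ler_wpM2l.
  have h2 : M8 <= M8 * l ^+ 6 by rewrite ler_peMr.
  by move: h1 h2 l6; lra.
have -> : l * (C * l ^+ 6) = C * l ^+ 7 by ring.
by rewrite ler_wpM2l// ler_weXn2l.
Qed.

Lemma total_fourth l : 1 <= l -> fourth_moment P (total l).
Proof.
move=> l1; split; first by apply: measurable_total; exact: lt_le_trans l1.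
by have [C _ h] := total_moment; apply: le_lt_trans (h l l1) (ltry _).
Qed.

(** The hypothesis on the boundary concerns small radii only. When 3s is not small, the number of
    all cells is used, and [K2] absorbs the lower bound e / 3 on [s]. *)
Lemma boundary_count : exists2 Kb : R, 1 <= Kb & forall s : R, 0 < s -> s <= 1 ->
  #|boundary_cells b s G|%:R * s ^+ d <= Kb * s.
Proof.
have [K] := G_boundary; rewrite near_withinE => /nbhs_ballP[e /= e0 he].
have b0 : 0 <= b by exact: ltW.
pose K2 := (2 * b + 1) ^+ d * 3 / e.
have K20 : 0 <= K2 by rewrite divr_ge0 ?(ltW e0)// mulr_ge0// exprn_ge0// addr_ge0// mulr_ge0.
exists (1 + `|K * 3| + K2) => [|s s0 s1]; first by rewrite -addrA lerDl addr_ge0.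
have [h|h] := ltP (3 * s) e.
  apply: (@le_trans _ _ (K * (3 * s))).
    apply: card_boundary_cells => //; apply: he; last by rewrite mulr_gt0.
    by rewrite -ball_normE /= sub0r normrN gtr0_norm// mulr_gt0.
  rewrite mulrA ler_pM2r//; have := ler_norm (K * 3); move: K20; lra.
apply: (@le_trans _ _ ((2 * b + 1) ^+ d)).
  apply: le_trans (card_cells d b_gt0 s0 s1).
  by rewrite ler_wpM2r ?exprn_ge0 ?(ltW s0)// ler_nat max_card.
apply: (@le_trans _ _ (K2 * s)).
  rewrite /K2 mulrAC ler_pdivlMr// -mulrA ler_wpM2l// exprn_ge0// addr_ge0// mulr_ge0//.
by rewrite ler_pM2r// lerDr addr_ge0.
Qed.

(** Scores are cut off at [y] and a cell has at most [y ^+ d.+1] points on the good event, so the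
    clamp at [F * y ^+ d.+2] is inactive there. *)
Definition centered_stat (l y : R) (c : {ffun 'I_d -> 'I_(grid_size b (side l y))}) : Omega -> R :=
  let g w := cell_stat (xs l) G f y (F * y ^+ d.+2) c (PP l w) in
  fun w => g w - Ex g.

Definition interior_sum (l y : R) : Omega -> R :=
  locsum (@centered_stat l y) (interior_cells b (side l y) G).

Lemma dep_centered_stat l y c : 0 < l -> 0 < y ->
  dep (PP l) (cells_within 1 c) (@centered_stat l y c).
Proof.
move=> l0 y0; have [mxs xs0 xsE] := xsP l0.
have K0 : 0 <= F * y ^+ d.+2 by rewrite mulr_ge0// exprn_ge0// ltW.
set e := Ex (fun w => cell_stat (xs l) G f y (F * y ^+ d.+2) c (PP l w)).
exists (fun Y => cell_stat (xs l) G f y (F * y ^+ d.+2) c Y - e).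
  apply: bmeasD; last exact: bmeas_cst.
  exact: (bmeas_cell_stat mxs mG mf).
by move=> w; rewrite /centered_stat -/e /cell_stat restr_restr.
Qed.

(** All neighbours of an interior cell are contained in [G], so the sum uses only points in cells
    inside [G]. For disjoint sets these families of cells are disjoint. *)
Lemma dep_interior_sum (l y : R) : 0 < l -> 0 < y ->
  dep (PP l) [set c : {ffun 'I_d -> 'I_(grid_size b (side l y))} | `[< cell c `<=` G >]]%SET (interior_sum l y).
Proof.
move=> l0 y0; have [nu [hX _ _ _ _]] := poisson_intensity l0.
have hdep := poisson_system b (side_gt0 l0 y0) hX.
apply: (dep_sum hdep) => c; rewrite inE => /asboolP hc.
apply: (dep_sub hdep) (dep_centered_stat c l0 y0).
by apply/fintype.subsetP => c' c'c; rewrite inE; apply/asboolP; exact: hc.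
Qed.

Lemma one_set_clt (k0 : nat) (c : R) : (0 < k0)%N -> 0 < c ->
  exists C t0 : R, [/\ 0 < C, 0 < t0 & forall l y z : R,
    1 <= l -> 1 <= y -> 1 <= z -> t0 < y -> l <= y ^+ k0 -> y ^+ d.+2 <= l ->
    l `^ (- d%:R^-1) = (z ^+ 2)^-1 -> z ^+ 2 <= l -> y <= z ^+ 2 ->
    c * l <= fine 'V_P[total l] ->
    let r := C * ((y * y ^+ d.+2) ^+ 3 / z) in r <= 1 ->
    exists Bad : set Omega, [/\ measurable Bad, fine (P Bad) <= r,
      (forall w, ~ Bad w -> `|total l w - fine 'E_P[total l] - interior_sum l y w| <=
         r * Num.sqrt (fine 'V_P[total l])) &
      forall t : R, `|fine (P [set w | interior_sum l y w <= t * Num.sqrt (fine 'V_P[total l])])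
         - std_normal_cdf t| <= r]].
Proof.
move=> k00 c0.
have [Cb [t0 [Cb0 t00 hbad]]] := bad_event k00.
have [CT CT0 hT] := total_moment.
have [Kb Kb1 hb] := boundary_count.
pose D : R := 13%:R ^+ d.
have D1 : 1 <= D by rewrite exprn_ege1// ler1n.
pose Cg := (2 * b + 1) ^+ d.
have Cg0 : 0 <= Cg by rewrite exprn_ge0// addr_ge0// mulr_ge0// ltW.
pose CQ := 8 * (CT + (Cg * F) ^+ 4).
have CQ0 : 0 <= CQ by rewrite mulr_ge0// addr_ge0// exprn_even_ge0.
(* The bound on a centred statistic is [2 * (F * p)]: [C1] combines its square with the number of
   all cells, [C2] with the number of boundary cells and the square of the dependency degree. [C4]
   collects the two contributions of the bad event to mean and variance. *)
pose C1 := 4 * F ^+ 2 * Cg; pose C2 := 4 * D ^+ 2 * F ^+ 2 * Kb.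
pose C3 := 2 * F; pose C4 := CQ + Cb.
have C10 : 0 <= C1 by rewrite mulr_ge0// mulr_ge0// exprn_ge0.
have Kb0 : 0 <= Kb by exact: le_trans Kb1.
have D0 : 0 <= D by exact: le_trans D1.
have C20 : 0 <= C2 by rewrite !mulr_ge0// exprn_ge0.
have C30 : 0 <= C3 by rewrite mulr_ge0.
have C40 : 0 <= C4 by rewrite addr_ge0.
pose C := clt_cst D k0 c C1 C2 C3 C4 Cb.
exists (1 + `|C|), t0; split => //.
move=> l y z l1 y1 z1 ty ly pl lz zl yz cv; set p := y ^+ d.+2 in pl *; move=> r r1.
have l0 : 0 < l by exact: lt_le_trans l1.
have y0 : 0 < y by exact: lt_le_trans y1.
have z0 : 0 < z by exact: lt_le_trans z1.
have p1 : 1 <= p by rewrite exprn_ege1.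
have p0 : 0 < p by exact: lt_le_trans p1.
set s := side l y.
have sE : s = y / z ^+ 2 by rewrite /s lz mulrC.
have z20 : 0 < z ^+ 2 by rewrite exprn_gt0.
have s1 : s <= 1 by rewrite sE ler_pdivrMr// mul1r.
have s0 : 0 < s by exact: side_gt0.
have [Bad [mBad PBad hBad]] := hbad l y l1 y1 ty ly s1.
have [mxs xs0 xsE] := xsP l0.
have [nu [hX nu1 nuA nuT nuB]] := poisson_intensity l0.
have hdep := poisson_system b s0 hX.
pose st (c' : {ffun 'I_d -> 'I_(grid_size b s)}) w := cell_stat (xs l) G f y (F * p) c' (PP l w) : R.
pose a := \sum_(c' : {ffun 'I_d -> 'I_(grid_size b s)}) Ex (st c').
have K0 : 0 <= F * p by rewrite mulr_ge0// ltW.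
have bst c' : bmeas (st c').
  have := bmeasD (dep_bmeas hdep (dep_centered_stat c' l0 y0)) (bmeas_cst _ (Ex (st c'))).
  by congr bmeas; apply/funext => w; rewrite /centered_stat -/(st c') subrK.
have st_le c' w : `|st c' w| <= F * p by exact: cell_stat_le.
have Est_le c' : `|Ex (st c')| <= F * p.
  apply: le_trans (Ex_norm _ (bst c')) _; rewrite -[leRHS](Ex_cst P).
  by apply: Ex_le => //; [exact: bmeas_norm|exact: bmeas_cst].
have cst_le c' w : `|@centered_stat l y c' w| <= 2 * (F * p).
  rewrite /centered_stat -/(st c'); apply: le_trans (ler_normB _ _) _.
  by apply: le_trans (lerD (st_le c' w) (Est_le c')) _; rewrite -mulr2n mulr_natl.
have cst0 c' : Ex (@centered_stat l y c') = 0.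
  by rewrite /centered_stat -/(st c') (ExB P (bst c') (bmeas_cst _ _)) Ex_cst subrr.
(* Cells that miss [G] have statistic 0, so only interior and boundary cells contribute to the
   centred sum. *)
have sumE w : \sum_c' st c' w = a + interior_sum l y w +
    locsum (@centered_stat l y) (boundary_cells b s G) w.
  rewrite -addrA [X in _ = a + X](_ : _ = \sum_c' @centered_stat l y c' w).
    rewrite /a -big_split; apply: eq_bigr => c' _.
    by rewrite /centered_stat -/(st c') /= addrC subrK.
  rewrite [RHS](bigID (mem (interior_cells b s G)))/=; congr (_ + _).
  rewrite /locsum [LHS]big_mkcond [RHS]big_mkcond /=; apply: eq_bigr => c' _.
  rewrite /boundary_cells finset.in_setD; case: (boolP (c' \in interior_cells b s G)) => //= _.
  rewrite inE; case: asboolP => // nG; apply/esym.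
  have cG : cell c' `&` G = set0 by apply/seteqP; split=> x //= hx; apply: nG; exists x.
  have st0 w' : st c' w' = 0 by exact: cell_stat0.
  rewrite /centered_stat -/(st c') /= (_ : Ex _ = 0) ?subr0 ?[LHS]st0//.
  by rewrite -[RHS](Ex_cst P 0); congr Ex; apply/funext => w'; exact: st0.
have TB w : ~ Bad w -> total l w = a + interior_sum l y w +
    locsum (@centered_stat l y) (boundary_cells b s G) w.
  move=> /hBad[h1 h2 h3]; rewrite -sumE /total.
  apply: (sum_cell_stat s0 xs0 F_ge0 (ltW y0) f_le A_box h1 h2 h3) => //.
  by rewrite -mulrA -exprS.
have cardV : #|{: {ffun 'I_d -> 'I_(grid_size b s)}}|%:R <= Cg * l by exact: card_cells_le.
have D4 : (\int[P]_w ((total l w - (a + interior_sum l y w +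
    locsum (@centered_stat l y) (boundary_cells b s G) w)) ^+ 4)%:E <= (CQ * l ^+ 8)%:E)%E.
  (* At most [Cg * l] cells, each with a statistic of at most [F * p <= F * l]. *)
  pose W4 : R := (Cg * F) ^+ 4 * l ^+ 8.
  apply: (@le_trans _ _ (\int[P]_w (8%:E * ((total l w ^+ 4)%:E + W4%:E)))%E).
    apply: ge0_le_integral_any => w; first by rewrite lee_fin exprn_even_ge0.
    rewrite -sumE -EFinD -EFinM lee_fin.
    set x := total l w; set v := \sum_c' _.
    have v4 : v ^+ 4 <= W4.
      have -> : v ^+ 4 = `|v| ^+ 4 by rewrite -normrX ger0_norm// exprn_even_ge0.
      have -> : W4 = ((Cg * l) * (F * l)) ^+ 4 by rewrite /W4; ring.
      apply: lerXn2r; rewrite ?nnegrE ?mulr_ge0 ?(ltW l0)//.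
      apply: le_trans (ler_norm_sum _ _ _) _.
      apply: (@le_trans _ _ (\sum_(c' : {ffun 'I_d -> 'I_(grid_size b s)}) (F * p))).
        by apply: ler_sum => c' _; exact: st_le.
      rewrite sumr_const -[leLHS]mulr_natl; apply: ler_pM => //.
      by rewrite ler_wpM2l.
    apply: (@le_trans _ _ (8 * (x ^+ 4 + v ^+ 4))); last by rewrite ler_pM2l// lerD2l.
    by rewrite (_ : v ^+ 4 = (- v) ^+ 4) ?expr4D_le//; ring.
  have W40 : 0 <= W4 by rewrite mulr_ge0 ?exprn_even_ge0.
  have m4 : measurable_fun setT (fun w => (total l w ^+ 4)%:E).
    by apply/measurable_EFinP; apply: measurable_funX; exact: measurable_total.
  rewrite ge0_integralZl//; first last.
  - by move=> w _; rewrite -EFinD lee_fin addr_ge0// exprn_even_ge0.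
  - by apply: emeasurable_funD => //.
  rewrite ge0_integralD//; last by move=> w _; rewrite lee_fin exprn_even_ge0.
  rewrite /CQ -[8 * _ * _]mulrA [leRHS]EFinM; apply: lee_wpmul2l => //.
  rewrite mulrDl [leRHS]EFinD; apply: leeD; first exact: hT.
  by apply: ge0_integral_le_cst.
have lz1 : 1 <= l / z ^+ 2 by rewrite ler_pdivlMr// mul1r.
have p20 : 0 <= p ^+ 2 by exact: sqr_ge0.
have hI : #|interior_cells b s G|%:R * (2 * (F * p)) ^+ 2 <= C1 * p ^+ 2 * l.
  rewrite (_ : C1 * p ^+ 2 * l = Cg * l * (2 * (F * p)) ^+ 2); last by rewrite /C1; ring.
  apply: ler_wpM2r; first exact: sqr_ge0.
  by apply: le_trans cardV; rewrite ler_nat max_card.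
have DBE : (D * (2 * (F * p))) ^+ 2 * Kb = C2 * p ^+ 2 by rewrite /C2; ring.
have DB0 : 0 <= (D * (2 * (F * p))) ^+ 2 by exact: sqr_ge0.
have hDB : (D * (2 * (F * p))) ^+ 2 <= C2 * p ^+ 2 * (l / z ^+ 2).
  rewrite -DBE -mulrA ler_peMr//.
  by rewrite -[leLHS]mulr1; apply: ler_pM.
(* The number of boundary cells is at most Kb s l / y^d. With s = y / z^2 this is Kb (l / z^2) y /
   y^d, and y <= y^d since d is positive. *)
have hB : #|boundary_cells b s G|%:R * (D * (2 * (F * p))) ^+ 2 <= C2 * p ^+ 2 * (l / z ^+ 2).
  rewrite -DBE mulrC -mulrA; apply: ler_wpM2l => //.
  have := hb s s0 s1; rewrite side_expr// => hN.
  have yd0 : 0 < y ^+ d by rewrite exprn_gt0.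
  have {}hN : #|boundary_cells b s G|%:R <= Kb * s * (l / y ^+ d).
    rewrite -(@ler_pM2r _ (y ^+ d / l)) ?divr_gt0//; apply: le_trans hN _.
    have e1 : l / y ^+ d * (y ^+ d / l) = 1 by field; rewrite !gt_eqF.
    by rewrite -[leRHS]mulrA e1 mulr1.
  apply: le_trans hN _; rewrite -mulrA; apply: ler_wpM2l => //.
  rewrite sE (_ : y / z ^+ 2 * (l / y ^+ d) = l / z ^+ 2 * (y / y ^+ d)); last by ring.
  rewrite ler_piMr ?divr_ge0 ?(ltW l0) ?(ltW z20)// ler_pdivrMr// mul1r.
  by rewrite -[leLHS]expr1 ler_weXn2l.
have lX j : (j <= 20)%N -> 1 <= l ^+ j by move=> _; rewrite exprn_ege1.
have hq : Cb / l ^+ 20 <= Cb / z.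
  apply: ler_wpM2l => //; rewrite lef_pV2 ?posrE ?exprn_gt0//.
  apply: (@le_trans _ _ l); last by rewrite -[leLHS]expr1 ler_weXn2l.
  by apply: le_trans zl; rewrite -[leLHS]expr1 ler_weXn2l.
(* The parameter h = l^(-9) turns the fourth moment of order l^8 into a term of order 1/l, while the
   probability of order l^(-20) becomes l^(-11). *)
have h0 : 0 < (l ^+ 9)^-1 by rewrite invr_gt0 exprn_gt0.
have hQ : (l ^+ 9)^-1 * (CQ * l ^+ 8) + (Cb / l ^+ 20) / (l ^+ 9)^-1 <= C4 / l.
  have -> : (l ^+ 9)^-1 * (CQ * l ^+ 8) = CQ / l by field; rewrite gt_eqF.
  have -> : (Cb / l ^+ 20) / (l ^+ 9)^-1 = Cb / l ^+ 11 by field; rewrite gt_eqF.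
  rewrite mulrDl lerD2l; apply: ler_wpM2l => //; rewrite lef_pV2 ?posrE ?exprn_gt0//.
  by rewrite -[leLHS]expr1 ler_weXn2l.
have lyk : l <= y ^+ k0.*2 by apply: le_trans ly _; rewrite ler_weXn2l// -addnn leq_addr.
have Bgt0 : 0 < 2 * (F * p) by rewrite mulr_gt0// mulr_gt0// (lt_le_trans _ F_ge1).
have hC3 : 2 * (F * p) <= C3 * p by rewrite /C3 mulrA.
have Cr : C * ((y * p) ^+ 3 / z) <= r.
  rewrite /r; apply: ler_wpM2r; last by rewrite (le_trans (ler_norm C))// lerDr.
  by rewrite divr_ge0 ?(ltW z0)// exprn_ge0// mulr_ge0 ?(ltW y0)// ltW.
have := @single_clt _ _ _ P _ _ hdep _ (@centered_stat l y) (2 * (F * p)) D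
  (interior_cells b s G) (boundary_cells b s G)
  (fun c' => dep_centered_stat c' l0 y0) cst_le cst0 D1
  (fun c' => interacting_card c') (fun c' => interacting_second_card c') Bgt0
  (total l) a (Cb / l ^+ 20) (CQ * l ^+ 8) (l ^+ 9)^-1 Bad (total_fourth l1) mBad TB PBad D4 h0
  l y z p k0 y1 z1 zl p1 lyk c C1 C2 C3 C4 Cb c0 C10 C20 C30 C40 Cb0 cv hI hB hDB hC3 hQ hq
  (le_trans Cr r1).
move=> [Bad' [mB' PB' h1 h2]]; exists Bad'; split => //.
- exact: le_trans PB' Cr.
- move=> w /h1 /le_trans; apply; apply: ler_wpM2r; first exact: sqrtr_ge0.
  exact: Cr.
- by move=> t; apply: le_trans (h2 t) Cr.
Qed.

End one_set.

End model.

(** * Choice of scales and conclusion *)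

(** The accumulated powers of y amount to y^(3(d + 3)). The exponent [delta] is chosen so that they
    use up exactly the gap [g] between 1/(2d) and 1/(2d + eps), and [k] so that [delta * k] is at
    least 1. *)
Lemma scale_exponents (R : realType) (d : nat) (eps : R) : (0 < d)%N -> 0 < eps ->
  exists (delta : R) (k : nat), [/\ 0 < delta, (0 < k)%N & forall l : R, 1 <= l ->
  let y := l `^ delta in let z := l `^ (2 * d%:R)^-1 in
  [/\ 1 <= y, 1 <= z, l <= y ^+ k & y ^+ d.+2 <= l] /\
  [/\ l `^ (- d%:R^-1) = (z ^+ 2)^-1, z ^+ 2 <= l, y <= z ^+ 2 &
    (y * y ^+ d.+2) ^+ 3 / z = l `^ (- (2 * d%:R + eps)^-1)]].
Proof.
move=> d0 e0; have dR1 : 1 <= d%:R :> R by rewrite ler1n.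
set D := d%:R : R in dR1 *.
have D2 : 0 < 2 * D by lra.
have De : 0 < 2 * D + eps by lra.
pose g := (2 * D)^-1 - (2 * D + eps)^-1.
have g0 : 0 < g by rewrite subr_gt0 ltf_pV2 ?posrE//; lra.
have gle : g <= (2 * D)^-1 by rewrite gerBl invr_ge0 ltW.
have iD : (2 * D)^-1 = D^-1 / 2 by rewrite invfM mulrC.
have D1 : D^-1 <= 1 by rewrite invf_le1//; lra.
have D10 : 0 < D^-1 by rewrite invr_gt0; lra.
have n3 : (d.+2).+1%:R = D + 3 :> R by rewrite -addn3 natrD.
have D3 : 0 < 3 * (D + 3) by lra.
pose delta := g / (3 * (D + 3)).
have de0 : 0 < delta by rewrite divr_gt0.
have deE : delta * (3 * (D + 3)) = g by rewrite /delta divfK// gt_eqF.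
pose k := (Num.truncn delta^-1).+1.
have kd : 1 <= delta * k%:R.
  by rewrite mulrC -ler_pdivrMr// mul1r ltW// truncnS_gt.
exists delta, k; split => // l l1 y z.
have l0 : 0 < l by exact: lt_le_trans l1.
have pw (a : R) (n : nat) : (l `^ a) ^+ n = l `^ (a * n%:R).
  by rewrite -powR_mulrn ?powR_ge0// -powRrM.
have le1 (a : R) : 0 <= a -> 1 <= l `^ a by move=> a0; rewrite -[leLHS](powRr0 l) ler_powR.
have lel (a : R) : a <= 1 -> l `^ a <= l by move=> a1; rewrite -[leRHS]powRr1 ?ler_powR// ltW.
have lge (a : R) : 1 <= a -> l <= l `^ a by move=> a1; rewrite -[leLHS]powRr1 ?ler_powR// ltW.
have z2E : z ^+ 2 = l `^ D^-1 by rewrite /z pw iD divfK.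
split; split.
- by apply: le1; exact: ltW.
- by apply: le1; rewrite invr_ge0 ltW.
- by rewrite /y pw; exact: lge.
- rewrite /y pw; apply: lel.
  have -> : d.+2%:R = D + 2 :> R by rewrite -addn2 natrD.
  have : delta * (D + 2) <= delta * (3 * (D + 3)) by rewrite ler_pM2l//; lra.
  by rewrite deE; lra.
- by rewrite z2E powRN.
- by rewrite z2E; exact: lel.
- rewrite z2E; apply: ler_powR => //.
  have : delta * 1 <= delta * (3 * (D + 3)) by rewrite ler_pM2l//; lra.
  by rewrite deE; lra.
- rewrite -exprS /y !pw /z -powRN -powRD; last by rewrite (gt_eqF l0) implybT.
  by congr (_ `^ _); rewrite n3; move: deE; rewrite /g; lra.
Qed.

Theorem theorem1 (R : realType) (d : nat) (d_gt0 : (0 < d)%N)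
  (dM : measure_display) (M : measurableType dM) (PM : probability M R)
  (xi : 'rV[R]_d -> M -> {fset ('rV[R]_d * M)} -> {nonneg R})
  (xi_meas : measurable_functional xi)
  (kappa : 'rV[R]_d -> R) (A : set 'rV[R]_d)
  (kappa_meas : measurable_fun setT kappa)
  (kappa_ge0 : forall x, 0 <= kappa x)
  (kappa_int1 : (\int[lebesgue_rV R d]_x (kappa x)%:E = 1)%E)
  (kappa_bounded : exists K, forall x, kappa x <= K)
  (A_support : A = closure [set x | kappa x != 0])
  (A_compact : compact A)
  (A_leb : (lebesgue_rV R d A != 0)%E)
  (dO : measure_display) (Omega : measurableType dO) (P : probability Omega R)
  (PP : R -> {RV P >-> {fset ('rV[R]_d * M)}})
  (PP_poisson : forall l, 0 < l -> poisson_process (intensity PM kappa l) (PP l))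
  (U : {RV P >-> M})
  (U_law : forall B, measurable B -> distribution P U B = PM B)
  (U_indep : forall l, 0 < l -> independent_RV U (PP l))
  (xi_stab : exponentially_stabilizing xi PP U A)
  (xi_moments : forall p : R, 1 <= p -> has_moment xi PP U A p)
  (m : nat) (m_gt0 : (0 < m)%N)
  (Gamma : 'I_m -> set 'rV[R]_d)
  (Gamma_disj : trivIset setT Gamma)
  (Gamma_meas : forall i, measurable (Gamma i))
  (Gamma_sub : forall i, Gamma i `<=` A)
  (Gamma_leb : forall i, (lebesgue_rV R d (Gamma i) != 0)%E)
  (Gamma_bd : forall i, exists K : R, \forall r \near 0^'+,
     (lebesgue_rV R d (boundary_nbhd r (Gamma i)) <= (K * r)%:E)%E)
  (f : 'I_m -> 'rV[R]_d -> R)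
  (f_meas : forall i, measurable_fun (Gamma i) (f i))
  (f_bounded : forall i, exists K, forall x, Gamma i x -> `|f i x| <= K)
  (T : 'I_m -> R -> Omega -> R)
  (T_def : forall i l, T i l = xi_integral xi PP A (Gamma i) (f i) l)
  (var_ge : forall i, exists2 c : R, 0 < c &
     \forall l \near +oo, ((c * l)%:E <= 'V_P[T i l])%E)
  (eps : R) (eps_gt0 : 0 < eps) :
  exists2 C : R, 0 < C & forall l : R, 1 <= l ->
    (ereal_sup [set `|fine (P (\bigcap_(i in setT)
          [set w | (T i l w - fine 'E_P[T i l]) / Num.sqrt (fine 'V_P[T i l])
                   <= t i]))
        - \prod_(i < m) std_normal_cdf (t i)|%:E | t in [set: 'I_m -> R]]
     <= (C * l `^ (- (2 * d%:R + eps)^-1))%:E)%E.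
Proof.
have [Kk kappa_le] := kappa_bounded.
have [b b_gt0 A_box] := support_bounded A_compact.
have [xs xsP] := scaled_version xi_meas.
have [delta [k0 [delta0 k00 scales]]] := scale_exponents d_gt0 eps_gt0.
have /choice[F hF] i : exists F : R, 1 <= F /\ forall x, Gamma i x -> `|f i x| <= F.
  have [K hK] := f_bounded i; exists (1 + `|K|); split; first by rewrite lerDl.
  move=> x Gx; apply: le_trans (hK x Gx) _.
  by apply: le_trans (ler_norm K) _; rewrite lerDr.
pose rate (l : R) := l `^ (- (2 * d%:R + eps)^-1).
pose S i l := interior_sum PP xs b (Gamma i) (f i) (F i) l (l `^ delta).
pose tot i l := total PP xs (Gamma i) (f i) l.
have TE i l : 1 <= l -> T i l = tot i l.
  move=> l1; have l0 : 0 < l by exact: lt_le_trans l1.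
  rewrite T_def; exact: (xi_integral_total PP xsP (Gamma_meas i) (@Gamma_sub i) (f_meas i)).
have tot4 i l : 1 <= l -> fourth_moment P (tot i l).
  have [F1 fF] := hF i.
  exact: (total_fourth d_gt0 kappa_meas kappa_ge0 kappa_int1 kappa_le A_support PP_poisson
    U_law U_indep xi_moments xsP (Gamma_meas i) (@Gamma_sub i) (f_meas i) F1 fF).
have /choice[l0 hl0] i : exists l0 : R, exists C : R, 0 < C /\ forall l, 1 <= l -> l0 < l ->
    C * rate l <= 1 -> 0 < fine 'V_P[tot i l] /\
    exists Bad : set Omega, [/\ measurable Bad, fine (P Bad) <= C * rate l,
      (forall w, ~ Bad w -> `|tot i l w - fine 'E_P[tot i l] - S i l w| <=
         C * rate l * Num.sqrt (fine 'V_P[tot i l])) &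
      forall t : R, `|fine (P [set w | S i l w <= t * Num.sqrt (fine 'V_P[tot i l])])
         - std_normal_cdf t| <= C * rate l].
  have [F1 fF] := hF i; have [c c0 [l1 [_ hl1]]] := var_ge i.
  have [C [t0 [C0 t00 h]]] := one_set_clt d_gt0 kappa_meas kappa_ge0 kappa_int1 kappa_le
    A_support PP_poisson U_law U_indep xi_stab xi_moments xsP b_gt0 A_box
    (Gamma_meas i) (@Gamma_sub i) (f_meas i) F1 fF (Gamma_bd i) k00 c0.
  (* Beyond the second term, y = l^delta exceeds [t0]; beyond the first, the lower bound on the
     variance holds. *)
  exists (Num.max l1 (t0 `^ delta^-1)), C; split => // l l_ge1.
  rewrite gt_max => /andP[ll1 lt0] Cr.
  have lp : 0 < l by exact: lt_le_trans l_ge1.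
  have [[y1 z1 ly pl] [lz zl yz rE]] := scales l l_ge1.
  have ty : t0 < l `^ delta.
    have := gt0_ltr_powR delta0 _ _ lt0; rewrite !nnegrE powR_ge0 (ltW lp).
    by rewrite -powRrM mulVf ?gt_eqF// powRr1 ?(ltW t00)//; apply.
  have cv : c * l <= fine 'V_P[tot i l].
    rewrite -lee_fin fineK; last exact: (variance_fin_num (tot4 i l l_ge1)).
    by rewrite -TE//; exact: hl1.
  split; first by apply: lt_le_trans cv; rewrite mulr_gt0.
  rewrite /rate -rE; apply: h => //.
  by rewrite rE.
have {hl0} /choice[Ci hCi] := hl0.
pose Cs := \sum_(i < m) Ci i.
have Ci_le i : Ci i <= Cs.
  by rewrite /Cs (bigD1 i)//= lerDl sumr_ge0// => j _; have [/ltW] := hCi j.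
pose ls := 1 + \sum_(i < m) `|l0 i|.
have l0_lt i : l0 i < ls.
  rewrite /ls (bigD1 i)//=; apply: le_lt_trans (ler_norm _) _.
  have : 0 <= \sum_(j < m | j != i) `|l0 j| by rewrite sumr_ge0.
  lra.
have ls1 : 1 <= ls by rewrite lerDl sumr_ge0.
have rate_gt0 l : 1 <= l -> 0 < rate l.
  by move=> l1; rewrite powR_gt0// (lt_le_trans _ l1).
have Cs0 : 0 <= Cs by rewrite sumr_ge0// => j _; have [/ltW] := hCi j.
have inv_ls : 0 < (rate ls)^-1 by rewrite invr_gt0 rate_gt0.
have m0 : 0 <= m%:R * (3 * Cs) by rewrite !mulr_ge0.
(* One term for each regime: the joint approximation, the case where [Cs * rate l] exceeds 1, and
   [l <= ls], where [rate] is at least [rate ls]. In the last two the trivial bound 1 on the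
   distance suffices. *)
exists (m%:R * (3 * Cs) + Cs + (rate ls)^-1) => [|l l1].
  by rewrite ltr_wpDl// addr_ge0.
apply: ge_ereal_sup => _ [t _ <-]; rewrite lee_fin -/(rate l).
have r0 := rate_gt0 l l1.
have lp : 0 < l by exact: lt_le_trans l1.
have Vm i := variance_fin_num (tot4 i l l1).
have mT i : measurable_fun setT (T i l) by rewrite TE//; have [] := tot4 i l l1.
set p := fine (P _); set q := \prod_(i < m) _.
have p01 : 0 <= p <= 1.
  have mI : measurable (\bigcap_(i in [set: 'I_m])
      [set w | (T i l w - fine 'E_P[T i l]) / Num.sqrt (fine 'V_P[T i l]) <= t i]).
    apply: fin_bigcap_measurable => [|i _]; first exact: finite_finset.
    have mf : measurable_fun setT
        (fun w => (T i l w - fine 'E_P[T i l]) / Num.sqrt (fine 'V_P[T i l])).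
      by apply: measurable_funM => //; exact: measurable_funB.
    have := mf measurableT _ (measurable_itv `]-oo, t i]); rewrite setTI.
    by congr measurable; apply/seteqP; split=> w /=; rewrite in_itv.
  by rewrite fine_ge0//= -lee_fin fineK ?probability_le1// fin_num_measure.
have q01 : 0 <= q <= 1.
  apply/andP; split; first by apply: prodr_ge0 => i _; exact: std_normal_cdf_ge0.
  apply: prodr_ile1 => i _; by rewrite std_normal_cdf_ge0 std_normal_cdf_le1.
have pq1 : `|p - q| <= 1.
  by move: p01 q01 => /andP[? ?] /andP[? ?]; rewrite ler_norml; apply/andP; split; lra.
have [lls|lls] := leP l ls.
  apply: le_trans pq1 _; apply: (@le_trans _ _ ((rate ls)^-1 * rate l)).
    rewrite mulrC ler_pdivlMr ?rate_gt0// mul1r /rate !powRN lef_pV2 ?posrE ?powR_gt0//; last first.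
      exact: lt_le_trans ls1.
    have e0 : 0 <= (2 * d%:R + eps)^-1 by rewrite invr_ge0 addr_ge0 ?mulr_ge0// ltW.
    have ln : l \is Num.nneg by rewrite nnegrE ltW.
    have lsn : ls \is Num.nneg by rewrite nnegrE (le_trans ler01 ls1).
    exact: (ge0_ler_powR e0 ln lsn lls).
  by rewrite ler_pM2r// lerDr addr_ge0.
have [Cr|Cr] := leP (Cs * rate l) 1; last first.
  apply: le_trans pq1 _; apply: le_trans (ltW Cr) _; rewrite ler_pM2r//.
  by rewrite -addrA [Cs + _]addrC addrA lerDr addr_ge0// ltW.
have Cir i : Ci i * rate l <= Cs * rate l by rewrite ler_pM2r.
have hi i := (hCi i).2 l l1 (lt_trans (l0_lt i) lls) (le_trans (Cir i) Cr).
have /choice[Bad hBad] i := (hi i).2.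
have y0 : 0 < l `^ delta by rewrite powR_gt0.
have [nu [hX _ _ _ _]] := poisson_intensity d_gt0 kappa_meas kappa_ge0 kappa_int1 kappa_le
  A_support PP_poisson lp.
have hside := side_gt0 d lp y0.
have hdep := poisson_system b hside hX.
pose UG i : {set {ffun 'I_d -> 'I_(grid_size b (l `^ (- d%:R^-1) * l `^ delta))}} :=
  [set c | `[< cell c `<=` Gamma i >]]%SET.
have depS i : dep (PP l) (UG i) (S i l).
  have [F1 fF] := hF i.
  exact: (dep_interior_sum d_gt0 kappa_meas kappa_ge0 kappa_int1 kappa_le A_support
    PP_poisson xsP b (Gamma_meas i) (f_meas i) F1 lp y0).
(* A cell is nonempty, so it cannot lie in two disjoint sets. *)
have dU i j : i != j -> disjoint (mem (UG i)) (mem (UG j)).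
  move=> ij; apply/pred0P => c /=; apply/negP; rewrite !inE => /andP[/asboolP ci /asboolP cj].
  have [v cv] := cell_nonempty hside c.
  move/trivIsetP : Gamma_disj => /(_ i j Logic.I Logic.I ij) GG.
  have : (Gamma i `&` Gamma j) v by split; [exact: ci|exact: cj].
  by rewrite GG.
have ind t' := prob_joint_indep hdep (fun I g B => @dep_indic _ _ _ _ _ _ _ _ _ _ I g B) t' depS dU.
have := @joint_approximation _ _ _ P m (fun i => T i l) (fun i => S i l)
  (fun i => fine 'E_P[T i l]) (fun i => Num.sqrt (fine 'V_P[T i l])) Bad
  (Cs * rate l) (Cs * rate l) (Cs * rate l) mT.
move=> /(_ _ _ _ _ _ _ ind _ t)/le_trans; apply.
- by move=> i; have [] := dep_bmeas hdep (depS i).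
- by move=> i; rewrite TE// sqrtr_gt0; case: (hi i).
- by move=> i; have [] := hBad i.
- by move=> i; have [_ + _ _] := hBad i; move=> /le_trans; apply.
- by rewrite mulr_ge0// ltW.
- move=> i w; have [_ _ + _] := hBad i => /[apply]; rewrite TE// => /le_trans; apply.
  by rewrite ler_wpM2r ?sqrtr_ge0.
- by move=> i t'; have [_ _ _ +] := hBad i => /(_ t'); rewrite TE// => /le_trans; apply.
have -> : Cs * rate l + Cs * rate l + Cs * rate l = 3 * Cs * rate l by ring.
by rewrite mulrA ler_pM2r// -addrA lerDl addr_ge0// ltW.
Qed.
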